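(* Let the setting, the constant $M_0$ and the extended metric functions $m^*_{\mathrm N},m^*_{\mathrm C}$ be as in the context, and let $m^*$ be either $m^*_{\mathrm N}$ or $m^*_{\mathrm C}$. There is $C>0$ such that for all $t\ge1$ and $y\in\mathbb{R}^n$ with $|y|\le M_0t$, $$2m^*(t,0,y)\le m^*(2t,0,2y)+C.$$
   Context: Let $n\ge2$ be an integer and let $\Omega\subset\mathbb{R}^n$ be an open connected set with nonempty $C^1$ boundary such that $\Omega+\mathbb{Z}^n=\Omega$; $\nu(y)$ is the outward unit normal at $y\in\partial\Omega$, $\Omega_\varepsilon:=\varepsilon\Omega$, $Y:=[-\frac12,\frac12]^n$. $H:\mathbb{R}^n\times\mathbb{R}^n\to\mathbb{R}$ is continuous, $\mathbb{Z}^n$-periodic in $y$, convex in $p$, and $\frac{|p|^2}{2}-K_0\le H(y,p)\le\frac{|p|^2}{2}+K_0$ for all $(y,p)$, for some $K_0>0$. $u_0:\mathbb{R}^n\to\mathbb{R}$ is bounded, uniformly continuous and Lipschitz. $\gamma:\partial\Omega\to\mathbb{R}^n$ is continuous, $\mathbb{Z}^n$-periodic, with $\gamma\cdot\nu>0$; $g\in C(\partial\Omega)$ is $\mathbb{Z}^n$-periodic (extended to $\mathbb{R}^n$); $\theta:\mathbb{R}^n\to[\frac{\pi}{2},\pi)$ is continuous, $\mathbb{Z}^n$-periodic, $h:=\cos\theta$. $L_{\mathrm N}(y,q,l):=\sup_{p}\{p\cdot q-H(y,p)\}-g(y)l$, $L_{\mathrm C}(y,q,l):=\sup_{p}\{p\cdot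 q-H(y,p)-h(y)l|p|\}$. Put $\beta_{\mathrm N}:=\gamma$, $\beta_{\mathrm C}:=\nu$. For $b\in\{\mathrm N,\mathrm C\}$, $\varepsilon>0$, $x\in\overline{\Omega}_\varepsilon$, $\mathrm{SP}^b_\varepsilon(x)$ is the set of $(\eta,v,l)\in\mathrm{AC}_{\rm loc}([0,\infty),\mathbb{R}^n)\times L^1_{\rm loc}([0,\infty),\mathbb{R}^n)\times L^1_{\rm loc}([0,\infty),\mathbb{R})$ with $\eta(0)=x$, $\eta(s)\in\overline{\Omega}_\varepsilon$ for all $s\ge0$, and for a.e. $s$: $\dot\eta(s)+l(s)\beta_b(\eta(s)/\varepsilon)=v(s)$, $l(s)\ge0$, and $l(s)=0$ if $\eta(s)\in\Omega_\varepsilon$ (then $l\beta_b$ is read as $0$). $\mathrm{SP}^b(x):=\mathrm{SP}^b_1(x)$. $V_b^\varepsilon(x,t):=\inf\{\int_0^tL_b(\frac{\eta}{\varepsilon},-v,-l)ds+u_0(\eta(t))\mid(\eta,v,l)\in\mathrm{SP}^b_\varepsilon(x)\}$. $M_0>0$ is a constant such that for all $\varepsilon>0$ and $(x,t)\in\overline{\Omega}_\varepsilon\times(0,\infty)$ the infimum $V_b^\varepsilon(x,t)$ is attained at some $(\eta,v,l)\in\mathrm{SP}^b_\varepsilon(x)$ with $\|\dot\eta\|_{L^\infty([0,t])}+\|l\|_{L^\infty([0,t])}\le M_0$ (such a constant is known to exist). Metric functions: for $x,y\in\overline{\Omega}$, $t\ge0$, $m_b(t,x,y):=\inf\{\int_0^tL_b(\eta(s),-v(s),-l(s))ds\mid(\eta,v,l)\in\mathrm{SP}^b(x),\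 \eta(t)=y\}$. Extended metric functions: for $x,y\in\mathbb{R}^n$, $t\ge0$, $m_b^*(t,x,y):=\inf\{m_b(t,\hat x,\hat y)\mid\hat x,\hat y\in\partial\Omega,\ \hat x-x\in Y,\ \hat y-y\in Y\}$. *)

(* Defs.v *)
From HB Require Import structures.
From mathcomp Require Import all_boot all_order all_algebra.
From mathcomp Require Import all_classical all_reals all_analysis.
Set Implicit Arguments.
Unset Strict Implicit.
Unset Printing Implicit Defensive.
Import Order.TTheory GRing.Theory Num.Theory.
Import numFieldNormedType.Exports.
Local Open Scope classical_set_scope.
Local Open Scope ring_scope.

(* The library's norm on 'rV[R]_n is the sup norm, so the Euclidean structure
   is introduced separately; both norms induce the library's topology. *)
Definition dot (R : realType) (n : nat) (u v : 'rV[R]_n) : R :=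
  \sum_(i < n) u 0 i * v 0 i.

Definition enorm (R : realType) (n : nat) (u : 'rV[R]_n) : R :=
  Num.sqrt (dot u u).

Definition Zlattice (R : realType) (n : nat) : set 'rV[R]_n :=
  [set z | exists k : 'rV[int]_n, z = map_mx intr k].

Definition unit_cell (R : realType) (n : nat) : set 'rV[R]_n :=
  [set x | forall i, - 2^-1 <= x 0 i <= 2^-1].

Definition bdry (T : topologicalType) (A : set T) : set T :=
  closure A `\` interior A.

Definition dilate (R : realType) (n : nat) (eps : R) (A : set 'rV[R]_n) :
    set 'rV[R]_n :=
  [set eps *: x | x in A].

(* Only the values on [A] matter; used with [A] stable under integer
   translations. *)
Definition Zperiodic_on (R : realType) (n : nat) (T : Type)
    (A : set 'rV[R]_n) (f : 'rV[R]_n -> T) : Prop :=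
  forall x z, A x -> Zlattice z -> f (x + z) = f x.

Definition grad (R : realType) (n : nat) (f : 'rV[R]_n -> R) (x : 'rV[R]_n) :
    'rV[R]_n :=
  \row_(i < n) 'D_(delta_mx 0 i) f x.

Definition C1_on (R : realType) (n : nat) (U : set 'rV[R]_n)
    (f : 'rV[R]_n -> R) : Prop :=
  (forall x, U x -> differentiable f x) /\
  (forall x, U x -> {for x, continuous (grad f)}).

(* [f] is a C^1 defining function of [Omega] near [y].  As the gradient does
   not vanish on [U], the boundary of [Omega] within [U] is [f = 0] and
   [Omega] lies locally on one side of it. *)
Definition local_defining (R : realType) (n : nat) (Omega : set 'rV[R]_n)
    (y : 'rV[R]_n) (f : 'rV[R]_n -> R) : Prop :=
  exists U : set 'rV[R]_n,
    [/\ open U, U y, C1_on U f, (forall x, U x -> grad f x != 0)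
      & forall x, U x -> (Omega x <-> f x < 0)].

Definition C1_boundary (R : realType) (n : nat) (Omega : set 'rV[R]_n) :
    Prop :=
  forall y, bdry Omega y -> exists f, local_defining Omega y f.

Definition is_outward_normal (R : realType) (n : nat) (Omega : set 'rV[R]_n)
    (y w : 'rV[R]_n) : Prop :=
  exists2 f, local_defining Omega y f & w = (enorm (grad f y))^-1 *: grad f y.

(* The vector is unique for [y] on a C^1 boundary; elsewhere the value is
   irrelevant. *)
Definition outward_normal (R : realType) (n : nat) (Omega : set 'rV[R]_n)
    (y : 'rV[R]_n) : 'rV[R]_n :=
  xget 0 (is_outward_normal Omega y).

Definition abs_continuous (R : realType) (n : nat) (a b : R)
    (f : R -> 'rV[R]_n) : Prop :=
  forall e : R, 0 < e -> exists2 d : R, 0 < d &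
    forall (m : nat) (u v : 'I_m -> R),
      (forall i, [/\ a <= u i, u i <= v i & v i <= b]) ->
      trivIset setT (fun i => `]u i, v i[%classic) ->
      \sum_(i < m) (v i - u i) < d ->
      \sum_(i < m) enorm (f (v i) - f (u i)) < e.

(* Elements of the spaces on [0, +oo[ are functions on R whose values at
   negative reals are irrelevant. *)
Definition ACloc (R : realType) (n : nat) (f : R -> 'rV[R]_n) : Prop :=
  forall T : R, 0 <= T -> abs_continuous 0 T f.

(* Measurability is Borel measurability; every class in L^1_loc has such a
   representative. *)
Definition L1loc (R : realType) (f : R -> R) : Prop :=
  forall T : R, 0 <= T ->
    (@lebesgue_measure R).-integrable `[0, T] (EFin \o f).

Definition L1loc_vec (R : realType) (n : nat) (f : R -> 'rV[R]_n) : Prop :=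
  forall i, L1loc (fun s => f s 0 i).

Definition Linfty_norm (R : realType) (t : R) (f : R -> R) : \bar R :=
  ('N[@lebesgue_measure R]_+oo
     [ (fun s => (f s * \1_(`[0, t]%classic) s)%:E) ])%E.

Inductive bc : Type := Neumann | Capillary.

Definition beta (R : realType) (n : nat) (Omega : set 'rV[R]_n)
    (gamma : 'rV[R]_n -> 'rV[R]_n) (b : bc) : 'rV[R]_n -> 'rV[R]_n :=
  match b with
  | Neumann => gamma
  | Capillary => outward_normal Omega
  end.

(* Under the quadratic growth of [H] both suprema are over nonempty sets
   bounded above, hence genuine real suprema. *)
Definition lagrangian (R : realType) (n : nat)
    (H : 'rV[R]_n -> 'rV[R]_n -> R) (g theta : 'rV[R]_n -> R) (b : bc)
    (y q : 'rV[R]_n) (l : R) : R :=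
  match b with
  | Neumann =>
      sup [set dot p q - H y p | p in [set: 'rV[R]_n]] - g y * l
  | Capillary =>
      sup [set dot p q - H y p - cos (theta y) * l * enorm p
          | p in [set: 'rV[R]_n]]
  end.

Definition SP (R : realType) (n : nat) (Omega : set 'rV[R]_n)
    (gamma : 'rV[R]_n -> 'rV[R]_n) (b : bc) (eps : R) (x : 'rV[R]_n)
    (eta v : R -> 'rV[R]_n) (l : R -> R) : Prop :=
  [/\ [/\ ACloc eta, L1loc_vec v & L1loc l],
      eta 0 = x,
      (forall s, 0 <= s -> closure (dilate eps Omega) (eta s))
    & {ae @lebesgue_measure R, forall s, 0 <= s ->
        [/\ derivable eta s 1,
            derive1 eta s + l s *: beta Omega gamma b (eps^-1 *: eta s) = v s,
            0 <= l s
          & dilate eps Omega (eta s) -> l s = 0]}].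

(* The integral may be +oo, whence extended real values. *)
Definition action (R : realType) (n : nat) (H : 'rV[R]_n -> 'rV[R]_n -> R)
    (g theta : 'rV[R]_n -> R) (b : bc) (eps t : R)
    (eta v : R -> 'rV[R]_n) (l : R -> R) : \bar R :=
  (\int[@lebesgue_measure R]_(s in `[0%R, t])
     (lagrangian H g theta b (eps^-1 *: eta s) (- v s) (- l s))%:E)%E.

Definition value (R : realType) (n : nat) (Omega : set 'rV[R]_n)
    (H : 'rV[R]_n -> 'rV[R]_n -> R) (u0 : 'rV[R]_n -> R)
    (gamma : 'rV[R]_n -> 'rV[R]_n) (g theta : 'rV[R]_n -> R) (b : bc)
    (eps : R) (x : 'rV[R]_n) (t : R) : \bar R :=
  ereal_inf [set c | exists eta v l, SP Omega gamma b eps x eta v l /\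
    c = (action H g theta b eps t eta v l + (u0 (eta t))%:E)%E].

Definition minimizer_bound (R : realType) (n : nat) (Omega : set 'rV[R]_n)
    (H : 'rV[R]_n -> 'rV[R]_n -> R) (u0 : 'rV[R]_n -> R)
    (gamma : 'rV[R]_n -> 'rV[R]_n) (g theta : 'rV[R]_n -> R) (b : bc)
    (M0 : R) : Prop :=
  forall (eps t : R) (x : 'rV[R]_n),
    0 < eps -> 0 < t -> closure (dilate eps Omega) x ->
    exists eta v l,
      [/\ SP Omega gamma b eps x eta v l,
          (action H g theta b eps t eta v l + (u0 (eta t))%:E)%E
            = value Omega H u0 gamma g theta b eps x t
        & (Linfty_norm t (fun s => enorm (derive1 eta s)) + Linfty_norm t l
            <= M0%:E)%E].

Definition metric (R : realType) (n : nat) (Omega : set 'rV[R]_n)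
    (H : 'rV[R]_n -> 'rV[R]_n -> R) (gamma : 'rV[R]_n -> 'rV[R]_n)
    (g theta : 'rV[R]_n -> R) (b : bc) (t : R) (x y : 'rV[R]_n) : \bar R :=
  ereal_inf [set c | exists eta v l,
    [/\ SP Omega gamma b 1 x eta v l, eta t = y
      & c = action H g theta b 1 t eta v l]].

Definition ext_metric (R : realType) (n : nat) (Omega : set 'rV[R]_n)
    (H : 'rV[R]_n -> 'rV[R]_n -> R) (gamma : 'rV[R]_n -> 'rV[R]_n)
    (g theta : 'rV[R]_n -> R) (b : bc) (t : R) (x y : 'rV[R]_n) : \bar R :=
  ereal_inf [set c | exists x' y',
    [/\ bdry Omega x', bdry Omega y', unit_cell (x' - x), unit_cell (y' - y)
      & c = metric Omega H gamma g theta b t x' y']].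

(* Main.v *)
Require Import Defs.
From HB Require Import structures.
From mathcomp Require Import all_boot all_order all_algebra fingroup perm.
From mathcomp Require Import zify ring lra.
Set Implicit Arguments.
Unset Strict Implicit.
Unset Printing Implicit Defensive.
Import Order.TTheory GRing.Theory Num.Theory.

(* A path of duration [2t] is cut into many short pieces and its pieces are
   distributed among two paths so that both get half of the duration and half of
   the displacement up to bounded errors, while the number of switches between
   the two groups stays at most [2n + 3].  This "necklace splitting" is a discrete
   octahedral Tucker lemma, proved by Fan's parity count.  Integer translations
   leave the action invariant and [Omega] is connected, so any two points of the
   closure at bounded distance are joined in unit time at bounded cost; hence
   consecutive pieces of one group can be glued at bounded cost per switch.
   The time lost in gluing is gained beforehand by replacing one stretch of
   bounded duration and bounded cost of the given path by a unit-time connection.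
   Such a stretch exists since the path may be assumed to cost at most a multiple
   of [t]; it has bounded displacement because the Lagrangian plus a constant
   dominates the speed [|eta'|], even on the boundary: testing the supremum with
   a large multiple of the normal absorbs the reflection term. *)

(** The cost is not among the quantities to be halved: the costs of the two new paths add up to the
    old cost plus a constant, so the cheaper path suffices. This leaves [n + 1] measures, time and
    the coordinates of the displacement. The mesh is dictated by the absolute continuity of the
    given path, so no bound may involve the number [q] of pieces. For this reason the Tucker labels
    also record sign alternations: [d] measures use [d] of the [q - 1] available absolute values,
    and the remaining ones force a sign vector with no majority whose twisted signs alternate at
    least [q - d] times. Such a vector changes group at most [2 * d] times and leaves at most [d]
    pieces undecided. No piece is ever cut; the price is an error of [d] pieces, each of bounded
    size. The new paths run from a boundary point [p] near the origin to a translate [p + z] near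
    [y], whatever the ends of the given path are; one last connection makes up for the bounded
    discrepancy. *)

Lemma odd_card_involution (T : finType) (A : {set T}) (f : T -> T) :
  (forall x, x \in A -> f x \in A) -> (forall x, x \in A -> f (f x) = x) ->
  (forall x, x \in A -> f x != x) -> odd #|A| = false.
Proof.
move=> fA ff fx.
(* [B] takes from each orbit of [f] the element of smaller rank, so [A] is the disjoint union of [B]
   and its image. *)
pose B := [set x in A | (enum_rank x < enum_rank (f x))%N].
have defA : A = B :|: [set f x | x in B].
  apply/setP=> x; rewrite !inE; apply/idP/orP.
    move=> xA; case: (ltngtP (enum_rank x) (enum_rank (f x))) => h.
    - by left; rewrite xA.
    - right; apply/imsetP; exists (f x); last by rewrite ff.
      by rewrite !inE fA// ff.
    - by move/val_inj/enum_rank_inj: h => h; move: (fx x xA); rewrite -h eqxx.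
  case; first by case/andP.
  by case/imsetP => y; rewrite !inE => /andP[yA _] ->; exact: fA.
have dis : [disjoint B & [set f x | x in B]].
  rewrite -setI_eq0; apply/eqP/setP => x; rewrite !inE.
  apply/negP => /andP[/andP[xA lt1]] /imsetP[y]; rewrite !inE => /andP[yA lt2] xE.
  by move: lt1; rewrite xE ff// => lt1; move: (ltn_trans lt1 lt2); rewrite ltnn.
have injB : {in B &, injective f}.
  move=> x y; rewrite !inE => /andP[xA _] /andP[yA _] e.
  by rewrite -(ff x)// e ff.
rewrite defA cardsU; move: dis; rewrite -setI_eq0 => /eqP ->.
by rewrite cards0 subn0 card_in_imset// addnn odd_double.
Qed.

(** * Fan's parity count and the octahedral Tucker lemma *)

(* A nonzero integer label of absolute value [c./2 + 1] is coded by the natural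
   number [c], whose lowest bit is the sign; [flip] is negation. *)
Definition flip (c : nat) : nat := if odd c then c.-1 else c.+1.

Fixpoint altb (b : bool) (L : seq bool) : bool :=
  if L is c :: L' then (c == b) && altb (~~ b) L' else true.

(** Sorting the codes sorts the labels by absolute value, so on a [compl_free] list this is Fan's
    condition: the signs alternate in the order of increasing absolute value, starting with [b]. *)
Definition alternates (b : bool) (L : seq nat) : bool :=
  altb b (map odd (sort leq L)).

Definition delete (i : nat) (T : Type) (L : seq T) : seq T :=
  take i L ++ drop i.+1 L.

Definition compl_free (L : seq nat) : bool :=
  all2rel (fun a b => b != flip a) L.

Lemma altb_map_negb b L : altb b (map negb L) = altb (~~ b) L.
Proof. by elim: L b => //= c L IH b; rewrite IH; case: c b => [] []. Qed.

(** If a nonempty word alternates from [b], only the deletion of its last letter is good; if it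
    alternates from [~~ b], only that of its first. A word with exactly one pair of equal neighbours
    has two good deletions or none, namely the two letters of that pair. Any other word has none. *)
Lemma altb_delete_parity b L :
  odd (\sum_(0 <= i < size L) altb b (delete i L)) = altb b L (+) altb (~~ b) L.
Proof.
elim: L b => [|c L IH] b; first by rewrite big_geq.
rewrite /= big_nat_recl// /delete/= ?take0 ?drop0 /=.
have -> : (\sum_(0 <= i < size L) altb b (c :: take i L ++ drop i.+1 L) =
           \sum_(0 <= i < size L) (c == b) * altb (~~ b) (delete i L))%N.
  by apply: eq_bigr => i _ /=; case: (c == b); rewrite ?mul1n ?mul0n.
rewrite -big_distrr/= oddD oddM IH negbK.
by case: c b => [] []; case: (altb true L); case: (altb false L).
Qed.

Lemma sort_leq_rem x (s : seq nat) : sort leq (rem x s) = rem x (sort leq s).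
Proof.
apply: (@sorted_eq _ leq leq_trans anti_leq).
- exact/sort_sorted/leq_total.
- apply: (subseq_sorted leq_trans (rem_subseq x _)).
  exact/sort_sorted/leq_total.
- rewrite perm_sort perm_sym.
  case: (boolP (x \in s)) => xs.
    rewrite -(perm_cons x) -(permPl (perm_to_rem _)) ?mem_sort// perm_sort.
    exact: perm_to_rem.
  by rewrite !rem_id ?mem_sort// perm_sort.
Qed.

Lemma perm_delete_rem x0 i (L : seq nat) : (i < size L)%N ->
  perm_eq (delete i L) (rem (nth x0 L i) L).
Proof.
move=> iL; rewrite -(perm_cons (nth x0 L i)).
rewrite -(permPr (perm_to_rem _)) ?mem_nth//.
rewrite /delete -[X in perm_eq _ X](cat_take_drop i L) (drop_nth x0 iL).
by rewrite perm_sym perm_catC/= perm_cons perm_catC.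
Qed.

(** Only the sorted list matters, so the sum over positions of [L] is reindexed by positions of the
    sorted list, where the count for words applies. *)
Lemma alternates_delete_parity b L :
  odd (\sum_(0 <= i < size L) alternates b (delete i L)) =
  alternates b L (+) alternates (~~ b) L.
Proof.
have E (s : seq nat) : (\sum_(0 <= i < size s) alternates b (delete i s) =
    \sum_(x <- s) alternates b (rem x s))%N.
  rewrite [RHS](big_nth 0%N); apply: eq_big_nat => i /andP[_ iL].
  congr (nat_of_bool (altb b (map odd _))).
  by apply/perm_sortP; [exact: leq_total|exact: leq_trans|exact: anti_leq|
                        exact: perm_delete_rem].
have srt : sort leq (sort leq L) = sort leq L.
  by apply/perm_sortP; [exact: leq_total|exact: leq_trans|exact: anti_leq|
                        rewrite perm_sort].
rewrite E -(perm_big _ (permEl (perm_sort leq L)))/=.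
have -> : (\sum_(x <- sort leq L) alternates b (rem x L) =
          \sum_(x <- sort leq L) alternates b (rem x (sort leq L)))%N.
  by apply: eq_bigr => x _; rewrite /alternates !sort_leq_rem srt.
rewrite -E {1}/alternates.
have -> : (\sum_(0 <= i < size (sort leq L)) altb b (map odd (sort leq (delete i (sort leq L))))
   = \sum_(0 <= i < size (map odd (sort leq L))) altb b (delete i (map odd (sort leq L))))%N.
  rewrite size_map; apply: eq_big_nat => i _.
  rewrite /delete -map_take -map_drop -map_cat; congr (nat_of_bool (altb b (map odd _))).
  apply: sorted_sort; first exact: leq_trans.
  apply: (subseq_sorted leq_trans _ (sort_sorted leq_total L)).
  rewrite -{3}(cat_take_drop i (sort leq L)) cat_subseq//.
  by rewrite -(add1n i) -drop_drop drop_subseq.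
by rewrite altb_delete_parity.
Qed.

Lemma flipK : involutive flip.
Proof. by move=> c; rewrite /flip; case: (boolP (odd c)) => h; case: ifP; lia. Qed.

(** [flip] exchanges the two codes of one absolute value. As [compl_free] prevents both from
    occurring, [flip] is monotone on [L] and commutes with sorting. *)
Lemma alternates_flip b L : compl_free L ->
  alternates b (map flip L) = alternates (~~ b) L.
Proof.
move=> cf.
have -> : alternates b (map flip L) = altb b (map odd (map flip (sort leq L))).
  rewrite /alternates; congr (altb b (map odd _)).
  apply: (@sorted_eq _ leq leq_trans anti_leq).
  - exact/sort_sorted/leq_total.
  - apply: (@homo_sorted_in _ _ (mem L) flip leq leq).
    + move=> x y xL yL /= xy.
      have := (allrelP cf) x y xL yL; rewrite /flip.
      by case: (boolP (odd x)); case: (boolP (odd y)); lia.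
    + by apply/allP => x; rewrite mem_sort.
    + exact/sort_sorted/leq_total.
  - by rewrite perm_sort perm_sym perm_map// perm_sort.
rewrite -map_comp (_ : map (odd \o flip) _ = map negb (map odd (sort leq L))).
  by rewrite altb_map_negb.
rewrite -map_comp; apply: eq_map => c /=; rewrite /flip.
by case: (boolP (odd c)); lia.
Qed.

(** Neighbours in the sorted list differ in sign and are not complementary, so their absolute values
    [c./2] strictly increase; only [m] values are available. *)
Lemma alternates_size b L m : compl_free L -> alternates b L ->
  all (fun c => c < m.*2)%N L -> (size L <= m)%N.
Proof.
move=> cf alt /allP lt; rewrite -(size_sort leq).
have cf' := allrelP cf.
have sub : {subset sort leq L <= L} by move=> x; rewrite mem_sort.
move: alt (sort_sorted leq_total L); rewrite /alternates.
case: (sort leq L) sub => // a s sub //= /andP[/eqP oa alt] srt.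
rewrite -oa in alt.
suff h (t : seq nat) (d : nat) : {subset d :: t <= L} -> altb (~~ odd d) (map odd t) ->
    path leq d t -> (size t + d./2 <= (last d t)./2)%N.
  have lL : last a s \in L by apply/sub/mem_last.
  have h1 : (last a s < m.*2)%N := lt _ lL.
  by have := h _ _ sub alt srt; lia.
elim: t d => //= c t IH d dsub /andP[/eqP oc dalt] /andP[dc dsrt].
have tsub : {subset c :: t <= L} by move=> x xt; apply: dsub; rewrite inE xt orbT.
have dL : d \in L by apply: dsub; rewrite inE eqxx.
have cL : c \in L by apply: dsub; rewrite !inE eqxx orbT.
have := IH c tsub; rewrite oc => /(_ dalt dsrt).
move: (cf' c d cL dL) oc dc; rewrite /flip; clear.
by case: ifP; lia.
Qed.

(** * Sign vectors and signed permutations *)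

Definition signvec (m : nat) := {ffun 'I_m -> option bool}.

Definition sv_opp m (X : signvec m) : signvec m := [ffun j => omap negb (X j)].

Definition sv_le m (A B : signvec m) : bool :=
  [forall j, (A j == None) || (A j == B j)].

Definition sv_nonzero m (X : signvec m) : bool := [exists j, X j != None].

(** An order of the coordinates with a sign for each encodes a maximal chain of nonzero sign
    vectors, that is, a facet of the barycentric subdivision of the octahedral sphere. The [i]-th
    member of the chain has the first [i] coordinates of the order as support. *)
Definition signed_perm m : finType := ({perm 'I_m} * {ffun 'I_m -> bool})%type.

Definition prefix_sv m (P : signed_perm m) (i : nat) : signvec m :=
  [ffun j => if ((P.1^-1)%g j < i)%N then Some (P.2 j) else None].

Definition prefix_labels m (lam : signvec m -> nat) (k : nat) (P : signed_perm m) : seq nat :=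
  mkseq (fun i => lam (prefix_sv P i.+1)) k.

Lemma prefix_sv_le m (P : signed_perm m) i j : (i <= j)%N ->
  sv_le (prefix_sv P i) (prefix_sv P j).
Proof.
move=> ij; apply/forallP => a; rewrite !ffunE.
by case: (ltnP _ i) => //= h; rewrite (leq_trans h ij) eqxx.
Qed.

Lemma prefix_sv_nonzero m (P : signed_perm m) i : (0 < m)%N ->
  sv_nonzero (prefix_sv P i.+1).
Proof.
move=> m0; apply/existsP; exists (P.1 (Ordinal m0)).
by rewrite ffunE permK.
Qed.

(* The maximal chains of sign vectors in the sphere [S^(k-1)] are the prefixes
   of the signed permutations in [sphere k]; the hemisphere of [S^k] where the
   last coordinate is nonnegative corresponds to [hemisphere k]. *)
Definition sphere m k : {set signed_perm m} :=
  [set P : signed_perm m | [forall j : 'I_m, (k <= j)%N ==> (P.1 j == j) && P.2 j]].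

Definition hemisphere m k : {set signed_perm m} :=
  [set P in sphere m k.+1 | [forall j : 'I_m, (k == j :> nat) ==> P.2 j]].

Section Fan.
Variables (m : nat) (lam : signvec m -> nat).
Hypothesis lam_opp : forall X, sv_nonzero X -> lam (sv_opp X) = flip (lam X).
Hypothesis lam_compl : forall A B, sv_nonzero A -> sv_le A B -> lam B != flip (lam A).

Lemma prefix_labels_compl_free k P : compl_free (prefix_labels lam k P).
Proof.
case: (posnP m) => [m0|m0].
  have E (X Y : signvec m) : X = Y by apply/ffunP => -[j jm]; exfalso; rewrite m0 in jm.
  apply/allrelP => x y /mapP[i _ ->] /mapP[j _ ->].
  rewrite (E (prefix_sv P i.+1) (prefix_sv P j.+1)) /flip; case: ifP; lia.
have nz i := prefix_sv_nonzero P i m0.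
apply/allrelP => x y /mapP[i _ ->] /mapP[j _ ->].
case: (leqP i j) => ij.
  by apply: lam_compl => //; exact: prefix_sv_le.
have h : lam (prefix_sv P i.+1) != flip (lam (prefix_sv P j.+1)).
  by apply: lam_compl => //; apply: prefix_sv_le; exact: ltnW.
by apply: contraNneq h => ->; rewrite flipK.
Qed.

Definition fan_set k : {set signed_perm m} :=
  [set P in sphere m k | alternates true (prefix_labels lam k P)].

Definition fan_hemi b k : {set signed_perm m} :=
  [set P in hemisphere m k | alternates b (prefix_labels lam k.+1 P)].

(** The antipodal map of [sphere m k]. The signs from [k] on stay fixed because membership in
    [sphere m k] normalises them to [true]. *)
Definition opp_below k (P : signed_perm m) : signed_perm m :=
  (P.1, [ffun j : 'I_m => if (j < k)%N then ~~ P.2 j else P.2 j]).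

Lemma opp_belowK k : involutive (opp_below k).
Proof.
case=> p s; congr pair; apply/ffunP => j; rewrite /= !ffunE /= ?ffunE.
by case: ifP => ->; rewrite ?negbK.
Qed.

Lemma sphere_inv_lt k P (j : 'I_m) : P \in sphere m k ->
  ((P.1^-1)%g j < k)%N = (j < k)%N.
Proof.
rewrite inE => /forallP h.
case: (ltnP j k) => jk; last first.
  have /andP[/eqP e _] := implyP (h j) jk.
  by rewrite -{1}e permK ltnNge jk.
apply/negbNE; rewrite -leqNgt; apply/negP => le.
have /andP[/eqP] := implyP (h _) le; rewrite permKV => e.
by move: le; rewrite -e leqNgt jk.
Qed.

Lemma prefix_sv_opp k i P : P \in sphere m k -> (i <= k)%N ->
  prefix_sv (opp_below k P) i = sv_opp (prefix_sv P i).
Proof.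
move=> Pk ik; apply/ffunP => j; rewrite ?ffunE/= ?ffunE/=.
case: ifP => //= h; suff -> : (j < k)%N by [].
by rewrite -(sphere_inv_lt _ Pk) (leq_trans h ik).
Qed.

Lemma prefix_labels_opp k P : (0 < m)%N -> P \in sphere m k ->
  prefix_labels lam k (opp_below k P) = map flip (prefix_labels lam k P).
Proof.
move=> m0 Pk; rewrite -map_comp; apply/eq_in_map => i; rewrite mem_iota => /= ik.
by rewrite prefix_sv_opp// lam_opp// prefix_sv_nonzero.
Qed.

(** Each facet lies in exactly one of two opposite hemispheres. The antipodal map carries the lower
    one to the upper one and negates all labels, which exchanges the signs with which the
    alternation starts. *)
Lemma card_fan_set k : (k < m)%N ->
  #|fan_set k.+1| = (#|fan_hemi true k| + #|fan_hemi false k|)%N.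
Proof.
move=> km; have m0 : (0 < m)%N by lia.
pose neg := opp_below k.+1.
have nS P : P \in sphere m k.+1 -> neg P \in sphere m k.+1.
  rewrite !inE => /forallP h; apply/forallP => j; apply/implyP => kj.
  by have /andP[-> h2] := implyP (h j) kj; rewrite ffunE ltnNge kj.
have kk (j : 'I_m) : (k == j :> nat) -> j = Ordinal km by move=> /eqP e; apply: val_inj.
rewrite -(card_imset (mem (fan_hemi false k)) (can_inj (opp_belowK k.+1))).
rewrite -cardsUI.
have -> : fan_hemi true k :&: [set opp_below k.+1 x | x in mem (fan_hemi false k)] = set0.
  apply/setP => P; rewrite in_set0; apply/negP; rewrite inE => /andP[].
  rewrite inE => /andP[]; rewrite inE => /andP[_ /forallP h] _ /imsetP[Q].
  rewrite inE => /andP[]; rewrite inE => /andP[_ /forallP h'] _ e.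
  have := implyP (h (Ordinal km)) (eqxx _); rewrite e ffunE/= ltnSn.
  by rewrite (implyP (h' (Ordinal km)) (eqxx _)).
rewrite cards0 addn0; apply: eq_card => P; rewrite in_setU.
have alt_neg Q : Q \in sphere m k.+1 ->
    alternates true (prefix_labels lam k.+1 (neg Q)) =
    alternates false (prefix_labels lam k.+1 Q).
  move=> Qk; rewrite prefix_labels_opp// alternates_flip//.
  exact: prefix_labels_compl_free.
apply/idP/orP; last first.
  case; first by rewrite !inE => /andP[/andP[-> _] ->].
  case/imsetP => Q; rewrite 2!inE => /andP[/andP[Qs _] Q3] ->.
  by rewrite /fan_set inE nS// alt_neg.
rewrite inE => /andP[Ps alt].
case: (boolP (P.2 (Ordinal km))) => Pk; [left|right].
  rewrite inE alt andbT inE Ps; apply/forallP => j; apply/implyP => /kk ->.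
  exact: Pk.
apply/imsetP; exists (neg P); last by rewrite /neg opp_belowK.
rewrite inE inE nS//= -alt_neg ?nS// /neg opp_belowK alt andbT.
apply/forallP => j; apply/implyP => /kk ->.
by rewrite ffunE/= ltnSn.
Qed.

(** Transposing the places [i] and [i.+1] of the order changes only the member of the chain whose
    label is deleted: an inner ridge belongs to exactly two facets of the hemisphere, which are
    thereby paired. *)
Lemma card_hemi_delete_even k i : (k < m)%N -> (i < k)%N ->
  odd #|[set P in hemisphere m k |
     alternates true (delete i (prefix_labels lam k.+1 P))]| = false.
Proof.
move=> km ik.
have im : (i < m)%N by lia.
have i1m : (i.+1 < m)%N by lia.
pose a := Ordinal im; pose b := Ordinal i1m.
have ab : a != b by apply/eqP => /(congr1 val)/=; lia.
pose f (P : signed_perm m) : signed_perm m := ((tperm a b * P.1)%g, P.2).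
have ff P : f (f P) = P by case: P => p s; rewrite /f/= mulgA tperm2 mul1g.
have fH P : P \in hemisphere m k -> f P \in hemisphere m k.
  rewrite !inE => /andP[/forallP h ->]; rewrite andbT.
  apply/forallP => j; apply/implyP => kj; rewrite permM tpermD ?(implyP (h j) kj)//.
    by apply/eqP => /(congr1 val)/=; lia.
  by apply/eqP => /(congr1 val)/=; lia.
have fp P j : j != i.+1 -> prefix_sv (f P) j = prefix_sv P j.
  move=> ji; apply/ffunP => c; rewrite !ffunE/= invMg permM tpermV.
  suff -> : (tperm a b ((P.1^-1)%g c) < j)%N = ((P.1^-1)%g c < j)%N by [].
  by case: tpermP => [->|->|//] /=; lia.
have fL P : delete i (prefix_labels lam k.+1 (f P)) = delete i (prefix_labels lam k.+1 P).
  rewrite /delete /prefix_labels /mkseq -!map_take -!map_drop.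
  congr (_ ++ _); apply/eq_in_map => j.
    by rewrite take_iota mem_iota => h; rewrite fp//; lia.
  by rewrite drop_iota mem_iota => h; rewrite fp//; lia.
apply: (@odd_card_involution _ _ f) => P.
- by rewrite inE => /andP[PH alt]; rewrite inE fH// fL.
- by rewrite ff.
- move=> _; apply/eqP => /(congr1 (fun Q : signed_perm m => Q.1 a)) /=.
  by rewrite permM tpermL => /perm_inj e; rewrite e eqxx in ab.
Qed.

(** Without its largest member the chain misses just the coordinate [P.1 o]. If this is not [o], its
    sign is free and flipping it pairs the facets. If it is [o], the sign is fixed by the hemisphere
    and the remaining chain is a facet of the equator [sphere m k]. *)
Lemma odd_card_hemi_delete_last k : (k < m)%N ->
  odd #|[set P in hemisphere m k |
     alternates true (delete k (prefix_labels lam k.+1 P))]| = odd #|fan_set k|.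
Proof.
move=> km; pose o := Ordinal km.
have del P : delete k (prefix_labels lam k.+1 P) = prefix_labels lam k P.
  rewrite /delete drop_oversize ?size_mkseq// cats0 /prefix_labels /mkseq -map_take.
  by rewrite take_iota (minn_idPl (leqnSn k)).
have -> : [set P in hemisphere m k | alternates true (delete k (prefix_labels lam k.+1 P))] =
  [set P in hemisphere m k | alternates true (prefix_labels lam k P) & P.1 o != o] :|: fan_set k.
  apply/setP => P; rewrite inE del in_setU inE [P \in fan_set _]inE.
  have -> : (P \in sphere m k) = (P \in hemisphere m k) && (P.1 o == o).
    rewrite !inE; apply/forallP/andP => [h|[/andP[/forallP h1 /forallP h2] h3] j].
      split; last by have /andP[] := implyP (h o) (leqnn k).
      apply/andP; split; apply/forallP => j; apply/implyP => kj.
        by apply: (implyP (h j)); exact: ltnW.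
      by have /andP[] := implyP (h j) (eq_leq (eqP kj)).
    apply/implyP; rewrite leq_eqVlt => /orP[kj|kj]; last exact: (implyP (h1 j)).
    rewrite (implyP (h2 j) kj) andbT.
    by rewrite (_ : j = o)//; apply: val_inj; rewrite /= -(eqP kj).
  by case: (P \in _); case: (P.1 o == o); case: (alternates _ _).
rewrite cardsU (_ : _ :&: _ = set0) ?cards0 ?subn0; last first.
  apply/setP => P; rewrite !inE; apply/negP => /andP[/and3P[_ _ h] /andP[/forallP h' _]].
  by have /andP[e _] := implyP (h' o) (leqnn k); rewrite e in h.
rewrite oddD [X in X (+) _](_ : _ = false)//.
pose f (P : signed_perm m) : signed_perm m :=
  (P.1, [ffun j => if j == P.1 o then ~~ P.2 j else P.2 j]).
have Plt P : P \in hemisphere m k -> P.1 o != o -> (P.1 o < k)%N.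
  move=> PH Po.
  have := PH; rewrite inE => /andP[Ps _].
  have := sphere_inv_lt (P.1 o) Ps; rewrite permK/= ltnSn => /esym.
  rewrite ltnS leq_eqVlt => /orP[|//] /eqP e.
  by case/eqP: Po; apply: val_inj.
apply: (@odd_card_involution _ _ f) => P.
- rewrite inE => /and3P[PH alt Po]; have lt := Plt P PH Po.
  rewrite inE; apply/and3P; split => //.
    move: PH; rewrite !inE => /andP[/forallP h1 /forallP h2].
    apply/andP; split; apply/forallP => j; apply/implyP => kj;
      rewrite ffunE (_ : (j == P.1 o) = false).
    - exact: (implyP (h1 j)).
    - by apply/eqP => e; move: lt; rewrite -e; lia.
    - exact: (implyP (h2 j)).
    - by apply/eqP => e; move: lt; rewrite -e; lia.
  rewrite (_ : prefix_labels lam k (f P) = prefix_labels lam k P)//.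
  apply/eq_in_map => i; rewrite mem_iota => /= ik; congr lam.
  apply/ffunP => j; rewrite ?ffunE/= ?ffunE/=; case: ifP => // h.
  case: eqP => // e; rewrite e permK /= in h; lia.
- move=> _; case: P => p s; congr pair; apply/ffunP => j; rewrite /= !ffunE /= ?ffunE.
  by case: ifP => ->; rewrite ?negbK.
- move=> _; apply/eqP => /(congr1 (fun Q : signed_perm m => Q.2 (P.1 o))) /=.
  by rewrite ffunE eqxx; case: (P.2 _).
Qed.

(** Double counting of the pairs of a facet of the hemisphere and an alternating ridge in it.
    Counted by facets, the parity is that of the facets alternating from either sign; counted by the
    deleted place, all but the last contribute evenly and the last gives the equator. *)
Lemma odd_card_fan_set_step k : (k < m)%N ->
  odd #|fan_set k.+1| = odd #|fan_set k|.
Proof.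
move=> km; rewrite card_fan_set// oddD.
pose S := (\sum_(P in hemisphere m k) \sum_(0 <= i < k.+1)
  alternates true (delete i (prefix_labels lam k.+1 P)))%N.
have cE (p : pred (signed_perm m)) :
    #|[set P in hemisphere m k | p P]| = (\sum_(P in hemisphere m k) p P)%N.
  rewrite -sum1_card big_mkcond [RHS]big_mkcond/=.
  by apply: eq_bigr => P _; rewrite inE; case: (P \in _); case: (p P).
transitivity (odd S).
  rewrite /S !cE !(big_morph odd oddD (erefl (odd 0))) -big_split/=.
  apply: eq_bigr => P _.
  have := alternates_delete_parity true (prefix_labels lam k.+1 P).
  by rewrite size_mkseq => ->; rewrite !oddb.
rewrite /S exchange_big/= big_nat_recr//= oddD -cE odd_card_hemi_delete_last//.
rewrite (big_morph odd oddD (erefl (odd 0))) big_nat big1 // => i /andP[_ ik].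
by rewrite -cE card_hemi_delete_even.
Qed.

Lemma odd_card_fan_set k : (k <= m)%N -> odd #|fan_set k|.
Proof.
elim: k => [_|k IH km]; last by rewrite odd_card_fan_set_step// IH// ltnW.
(* The sphere of dimension [-1] has a single facet, the empty chain, whose empty list of labels
   alternates. *)
suff -> : fan_set 0 = [set (1%g, [ffun => true])] by rewrite cards1.
apply/setP => -[p s]; rewrite !inE andbT xpair_eqE.
apply/forallP/andP => [h|[/eqP -> /eqP ->] j]; last by rewrite perm1 ffunE eqxx.
split; apply/eqP.
  by apply/permP => j; rewrite perm1; have /andP[/eqP] := h j.
by apply/ffunP => j; rewrite ffunE; have /andP[_] := h j.
Qed.

End Fan.

(** Without a complementary pair Fan's count is odd, hence some facet carries [m] alternating
    labels; these need [m] distinct absolute values, but only [m.-1] exist. *)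
Theorem octahedral_tucker m (lam : signvec m -> nat) : (0 < m)%N ->
  (forall X, sv_nonzero X -> lam (sv_opp X) = flip (lam X)) ->
  (forall X, sv_nonzero X -> lam X < m.-1.*2)%N ->
  exists A B, [/\ sv_nonzero A, sv_le A B & lam B = flip (lam A)].
Proof.
move=> m0 lopp llt.
have [/existsP[A /existsP[B /and3P[a b /eqP c]]]|no] := boolP
  [exists A, exists B, [&& sv_nonzero A, sv_le A B & lam B == flip (lam A)]].
  by exists A, B.
exfalso.
have lc A B : sv_nonzero A -> sv_le A B -> lam B != flip (lam A).
  move=> a b; apply: contra no => c; apply/existsP; exists A; apply/existsP.
  by exists B; apply/and3P.
have := odd_card_fan_set lopp lc (leqnn m).
have [-> |[P]] := set_0Vmem (fan_set lam m); first by rewrite cards0.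
rewrite inE => /andP[_ alt] _.
have := @alternates_size _ _ m.-1 (prefix_labels_compl_free lc m P) alt.
rewrite size_mkseq => h.
suff : (m <= m.-1)%N by lia.
apply: h; apply/allP => x /mapP[i _ ->].
exact/llt/prefix_sv_nonzero.
Qed.

(** * Discrete halving with few cuts *)

(** The greatest length of an alternating subsequence starting with [b], entries [None] being
    skipped. *)
Fixpoint altlen (b : bool) (y : seq (option bool)) : nat :=
  if y is h :: t then
    if h == Some b then maxn (altlen b t) (altlen (~~ b) t).+1 else altlen b t
  else 0.

Definition altnum (y : seq (option bool)) : nat :=
  maxn (altlen true y) (altlen false y).

Lemma altlen_mono (T : Type) (f h : T -> option bool) (s : seq T) b :
  (forall j, (f j == None) || (f j == h j)) ->
  (altlen b (map f s) <= altlen b (map h s))%N.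
Proof.
move=> fh; elim: s b => //= j s IH b.
have := fh j => /orP[/eqP ->|/eqP ->] /=.
  have := IH b; case: ifP => // _ h1; exact: leq_trans h1 (leq_maxl _ _).
by have := IH b; have := IH (~~ b); case: ifP => //; lia.
Qed.

Lemma altlen_negb b y : altlen b (map (omap negb) y) = altlen (~~ b) y.
Proof.
elim: y b => //= h t IH b; rewrite !IH.
by case: h b => [[]|] [].
Qed.

(** Dropping the first letter of an alternating subsequence changes its starting sign. Hence a
    nonzero sequence has a definite sign, that of its longest alternating subsequences, which can
    serve as the sign of a label. *)
Lemma altlen_diff y : (altlen true y = (altlen false y).+1)%N \/
  (altlen false y = (altlen true y).+1)%N \/
  (altnum y = 0%N /\ all (pred1 None) y).
Proof.
rewrite /altnum; elim: y => [|h t IH] /=; first by right; right.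
by case: h => [[]|] /=; [lia|lia|exact: IH].
Qed.

Lemma altnum_count y : (count (pred1 None) y + altnum y <= size y)%N.
Proof.
rewrite /altnum; elim: y => //= h t IH.
by case: h => [[]|] /=; lia.
Qed.

Definition opposite (a b : option bool) : bool :=
  (a != None) && (b == omap negb a).

Fixpoint breaks (y : seq (option bool)) : nat :=
  if y is a :: t then
    (if t is b :: _ then ~~ opposite a b : nat else 0) + breaks t
  else 0.

(** Two neighbours that both belong to a longest alternating subsequence are opposite, so every
    break touches an omitted entry. An omitted entry touches at most two pairs, and only one if it
    comes first, which explains the term for [a == None]. *)
Lemma breaks_altnum a y :
  (breaks (a :: y) + (a == None) + (altnum (a :: y)).*2 <= (size (a :: y)).*2)%N.
Proof.
elim: y a => [|b t IH] a; first by case: a => [[]|].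
have := IH b; rewrite /altnum.
by case: a => [[]|]; case: b => [[]|]; rewrite /opposite /=; lia.
Qed.

Lemma sum_opposite_breaks (y : seq (option bool)) :
  (\sum_(0 <= j < (size y).-1) ~~ opposite (nth None y j) (nth None y j.+1) =
   breaks y)%N.
Proof.
elim: y => [|a [|b t] IH]; [by rewrite big_geq..|].
rewrite [size _]/= [breaks _]/(_ + breaks (b :: t))%N -IH.
by rewrite big_nat_recl.
Qed.

Definition sv_ext m (X : signvec m) (j : nat) : option bool :=
  if insub j is Some i then X i else None.

(* Flipping every other sign turns constant blocks into alternating ones. *)
Definition twist m (X : signvec m) : seq (option bool) :=
  mkseq (fun j => omap (addb (odd j)) (sv_ext X j)) m.

Lemma sv_extE m (X : signvec m) (j : 'I_m) : sv_ext X j = X j.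
Proof. by rewrite /sv_ext; case: insubP => [i _ /val_inj ->|]; rewrite ?ltn_ord. Qed.

Lemma twist_opp m (X : signvec m) : twist (sv_opp X) = map (omap negb) (twist X).
Proof.
rewrite /twist -map_comp; apply: eq_map => j /=; rewrite /sv_ext.
by case: insub => //= i; rewrite ffunE; case: (X i) => //= c; rewrite addbN.
Qed.

Lemma altlen_twist_le m (A B : signvec m) b : sv_le A B ->
  (altlen b (twist A) <= altlen b (twist B))%N.
Proof.
move=> /forallP le; apply: altlen_mono => j; rewrite /sv_ext.
case: insub => //= i; have := le i.
by case: (A i) => //= a /eqP <-; rewrite eqxx.
Qed.

(** The group can change only between unequal neighbours of [X], and unequal neighbours are not
    opposite after twisting. Undecided entries are put into the second group. *)
Lemma sum_changes_le m (X : signvec m) : (0 < m)%N ->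
  (\sum_(0 <= j < m.-1)
     ((sv_ext X j == Some true) != (sv_ext X j.+1 == Some true)) +
   (altnum (twist X)).*2 <= m.*2)%N.
Proof.
move=> m0; have sz : size (twist X) = m by rewrite size_mkseq.
have := sum_opposite_breaks (twist X); rewrite sz => E.
have B : (breaks (twist X) + (altnum (twist X)).*2 <= m.*2)%N.
  case: (twist X) sz => [|a y] sz; first by move: m0; rewrite -sz.
  by have := breaks_altnum a y; rewrite sz; lia.
apply: leq_trans B; rewrite leq_add2r -E big_nat [leqRHS]big_nat.
apply: leq_sum => j /andP[_ jq]; rewrite !nth_mkseq; [|lia|lia].
rewrite /opposite /=.
by case: (sv_ext X j) => [[]|]; case: (sv_ext X j.+1) => [[]|] //=; case: (odd j).
Qed.

Section Halving.
Local Open Scope ring_scope.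
Variables (R : realFieldType) (d q : nat) (w : 'I_d -> nat -> R) (M : R).
Hypothesis w_ge0 : forall i j, 0 <= w i j.
Hypothesis w_le : forall i j, w i j <= M.

Let total i : R := \sum_(j < q) w i j.
Let part (X : signvec q) (b : bool) i : R := \sum_(j < q | X j == Some b) w i j.
Let decided (X : signvec q) i : bool :=
  (total i / 2 < part X true i) || (total i / 2 < part X false i).

Let part_le A B b i : sv_le A B -> part A b i <= part B b i.
Proof.
move=> /forallP le; rewrite /part [leLHS]big_mkcond [leRHS]big_mkcond/=.
apply: ler_sum => j _; have := le j.
case: (A j) => [a|_]; last by case: ifP.
by move=> /= /eqP <-; case: ifP.
Qed.

Let part_total X i : part X true i + part X false i + \sum_(j < q | X j == None) w i j = total i.
Proof.
rewrite /part /total [X in X + _ + _]big_mkcond [X in _ + X + _]big_mkcond.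
rewrite [X in _ + X]big_mkcond -!big_split/=; apply: eq_bigr => j _.
by case: (X j) => [[]|] /=; rewrite ?addr0 ?add0r.
Qed.

Let part_opp X b i : part (sv_opp X) b i = part X (~~ b) i.
Proof.
by apply: eq_bigl => j; rewrite ffunE; case: (X j) b => [[]|] [].
Qed.

Let part_excl X b i : total i / 2 < part X b i -> ~~ (total i / 2 < part X (~~ b) i).
Proof.
move=> h; apply/negP => h'; have := part_total X i.
have : 0 <= \sum_(j < q | X j == None) w i j by apply: sumr_ge0.
have : total i = total i / 2 + total i / 2 by rewrite -splitr.
by case: b h h' => /= *; lra.
Qed.

(** If a group of [X] holds more than half of some measure [i], the label is [i] shifted into the
    top [d] absolute values, signed by that group. Otherwise it is the alternation number minus one,
    signed by the start of the longest alternation. If the alternation number always stayed below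
    [q - d], the two ranges would be disjoint and lie below [q.-1], one value too few for Tucker's
    lemma. *)
Let lam (X : signvec q) : nat :=
  if [pick i | decided X i] is Some i then
    ((q.-1 - d + i).*2 + (total i / 2 < part X true i)%R)%N
  else ((altnum (twist X)).-1.*2 + (altlen false (twist X) < altlen true (twist X)))%N.

Lemma exists_undecided : (d < q)%N ->
  exists X : signvec q, [/\ forall i, part X true i <= total i / 2,
    forall i, part X false i <= total i / 2 & (q - d <= altnum (twist X))%N].
Proof.
move=> dq.
have [/existsP[X /and3P[/forallP h1 /forallP h2 h3]]|no] := boolP
  [exists X : signvec q, [&& [forall i, part X true i <= total i / 2],
   [forall i, part X false i <= total i / 2] & (q - d <= altnum (twist X))%N]].
  by exists X.
exfalso.
have small X : (forall i, decided X i = false) -> (altnum (twist X) < q - d)%N.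
  move=> h; rewrite ltnNge; apply: contra no => h3; apply/existsP; exists X.
  rewrite h3 andbT; apply/andP; split; apply/forallP => i; rewrite leNgt;
    by apply/negP => h'; have := h i; rewrite /decided h' ?orbT.
have nz (X : signvec q) : sv_nonzero X -> (0 < altnum (twist X))%N.
  case/existsP => j Xj; have [h|[h|[_ /allP h]]] := altlen_diff (twist X).
  - by rewrite /altnum h; lia.
  - by rewrite /altnum h; lia.
  have /h : omap (addb (odd j)) (sv_ext X j) \in twist X.
    by apply/map_f; rewrite mem_iota/=.
  by rewrite sv_extE; case: (X j) Xj.
have dopp X : decided (sv_opp X) =1 decided X.
  by move=> i; rewrite /decided !part_opp orbC.
have lopp X : sv_nonzero X -> lam (sv_opp X) = flip (lam X).
  move=> Xnz; rewrite /lam (eq_pick (dopp X)).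
  case: pickP => [i Di|_].
    rewrite part_opp/= /flip; move: Di; rewrite /decided => /orP[] Di.
      by rewrite Di (negPf (part_excl Di)) /=; case: ifP; lia.
    by rewrite Di (negPf (part_excl Di)) /=; case: ifP; lia.
  have := nz _ Xnz; rewrite twist_opp /altnum !altlen_negb/= /flip.
  by have [->|[->|[]]] := altlen_diff (twist X); rewrite /altnum; case: ifP; lia.
have llt X : sv_nonzero X -> (lam X < q.-1.*2)%N.
  rewrite /lam => Xnz; case: pickP => [i _|und]; first by have := ltn_ord i; lia.
  by have := small X und; have := nz X Xnz; case: (altlen _ _ < _)%N; lia.
have [A [B [Anz AB]]] := octahedral_tucker (leq_ltn_trans (leq0n d) dq) lopp llt.
have Bnz : sv_nonzero B.
  move: Anz => /existsP[j Aj]; apply/existsP; exists j.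
  by move/forallP: AB => /(_ j); rewrite (negPf Aj) => /eqP <-.
have flip_half a (x : bool) b (y : bool) : (a.*2 + x)%N = flip (b.*2 + y) -> a = b /\ x = ~~ y.
  by rewrite /flip; case: x; case: y; case: ifP; lia.
(* A majority in [A] persists in the larger vector [B], so two measure labels cannot be opposite.
   Mixed labels lie in disjoint ranges. For two alternation labels, equal alternation numbers with
   opposite starting signs would contradict the monotonicity of [altlen]. *)
rewrite /lam; case: pickP => [i Di|und]; case: pickP => [i' Di'|und'].
- move=> /flip_half[ii' s].
  have {}ii' : i = i' by apply: ord_inj; lia.
  subst i'; case: (boolP (total i / 2 < part A true i)) s => Ai.
    by rewrite (lt_le_trans Ai (part_le _ _ AB)).
  move: Di'; rewrite /decided (negPf Ai)/= => Di' s.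
  by move/(@part_excl B false) : (lt_le_trans Di' (part_le false i AB)); rewrite s.
- by move=> /flip_half[]; have := small _ und'; have := nz _ Anz; have := ltn_ord i; lia.
- by move=> /flip_half[]; have := small _ und; have := nz _ Bnz; lia.
- move=> /flip_half[]; have := nz _ Anz; have := nz _ Bnz.
  have := altlen_twist_le true AB; have := altlen_twist_le false AB.
  rewrite /altnum; have [->|[->|[]]] := altlen_diff (twist A); 
  have [->|[->|[]]] := altlen_diff (twist B); rewrite /altnum; lia.
Qed.

(** Neither group of [X] exceeds half of any measure, and at most [d] entries, each of weight at
    most [M], are undecided. Hence the first group falls short of one half by at most [d%:R * M]. *)
Theorem halving : exists x : nat -> bool,
  (\sum_(0 <= j < q) (x j != x j.+1) <= d.*2.+1)%N /\
  forall i, `|\sum_(0 <= j < q | x j) w i j - (\sum_(0 <= j < q) w i j) / 2| <= d%:R * M.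
Proof.
have [qd|dq] := leqP q d.
  exists xpred0; split; first by rewrite big1.
  move=> i; rewrite big_pred0// sub0r normrN ger0_norm ?divr_ge0 ?sumr_ge0//.
  have : \sum_(0 <= j < q) w i j <= d%:R * M.
    rewrite (le_trans (ler_sum _ (fun j _ => w_le i j)))//.
    by rewrite sumr_const_nat subn0 -[leLHS]mulr_natl ler_wpM2r
        ?(le_trans (w_ge0 i 0%N) (w_le i 0%N))// ler_nat.
  have : 0 <= d%:R * M by rewrite mulr_ge0 ?(le_trans (w_ge0 i 0%N) (w_le i 0%N)).
  by lra.
have [X [Xt Xf alt]] := exists_undecided dq.
pose x j := sv_ext X j == Some true.
have sz : size (twist X) = q by rewrite size_mkseq.
exists x; split.
  have := sum_changes_le X (leq_ltn_trans (leq0n d) dq).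
  (* The sum over [j < q] also compares the last entry with [x q], which is false by default; this
     gives the extra one in [d.*2.+1]. *)
  have : (\sum_(0 <= j < q) (x j != x j.+1) <=
          \sum_(0 <= j < q.-1) (x j != x j.+1) + 1)%N.
    by case: (q) dq => // k _; rewrite big_nat_recr//= leq_add//; case: eqP.
  by rewrite /x; lia.
move=> i.
have -> : \sum_(0 <= j < q | x j) w i j = part X true i.
  by rewrite big_mkord; apply: eq_bigl => j; rewrite /x sv_extE.
rewrite big_mkord -/(total i).
have cN : (#|[pred j | X j == None]| <= d)%N.
  have := altnum_count (twist X); rewrite sz.
  suff -> : count (pred1 None) (twist X) = #|[pred j | X j == None]| by lia.
  rewrite /twist count_map -[#|_|]sum1_card -sum1_count.
  rewrite -val_enum_ord big_map big_enum_cond/=.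
  by apply: eq_bigl => j /=; rewrite sv_extE inE; case: (X j).
have N : \sum_(j < q | X j == None) w i j <= d%:R * M.
  rewrite (le_trans (ler_sum _ (fun (j : 'I_q) _ => w_le i j)))//.
  by rewrite sumr_const -[leLHS]mulr_natl ler_wpM2r
        ?(le_trans (w_ge0 i 0%N) (w_le i 0%N))// ler_nat.
have := part_total X i; have := Xt i; have := Xf i.
move: N; set s := \sum_(j < q | _) _; move: (total i) (part _ _ _) (part _ _ _) s.
move=> a p1 p2 s h1 h2 h3 h4; rewrite ler_norml; apply/andP; split; lra.
Qed.

End Halving.

From mathcomp Require Import all_classical all_reals all_analysis.
From mathcomp Require Import measurable_realfun.
Import numFieldNormedType.Exports.
Local Open Scope classical_set_scope.
Local Open Scope ring_scope.

(** * Integrals on intervals *)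

Section AeIntegral.
Context d (T : measurableType d) (R : realType) (mu : {measure set T -> \bar R}).
Local Open Scope ereal_scope.
Import HBNNSimple.

(** The integral is a supremum over simple functions. A simple function below [f] lies below [h]
    almost everywhere, and one below [h], cut off to zero on [N], lies below [f]. *)
Let ge0_ae_eq_integralT (f h : T -> \bar R) (N : set T) :
  measurable N -> mu N = 0 -> (forall x, ~ N x -> f x = h x) ->
  (forall x, 0 <= f x) -> (forall x, 0 <= h x) -> measurable_fun setT h ->
  \int[mu]_x f x = \int[mu]_x h x.
Proof.
move=> mN N0 fh f0 h0 mh; apply/eqP; rewrite eq_le; apply/andP; split.
  rewrite [leLHS]ge0_integralTE//; apply: ge_ereal_sup => _ [k /= kf <-].
  rewrite -integralT_nnsfun; apply: ae_ge0_le_integral => //.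
  - by move=> x _; rewrite lee_fin.
  - by apply/measurable_EFinP; exact: measurable_funP.
  - exists N; split => // x /= /not_implyP[_ hk]; apply: contrapT => Nx.
    by apply: hk; rewrite -fh.
have mNc : measurable (~` N) by exact: measurableC.
rewrite (@ge0_negligible_integral _ _ _ mu setT N)// setTD.
rewrite integral_mkcond [leLHS]ge0_integralTE; last first.
  by move=> x; rewrite patchE; case: ifP.
rewrite [leRHS]ge0_integralTE//; apply: le_ereal_sup => _ [k /= kf <-].
exists k => //= x; apply: (le_trans (kf x)); rewrite patchE.
by case: ifPn => // /[!inE] /fh ->.
Qed.

(* [f] need not be measurable: the library's integral is total, and it ignores
   null sets even so. *)
Lemma ae_eq_integral_nonmeasurable (D : set T) (f h : T -> \bar R) :
  measurable D -> measurable_fun D h ->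
  {ae mu, forall x, D x -> f x = h x} ->
  \int[mu]_(x in D) f x = \int[mu]_(x in D) h x.
Proof.
move=> mD mh [N [mN N0 sub]].
have fh x : ~ N x -> (f \_ D) x = (h \_ D) x.
  move=> Nx; rewrite !patchE; case: ifPn => // /[!inE] Dx.
  by apply: contrapT => ne; apply/Nx/sub => /= /(_ Dx).
have mhD : measurable_fun setT (h \_ D) by apply/(measurable_restrictT _ mD).1.
rewrite integral_mkcond [RHS]integral_mkcond integralE [RHS]integralE.
congr (_ - _); apply: (ge0_ae_eq_integralT mN N0) => //.
- by move=> x /fh fhx; rewrite !funepos.unlock fhx.
- exact: measurable_funepos.
- by move=> x /fh fhx; rewrite !funeneg.unlock fhx.
- exact: measurable_funeneg.
Qed.

End AeIntegral.

Section Intervals.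
Variable R : realType.
Local Notation mu := (@lebesgue_measure R).
Implicit Types (a b c : R) (f : R -> R).

Definition integrable_on a b f : Prop := mu.-integrable `[a, b] (EFin \o f).
Definition integral_on a b f : R := \int[mu]_(s in `[a, b]) f s.

Lemma integrable_onS a b a' b' f : a <= a' -> b' <= b ->
  integrable_on a b f -> integrable_on a' b' f.
Proof.
move=> aa bb; apply: integrableS => //; apply: subset_itv; rewrite bnd_simp//.
Qed.

Lemma integrable_on_measurable a b f : integrable_on a b f ->
  measurable_fun `[a, b] f.
Proof. by move=> /measurable_int /measurable_EFinP. Qed.

Lemma itv_split a b c : a <= b -> b <= c ->
  `[a, c]%classic = `[a, b]%classic `|` `]b, c]%classic.
Proof.
by move=> ab bc; rewrite -itv_bndbnd_setU// bnd_simp.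
Qed.

Lemma integral_on_split a b c f : a <= b -> b <= c -> integrable_on a c f ->
  integral_on a c f = integral_on a b f + integral_on b c f.
Proof.
move=> ab bc fi; rewrite /integral_on {1}(itv_split ab bc).
rewrite Rintegral_setU//=.
- congr (_ + _); rewrite Rintegral_itv_obnd_cbnd//.
  by apply: integrableS fi => //; apply: subset_itv; rewrite bnd_simp.
- by rewrite -itv_split.
- rewrite disj_set2E; apply/eqP/seteqP; split => // x [] /=.
  by rewrite !in_itv/= => /andP[_ xb] /andP[bx _]; lra.
Qed.

Lemma integrable_on_glue a b c f : a <= b -> b <= c ->
  integrable_on a b f -> mu.-integrable `]b, c] (EFin \o f) -> integrable_on a c f.
Proof.
move=> ab bc f1 f3; rewrite /integrable_on (itv_split ab bc).
have mf : measurable_fun (`[a, b] `|` `]b, c]) f.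
  apply/measurable_funU => //; split; first exact: integrable_on_measurable f1.
  by apply/measurable_EFinP; exact: measurable_int f3.
apply/integrableP; split; first exact/measurable_EFinP.
rewrite ge0_integral_setU//=.
- by rewrite lte_add_pinfty//; [have /integrableP[] := f1|have /integrableP[] := f3].
- by apply/measurable_EFinP; exact: measurableT_comp.
- rewrite disj_set2E; apply/eqP/seteqP; split => // x [] /=.
  by rewrite !in_itv/= => /andP[_ xb] /andP[bx _]; lra.
Qed.

Lemma integrable_on_ae a b f h : measurable_fun `[a, b] h ->
  {ae mu, forall s, a <= s <= b -> f s = h s} ->
  integrable_on a b f -> integrable_on a b h.
Proof.
move=> mh fh fi; apply/integrableP; split; first exact/measurable_EFinP.
have /integrableP[mf fin] := fi; apply: le_lt_trans fin; apply: ae_ge0_le_integral => //=.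
- by apply/measurable_EFinP; exact: measurableT_comp.
- by apply/measurable_EFinP; apply: measurableT_comp => //; exact/measurable_EFinP.
- case: fh => N [mN N0 sub]; exists N; split => // x /= /not_implyP[xab h'].
  apply: sub => /= fh; apply: h'; rewrite -fh//; by move: xab; rewrite in_itv/=.
Qed.

Lemma integral_on_ae a b f h : measurable_fun `[a, b] f -> measurable_fun `[a, b] h ->
  {ae mu, forall s, a <= s <= b -> f s = h s} ->
  integral_on a b f = integral_on a b h.
Proof.
move=> mf mh [N [mN N0 sub]]; congr fine; apply: ae_eq_integral => //.
- exact/measurable_EFinP.
- exact/measurable_EFinP.
- exists N; split => // x /= /not_implyP[xab h']; apply: sub => /= fh; apply: h'.
  by rewrite fh//; move: xab; rewrite in_itv/=.
Qed.

Lemma integral_on_le a b f h : integrable_on a b f -> integrable_on a b h ->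
  {ae mu, forall s, a <= s <= b -> f s <= h s} ->
  integral_on a b f <= integral_on a b h.
Proof.
move=> fi hi fh; rewrite -subr_ge0 /integral_on -RintegralB//.
have mhf : measurable_fun `[a, b] (h \- f)%R.
  apply: measurable_funB; exact: integrable_on_measurable.
rewrite [leRHS](_ : _ = integral_on a b (fun s => Num.max 0 (h s - f s))).
  by apply: Rintegral_ge0 => x _; rewrite le_max lexx.
apply: integral_on_ae => //; first exact: measurable_maxr.
case: fh => N [mN N0 sub]; exists N; split => // x /= /not_implyP[xab h'].
apply: sub => /= fh; apply: h'; rewrite max_r// subr_ge0; exact: fh.
Qed.

Lemma integrable_on_cst a b c : integrable_on a b (cst c).
Proof.
apply: measurable_bounded_integrable => //=.
  by rewrite lebesgue_measure_itv/=; case: ifP => _; rewrite -?EFinB ltry.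
by exists `|c|; split; rewrite ?num_real// => M cM x _ /=; exact: ltW.
Qed.

Lemma integral_on_cst a b c : a <= b -> integral_on a b (cst c) = c * (b - a).
Proof.
move=> ab; rewrite /integral_on Rintegral_cst//= lebesgue_measure_itv/= lte_fin.
by move: ab; rewrite le_eqVlt => /predU1P[->|->//]; rewrite ltxx subrr.
Qed.

Lemma integrable_on_bounded a b f (M : R) : measurable_fun `[a, b] f ->
  (forall s, a <= s <= b -> `|f s| <= M) -> integrable_on a b f.
Proof.
move=> mf fM; apply: (@le_integrable _ _ _ mu _ _ _ (EFin \o cst M)) => //.
- exact/measurable_EFinP.
- by move=> x /=; rewrite in_itv/= => /fM xM; rewrite lee_fin (le_trans xM)// ler_norm.
- exact: integrable_on_cst.
Qed.

(** * Translation invariance of the integral *)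

Definition translation c : measurableTypeR R -> measurableTypeR R := fun s => s + c.

Lemma measurable_translation c : measurable_fun setT (translation c).
Proof. by apply: measurable_funD. Qed.

Lemma lebesgue_measure_shift c (A : set R) : measurable A ->
  mu (translation c @^-1` A) = mu A.
Proof.
move=> mA; have := @lebesgue_measure_unique R (pushforward mu (translation c)).
move=> /(_ (measurable_translation c)) h; apply/esym/h => // _ [[a b]] _ <-.
have E : translation c @^-1` `]a, b]%classic = `]a - c, b - c]%classic.
  by apply/seteqP; split => x /=; rewrite /translation !in_itv/= ltrBlDr lerBrDr.
change (mu `]a, b]%classic = mu (translation c @^-1` `]a, b]%classic)); rewrite E.
rewrite !lebesgue_measure_itv/= !lte_fin ltrD2r -!EFinB.
by congr (if _ then _%:E else _); ring.
Qed.

Lemma ae_shift c (P : R -> Prop) : {ae mu, forall s, P s} ->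
  {ae mu, forall s, P (s + c)}.
Proof.
move=> [N [mN N0 sub]]; exists (translation c @^-1` N); split.
- by rewrite -[X in measurable X]setTI; apply: measurable_translation.
- by rewrite lebesgue_measure_shift.
- by move=> s /= h; exact: sub.
Qed.

Lemma integrable_on_integral_on_shift a b c f : integrable_on (a + c) (b + c) f ->
  integrable_on a b (fun s => f (s + c)) /\
  integral_on a b (fun s => f (s + c)) = integral_on (a + c) (b + c) f.
Proof.
move=> fi; pose phi := translation c.
have pre : phi @^-1` `[a + c, b + c]%classic = `[a, b]%classic.
  by apply/seteqP; split => x /=; rewrite /phi /translation !in_itv/= !lerD2r.
pose f' := (EFin \o f) \_ `[a + c, b + c].
have mf' : measurable_fun setT f'.
  by apply/(measurable_restrictT _ _).1 => //; exact: measurable_int fi.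
have f'E s : `[a + c, b + c]%classic s -> f' s = (f s)%:E.
  by move=> h; rewrite /f' patchE mem_set.
have fi' : mu.-integrable `[a + c, b + c] f'.
  by apply: eq_integrable fi => // s /[!inE] h; rewrite f'E.
have fi2 : (pushforward mu phi).-integrable `[a + c, b + c] f'.
  have /integrableP[m1 m2] := fi'; apply/integrableP; split => //.
  rewrite (@eq_measure_integral _ _ _ _ mu)//; first exact: measurable_translation.
  by move=> ? A mA _; exact: lebesgue_measure_shift.
have mabs : measurable_fun `[a + c, b + c] (fun s => `|f' s|%E).
  by apply: measurableT_comp => //; exact: measurable_int fi'.
have ci : mu.-integrable `[a, b] (f' \o phi).
  apply/integrableP; split; first by apply/measurable_funTS/measurableT_comp => //; exact: measurable_translation.
  have /integrableP[_] := fi2; rewrite ge0_integral_pushforward ?pre//.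
  exact: measurable_translation.
split.
  apply: eq_integrable ci => // s; rewrite inE/= in_itv/= => h.
  by rewrite f'E//= in_itv/= !lerD2r.
congr fine; have := @integral_pushforward _ _ _ _ _ phi (measurable_translation c) mu `[a + c, b + c]%classic f' mf'.
rewrite pre => /(_ ci (measurable_itv _)) h.
rewrite (@eq_integral _ _ _ _ _ (f' \o phi)); last first.
  by move=> s; rewrite inE/= in_itv/= => sab; rewrite f'E//= in_itv/= !lerD2r.
rewrite -h; transitivity (\int[mu]_(s in `[(a + c)%R, (b + c)%R]) f' s)%E; last first.
  by apply: eq_integral => s /[!inE] /f'E.
apply: eq_measure_integral; first exact: measurable_translation.
by move=> ? A mA _; exact: lebesgue_measure_shift.
Qed.

End Intervals.

(** * Absolutely continuous functions *)

Lemma aeS2 (R : realType) (P Q S : R -> Prop) : (forall s, P s -> Q s -> S s) ->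
  {ae @lebesgue_measure R, forall s, P s} -> {ae @lebesgue_measure R, forall s, Q s} ->
  {ae @lebesgue_measure R, forall s, S s}.
Proof.
by move=> h; apply: filterS2 h; exact: (ae_filter_ringOfSetsType (@lebesgue_measure R)).
Qed.

Lemma aeS (R : realType) (P Q : R -> Prop) : (forall s, P s -> Q s) ->
  {ae @lebesgue_measure R, forall s, P s} -> {ae @lebesgue_measure R, forall s, Q s}.
Proof.
by move=> h; apply: filterS h; exact: (ae_filter_ringOfSetsType (@lebesgue_measure R)).
Qed.

Section Creeping.
Variable R : realType.
Local Notation mu := (@lebesgue_measure R).
Implicit Types (a b : R) (f Phi : R -> R).

(** The step is used at the supremum of the points where [P] holds: it carries [P] from a point just
    before it to a point just after it. *)
Lemma real_induction a b (P : R -> Prop) : a <= b -> P a ->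
  (forall z, a <= z <= b -> exists2 r : R, 0 < r &
    forall x y, a <= x -> x <= z -> z <= y -> y <= b ->
      z - r < x -> y < z + r -> P x -> P y) ->
  P b.
Proof.
move=> ab Pa step; pose S := [set z | a <= z <= b /\ P z].
have Sa : S a by split => //; rewrite lexx ab.
have hS : has_sup S by split; [exists a|exists b => z [/andP[]]].
have ubS z : S z -> z <= sup S by move=> Sz; apply: ub_le_sup => //; case: hS.
have supb : sup S <= b by apply: ge_sup; [exists a|move=> z [/andP[]]].
have [|r r0 h] := step (sup S); first by rewrite ubS.
have [x Sx xr] := sup_adherent r0 hS.
have [/andP[ax xb] Px] := Sx.
pose y := Num.min b (sup S + r / 2).
have yb : y <= b by rewrite ge_min lexx.
have Sy : sup S <= y by rewrite le_min supb lerDl divr_ge0// ltW.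
have Py : P y.
  apply: (h x y) => //; first exact: ubS.
  by rewrite gt_min ltrD2l orbC ltr_pdivrMr// ltr_pMr// ltr1n.
have xS := ubS _ Sx.
have : y <= sup S by apply: ubS; split => //; rewrite yb andbT; lra.
rewrite {1}/y ge_min => /orP[bS|]; last by lra.
by have <- : y = b by lra.
Qed.

Definition abs_continuous1 a b f : Prop :=
  forall e : R, 0 < e -> exists2 d : R, 0 < d &
    forall (m : nat) (u v : 'I_m -> R),
      (forall i, [/\ a <= u i, u i <= v i & v i <= b]) ->
      trivIset setT (fun i => `]u i, v i[%classic) ->
      \sum_(i < m) (v i - u i) < d ->
      \sum_(i < m) `|f (v i) - f (u i)| < e.

(** Finitely many non-overlapping intervals inside [U] between [a] and [z], listed from right to
    left so that moving [z] to the right adds one at the head. *)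
Fixpoint chain a (U : set R) (z : R) (s : seq (R * R)) : Prop :=
  if s is (u, v) :: s' then
    [/\ v <= z, u <= v, `]u, v[%classic `<=` U & chain a U u s']
  else a <= z.

Lemma chain_le a U z s : chain a U z s -> a <= z.
Proof.
elim: s z => //= -[u v] s IH z [vz uv _ /IH au].
exact: (le_trans au (le_trans uv vz)).
Qed.

Lemma chain_widen a U z z' s : z <= z' -> chain a U z s -> chain a U z' s.
Proof.
move=> zz; case: s => [|[u v] s] /=; first by move=> /le_trans; apply.
by case=> vz *; split => //; exact: le_trans vz zz.
Qed.

Lemma chain_nth a U z s i : chain a U z s -> (i < size s)%N ->
  [/\ a <= (nth (0, 0) s i).1, (nth (0, 0) s i).1 <= (nth (0, 0) s i).2 &
      (nth (0, 0) s i).2 <= z].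
Proof.
elim: s i z => // -[u v] s IH [|i] z /= [vz uv _ cs].
  by move=> _; split => //; exact: chain_le cs.
by rewrite ltnS => /(IH _ _ cs)[h1 h2 h3]; split => //; lra.
Qed.

Lemma chain_sorted a U z s i j : chain a U z s -> (i < j < size s)%N ->
  (nth (0, 0) s j).2 <= (nth (0, 0) s i).1.
Proof.
elim: s i j z => [|[u v] s IH] i j z; first by rewrite ltn0 andbF.
move=> /= [vz uv _ cs]; case: j => // j; case: i => [|i] /=.
  by rewrite ltnS => /(chain_nth cs)[].
by rewrite !ltnS; exact: IH cs.
Qed.

Lemma chain_measure a U z s : open U -> chain a U z s ->
  ((\sum_(p <- s) (p.2 - p.1))%:E <= mu (U `&` `]a, z[))%E.
Proof.
move=> oU; have mU := open_measurable oU.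
elim: s z => [|[u v] s IH] z /=; first by rewrite big_nil.
move=> [vz uv sub cs]; rewrite big_cons EFinD/= addeC.
have au := chain_le cs.
apply: (@le_trans _ _ (mu (U `&` `]a, u[) + mu (`]u, v[))%E).
  rewrite leeD ?IH// lebesgue_measure_itv/= lte_fin; move: uv.
  by rewrite le_eqVlt => /predU1P[->|->//]; rewrite ltxx subrr.
rewrite -measureU//; [|exact: measurableI|].
  apply: le_measure; rewrite ?inE; [apply: measurableU => //| |]; try exact: measurableI.
  move=> x [[Ux]|]/=; rewrite !in_itv/= => /andP[x1 x2]; split => //.
  - by rewrite x1; lra.
  - by apply: sub; rewrite /= in_itv/= x1.
  - by lra.
apply/seteqP; split => // x [[_]]/=; rewrite !in_itv/= => /andP[_ x1] /andP[x2 _]; lra.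
Qed.

Lemma derivable_upper (g : R -> R) z e : derivable g z 1 -> derive1 g z <= 0 -> 0 < e ->
  exists2 r : R, 0 < r & forall x, z - r < x -> x < z + r ->
    (z <= x -> g x - g z <= e * (x - z)) /\ (x <= z -> g z - g x <= e * (z - x)).
Proof.
move=> dg g0 e0.
have /cvgrPdist_lt /(_ e e0) := dg.
rewrite near_withinE => -[r /= r0 hr]; exists r => // x zx xz.
have [->|h0] := eqVneq x z; first by rewrite !subrr mulr0.
have := hr (x - z); rewrite /= sub0r normrN ltr_norml => /(_ ltac:(lra)).
rewrite subr_eq0 => /(_ h0).
rewrite derive1E in g0; rewrite -/(derive g z 1).
have -> : (x - z)%:A + z = x by rewrite [_%:A]mulr1 subrK.
rewrite ltr_norml => /andP[H _].
have H2 : (x - z)^-1 * (g x - g z) <= e.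
  by move: H g0; rewrite -[_ *: _]/(_ * _); set D := 'D_1 g z; clear; lra.
have H3 : g x - g z = (x - z)^-1 * (g x - g z) * (x - z) by field; rewrite subr_eq0.
split=> [le|le]; first by rewrite H3 ler_wpM2r// subr_ge0.
by rewrite -opprB H3 -mulrN opprB ler_wpM2r// subr_ge0.
Qed.

(** The exceptional null set is covered by an open [U] of measure below the [d] that absolute
    continuity gives for [e]. One creeps from [a] to [b]: off [U] the difference [f - Phi] has
    derivative at most zero and grows with slope at most [e]; inside [U] it grows by at most the
    increment of [f], as [Phi] is monotone. The increments over [U] sum to less than [e]. *)
Lemma abs_continuous1_le a b f Phi : a <= b -> abs_continuous1 a b f ->
  (forall x y, a <= x -> x <= y -> y <= b -> Phi x <= Phi y) ->
  {ae mu, forall s, a < s < b ->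
    [/\ derivable f s 1, derivable Phi s 1 & derive1 f s <= derive1 Phi s]} ->
  f b - f a <= Phi b - Phi a.
Proof.
move=> ab acf ndPhi [N0 [mN0 N00 subN0]].
pose N := N0 `|` [set a] `|` [set b].
have mN : measurable N by apply: measurableU => //; apply: measurableU.
have N0' : mu N = 0%E.
  by rewrite /N measureU0 ?measureU0//; try exact: lebesgue_measure_set1; exact: measurableU.
have good s : a <= s <= b -> ~ N s -> [/\ derivable f s 1, derivable Phi s 1 & derive1 f s <= derive1 Phi s].
  move=> /andP[as_ sb] Ns; have sNa : s != a by apply/eqP => sa; apply: Ns; left; right.
  have sNb : s != b by apply/eqP => sa; apply: Ns; right.
  have sI : a < s < b by rewrite !lt_neqAle as_ sb sNb eq_sym sNa.
  apply: contrapT => h; apply: Ns; left; left; apply: subN0 => /= /(_ sI).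
  exact: h.
pose g := f - Phi.
suff h e : 0 < e -> g b - g a <= e * (b - a) + e.
  have {}h : g b - g a <= 0.
    apply/ler_addgt0Pr => e e0; rewrite add0r.
    have := h (e / (b - a + 1)); have ba : 0 < b - a + 1 by lra.
    rewrite divr_gt0// => /(_ isT) /le_trans; apply.
    have -> : e / (b - a + 1) * (b - a) + e / (b - a + 1) = e by field; lra.
    exact: lexx.
  by move: h; rewrite /g !fctE; lra.
move=> e0; have [d d0 hd] := acf e e0.
have [U [oU NU mUN]] : exists U : set R, [/\ open U, N `<=` U & (mu U < d%:E)%E].
  have Nfin : (mu N < +oo)%E by rewrite N0' ltry.
  have [U [oU NU mUN]] := lebesgue_regularity_outer mN Nfin d0.
  exists U; split => //.
    apply: le_lt_trans mUN; rewrite -[leRHS]adde0 -N0'.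
    have mU := open_measurable oU.
    apply: le_trans (measureU2 _ _ _) => //; last exact: measurableD.
    apply: le_measure; rewrite ?inE//; first by apply: measurableU => //; apply: measurableD.
    by move=> x Ux; case: (pselect (N x)) => Nx; [right|left].
(* The chain [s] records the intervals crossed inside [U]; their increments of [f] are estimated
   only at the end, all at once. *)
pose P z := exists2 s, chain a U z s &
  g z - g a <= e * (z - a) + \sum_(p <- s) `|f p.2 - f p.1|.
have Pb : P b.
  apply: (real_induction ab).
    by exists [::] => //=; rewrite !subrr mulr0 big_nil addr0.
  move=> z /andP[az zb]; have [Uz|nUz] := pselect (U z).
    have /nbhs_ballP[r /= r0 rU] : nbhs z U by apply: open_nbhs_nbhs.
    exists r => // x y ax xz zy yb zrx yzr [s cs le].
    exists ((x, y) :: s).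
      split => //; first exact: le_trans xz zy.
      move=> w /=; rewrite in_itv/= => /andP[xw wy]; apply: rU.
      by rewrite /ball/= ltr_norml; lra.
    rewrite big_cons/=.
    have := ler_norm (f y - f x); have := ndPhi x y ax (le_trans xz zy) yb.
    have : 0 <= e * (y - x) by rewrite mulr_ge0//; lra.
    by move: le; rewrite /g !fctE; clear; move: (\sum_(p <- s) _) (`| _ |) => S X; lra.
  have [|df dP le] := good z _ (fun h => nUz (NU _ h)); first by rewrite az.
  have dg : derivable g z 1 by exact: derivableB.
  have [|r r0 hr] := derivable_upper dg _ e0.
    have -> : derive1 g z = derive1 f z - derive1 Phi z.
      by rewrite !derive1E; exact: deriveB df dP.
    by rewrite subr_le0.
  exists r => // x y ax xz zy yb zrx yzr [s cs les].
  exists s; first by apply: chain_widen cs; exact: le_trans zy.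
  have [_ /(_ xz) h1] := hr x zrx ltac:(clear -xz r0; lra).
  have [/(_ zy) h2 _] := hr y ltac:(clear -zy r0; lra) yzr.
  move: les h1 h2; clear; move: (\sum_(p <- s) _) => S; lra.
have [s cs le] := Pb; apply: (le_trans le); rewrite lerD2l ltW//.
have nthE (F : R * R -> R) : \sum_(p <- s) F p = \sum_(i < size s) F (nth (0, 0) s i).
  by rewrite (big_nth (0, 0)) big_mkord.
rewrite nthE; apply: hd => [i||].
- exact: chain_nth cs (ltn_ord i).
- have dis (i j : 'I_(size s)) x : (i < j)%N ->
      `](nth (0, 0) s i).1, (nth (0, 0) s i).2[%classic x ->
      `](nth (0, 0) s j).1, (nth (0, 0) s j).2[%classic x -> False.
    move=> ij; rewrite /= !in_itv/= => /andP[x1 _] /andP[_ x2].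
    have := @chain_sorted _ _ _ _ i j cs; rewrite ij ltn_ord => /(_ isT); lra.
  move=> i j _ _ [x [xi xj]]; apply: val_inj => /=.
  by case: (ltngtP i j) => // [/dis|/dis]; [move=> /(_ x xi xj)|move=> /(_ x xj xi)].
- rewrite -(nthE (fun p => p.2 - p.1)) -lte_fin (le_lt_trans (chain_measure oU cs))//.
  apply: le_lt_trans mUN; apply: le_measure; rewrite ?inE.
  + by apply: measurableI => //; exact: open_measurable.
  + exact: open_measurable.
  + by move=> x [].
Qed.

(** The comparison function is the primitive of [G], extended by zero: it is monotone since [G] is
    nonnegative on the interval, and by Lebesgue differentiation its derivative is [G] almost
    everywhere. *)
Lemma abs_continuous1_le_integral a b f G : a <= b -> abs_continuous1 a b f ->
  integrable_on a b G -> (forall s, a <= s <= b -> 0 <= G s) ->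
  {ae mu, forall s, a < s < b -> derivable f s 1 /\ derive1 f s <= G s} ->
  f b - f a <= integral_on a b G.
Proof.
move=> ab acf iG G0 fG.
pose G' := G \_ `[a, b].
have G'0 s : 0 <= G' s.
  by rewrite /G' patchE; case: ifPn => // /[!inE]/=; rewrite in_itv/= => /G0.
have iG' : mu.-integrable setT (EFin \o G').
  have := (@integrable_mkcond _ (measurableTypeR R) R mu `[a, b]%classic (EFin \o G)
    (measurable_itv _)).1 iG.
  by apply: eq_integrable => // s _ /=; rewrite /G' !patchE; case: ifP.
have iGy y : integrable_on a y G' by apply: integrableS iG'.
have locG : locally_integrable [set: R] G'.
  by apply: open_integrable_locally => //; exact: openT.
pose Phi x := integral_on a x G'.
have -> : integral_on a b G = Phi b - Phi a.
  rewrite /Phi [X in _ - X](_ : _ = 0); last by rewrite /integral_on set_itv1 Rintegral_set1.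
  rewrite subr0; apply: eq_Rintegral => s sab; by rewrite /G' patchE sab.
apply: abs_continuous1_le => //.
  move=> x y ax xy yb; rewrite /Phi (@integral_on_split _ a x y)//.
  by rewrite lerDl; apply: Rintegral_ge0.
have := @FTC1 R G' (BLeft a) iGy locG => /= FTC.
apply: aeS2 FTC fG => s + fs sab; have /andP[as_ sb] := sab.
rewrite lte_fin => /(_ as_) [dPhi PhiE].
have [df fG'] := fs sab; split => //.
by rewrite PhiE /G' patchE mem_set//= in_itv/= !ltW.
Qed.

End Creeping.

(** * Euclidean vectors *)

Lemma continuous_sum (R : realType) (T : topologicalType) (p : T) (I : Type)
    (r : seq I) (f : I -> T -> R) :
  (forall i, {for p, continuous (f i)}) ->
  {for p, continuous (fun x => \sum_(i <- r) f i x)}.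
Proof.
move=> fp; have -> : (fun x => \sum_(i <- r) f i x) = \sum_(i <- r) f i.
  by apply/funext => x; rewrite fct_sumE.
elim: r => [|i r IH]; first by rewrite big_nil; exact: cvg_cst.
by rewrite big_cons; apply: continuousD.
Qed.

Section Vectors.
Variables (R : realType) (n : nat).
Implicit Types (p q x y : 'rV[R]_n).

Lemma coord_le_norm x i : `|x 0 i| <= `|x|.
Proof.
rewrite /Num.norm/= mx_normrE.
exact: (le_bigmax _ (fun ij => `|x ij.1 ij.2|) (0, i)).
Qed.

Lemma norm_le_coord x (M : R) : 0 <= M -> (forall i, `|x 0 i| <= M) -> `|x| <= M.
Proof.
move=> M0 h; rewrite /Num.norm/= mx_normrE; apply: bigmax_le => // -[i j] _ /=.
by rewrite ord1.
Qed.

Lemma dot_ge0 x : 0 <= dot x x.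
Proof. by apply: sumr_ge0 => i _; rewrite -expr2 sqr_ge0. Qed.

Lemma sqr_enorm x : enorm x ^+ 2 = dot x x.
Proof. by rewrite sqr_sqrtr// dot_ge0. Qed.

Lemma enorm_ge0 x : 0 <= enorm x.
Proof. exact: sqrtr_ge0. Qed.

Lemma coord_le_enorm x i : `|x 0 i| <= enorm x.
Proof.
rewrite -(@ler_pXn2r _ 2)// ?nnegrE ?enorm_ge0// sqr_enorm real_normK ?num_real//.
rewrite /dot (bigD1 i)//= -expr2 lerDl sumr_ge0// => j _.
by rewrite -expr2 sqr_ge0.
Qed.

Lemma norm_le_enorm x : `|x| <= enorm x.
Proof. by apply: norm_le_coord; [exact: enorm_ge0|exact: coord_le_enorm]. Qed.

Lemma dot_le_norm x : dot x x <= n%:R * `|x| ^+ 2.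
Proof.
rewrite mulr_natl -[X in _ *+ X]card_ord -sumr_const.
apply: ler_sum => i _; rewrite -expr2 -real_normK ?num_real//.
by rewrite ler_pXn2r ?nnegrE// coord_le_norm.
Qed.

Lemma enorm_le_norm x : enorm x <= n%:R * `|x|.
Proof.
rewrite -(@ler_pXn2r _ 2)// ?nnegrE ?enorm_ge0 ?mulr_ge0// sqr_enorm.
rewrite (le_trans (dot_le_norm x))// exprMn ler_wpM2r ?sqr_ge0//.
by rewrite -natrX ler_nat; case: (n) => // k; rewrite leq_pmulr.
Qed.

Lemma dotNr p q : dot p (- q) = - dot p q.
Proof. by rewrite /dot -sumrN; apply: eq_bigr => i _; rewrite mxE mulrN. Qed.

Lemma dotNl p q : dot (- p) q = - dot p q.
Proof. by rewrite /dot -sumrN; apply: eq_bigr => i _; rewrite mxE mulNr. Qed.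

Lemma dotDr p q x : dot p (q + x) = dot p q + dot p x.
Proof. by rewrite /dot -big_split; apply: eq_bigr => i _; rewrite mxE mulrDr. Qed.

Lemma dotDl p q x : dot (p + q) x = dot p x + dot q x.
Proof. by rewrite /dot -big_split; apply: eq_bigr => i _; rewrite mxE mulrDl. Qed.

Lemma dotZr p q (a : R) : dot p (a *: q) = a * dot p q.
Proof. by rewrite /dot mulr_sumr; apply: eq_bigr => i _; rewrite mxE mulrCA. Qed.

Lemma dotZl p q (a : R) : dot (a *: p) q = a * dot p q.
Proof. by rewrite /dot mulr_sumr; apply: eq_bigr => i _; rewrite mxE mulrA. Qed.

Lemma dotC p q : dot p q = dot q p.
Proof. by apply: eq_bigr => i _; rewrite mulrC. Qed.

Lemma dot_delta i q : dot (delta_mx 0 i) q = q 0 i.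
Proof.
rewrite /dot (bigD1 i)//= big1 ?addr0; first by rewrite mxE !eqxx mul1r.
by move=> j ji; rewrite mxE (negbTE ji) andbF mul0r.
Qed.

Lemma dot_young p q : dot p q <= dot p p / 4 + dot q q.
Proof.
have := dot_ge0 (2^-1 *: p - q).
rewrite dotDl !dotDr !dotNl !dotNr !dotZl !dotZr (dotC q p).
by move: (dot p p) (dot p q) (dot q q) => a b c; lra.
Qed.

Lemma dot_young2 p q : dot p q <= dot p p / 2 + dot q q / 2.
Proof.
have := dot_ge0 (p - q).
rewrite dotDl !dotDr !dotNl !dotNr (dotC q p).
by move: (dot p p) (dot p q) (dot q q) => a b c; lra.
Qed.

Lemma continuous_dot_self : continuous (fun p => dot p p).
Proof.
move=> p; apply: continuous_sum => i.
by apply: continuousM; exact: coord_continuous.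
Qed.

Lemma continuous_dot q : continuous (fun p => dot p q).
Proof.
move=> p; apply: continuous_sum => i.
by apply: continuousM; [exact: coord_continuous|exact: cst_continuous].
Qed.

Lemma continuous_enorm : continuous (@enorm R n).
Proof.
move=> p; apply: (@continuous_comp _ _ _ (fun p => dot p p) Num.sqrt).
  exact: continuous_dot_self.
exact: sqrt_continuous.
Qed.

Definition rat_point (k : 'rV[rat]_n) : 'rV[R]_n := map_mx ratr k.

Lemma rat_point_dense p (A : set 'rV[R]_n) : nbhs p A -> exists k, A (rat_point k).
Proof.
move=> /nbhs_ballP[e /= e0 eA].
have h i : exists r : rat, p 0 i - e < ratr r < p 0 i + e.
  have [|r] := @rat_in_itvoo R (p 0 i - e) (p 0 i + e); first by lra.
  by rewrite in_itv/= => ?; exists r.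
have [k hk] := fin_all_exists h.
exists (\row_i k i); apply: eA; split => // a i; rewrite ord1 !mxE /ball/= ltr_norml.
by have := hk i; lra.
Qed.

End Vectors.

(** * The Lagrangian *)

Section Lagrangian.
Variables (R : realType) (n : nat) (H : 'rV[R]_n -> 'rV[R]_n -> R) (K0 : R).
Hypothesis H_continuous : continuous (fun yp : 'rV[R]_n * 'rV[R]_n => H yp.1 yp.2).
Hypothesis H_growth : forall y p,
  enorm p ^+ 2 / 2 - K0 <= H y p <= enorm p ^+ 2 / 2 + K0.
Implicit Types (y p q : 'rV[R]_n) (c : R).

(** The term in [enorm p] lets one transform serve both boundary conditions: [c] is zero for Neumann
    and the cosine of the angle times [l] for capillary. *)
Definition conjugate_arg y q c p : R := dot p q - H y p - c * enorm p.

Definition conjugate y q c : R := sup [set conjugate_arg y q c p | p in setT].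

Lemma conjugate_arg_le y q c p : conjugate_arg y q c p <= dot q q + c ^+ 2 + K0.
Proof.
have /andP[Hl _] := H_growth y p; rewrite /conjugate_arg.
have := dot_young p q; rewrite -(sqr_enorm p).
have : 0 <= (enorm p / 2 + c) ^+ 2 by exact: sqr_ge0.
move: Hl; move: (dot p q) (dot q q) (H y p) (enorm p) => a b h e; clear; lra.
Qed.

Lemma has_sup_conjugate y q c : has_sup [set conjugate_arg y q c p | p in setT].
Proof.
split; first by exists (conjugate_arg y q c 0); exists 0.
by exists (dot q q + c ^+ 2 + K0) => _ [p _ <-]; exact: conjugate_arg_le.
Qed.

Lemma conjugate_ge y q c p : conjugate_arg y q c p <= conjugate y q c.
Proof. by apply: ub_le_sup; [case: (has_sup_conjugate y q c)|exists p]. Qed.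

Lemma conjugate_le y q : conjugate y q 0 <= dot q q / 2 + K0.
Proof.
apply: ge_sup; first by case: (has_sup_conjugate y q 0).
move=> _ [p _ <-]; rewrite /conjugate_arg mul0r subr0.
have /andP[Hl _] := H_growth y p; rewrite sqr_enorm in Hl.
have := dot_young2 p q; move: Hl.
by move: (dot p q) (dot q q) (H y p) (dot p p) => a b h e; clear; lra.
Qed.

Lemma continuous_H1 p : continuous (H ^~ p).
Proof.
move=> y; apply: (@continuous_comp _ _ _ (fun y => (y, p)) (fun yp => H yp.1 yp.2)).
  by apply: (@cvg_pair _ _ _ (nbhs y) (nbhs y) (nbhs p) _ _ _ id (fun=> p)); [exact: cvg_id|exact: cvg_cst].
exact: H_continuous.
Qed.

Lemma continuous_conjugate_arg y q c : continuous (conjugate_arg y q c).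
Proof.
rewrite /conjugate_arg => p.
apply: (@continuousB _ R^o _ (fun p => dot p q - H y p) (fun p => c * enorm p)).
  apply: (@continuousB _ R^o _ (fun p => dot p q) (H y)).
    exact: continuous_dot.
  apply: (@continuous_comp _ _ _ (fun p => (y, p)) (fun yp => H yp.1 yp.2)).
    by apply: (@cvg_pair _ _ _ (nbhs p) (nbhs y) (nbhs p) _ _ _ (fun=> y) id); [exact: cvg_cst|exact: cvg_id].
  exact: H_continuous.
by apply: continuousM; [exact: cst_continuous|exact: continuous_enorm].
Qed.

Definition conjugate_seq y q c (k : nat) : R :=
  conjugate_arg y q c (rat_point R (odflt 0 (unpickle k))).

(** By continuity in [p] rational momenta suffice. A countable supremum makes the Lagrangian along a
    curve measurable. *)
Lemma conjugate_sups y q c : conjugate y q c = sups (conjugate_seq y q c) 0.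
Proof.
rewrite /sups /sdrop /=; apply/eqP; rewrite eq_le; apply/andP; split.
  apply: ge_sup; first by case: (has_sup_conjugate y q c).
  move=> _ [p _ <-]; apply/ler_addgt0Pr => e e0.
  have : nbhs p [set p' | conjugate_arg y q c p - e < conjugate_arg y q c p'].
    have := @continuous_conjugate_arg y q c p.
    move=> /cvgr_gt; apply; lra.
  move=> /rat_point_dense[k /= hk].
  suff : conjugate_arg y q c (rat_point R k) <=
         sup [set conjugate_seq y q c k | k in [set k | (0 <= k)%N]] by lra.
  apply: ub_le_sup.
    exists (dot q q + c ^+ 2 + K0) => _ [j _ <-]; exact: conjugate_arg_le.
  by exists (pickle k) => //; rewrite /conjugate_seq pickleK.
apply: ge_sup; first by exists (conjugate_seq y q c 0); exists 0%N.
by move=> _ [j _ <-]; exact: conjugate_ge.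
Qed.

Lemma measurable_conjugate (D : set R) (y q : R -> 'rV[R]_n) (c : R -> R) :
  (forall p, measurable_fun D (fun s => H (y s) p)) ->
  (forall i, measurable_fun D (fun s => q s 0 i)) -> measurable_fun D c ->
  measurable_fun D (fun s => conjugate (y s) (q s) (c s)).
Proof.
move=> my mq mc; under eq_fun do rewrite conjugate_sups.
apply: measurable_fun_sups.
  move=> s _; exists (dot (q s) (q s) + c s ^+ 2 + K0) => _ [j _ <-].
  exact: conjugate_arg_le.
move=> k; apply: measurable_funB; first apply: measurable_funB => //.
  apply: measurable_sum => i; apply: measurable_funM => //; exact: measurable_cst.
by apply: measurable_funM => //; exact: measurable_cst.
Qed.

Definition angle_weight (theta : 'rV[R]_n -> R) (b : bc) y : R :=
  match b with Neumann => 0 | Capillary => cos (theta y) end.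

Definition flux (g : 'rV[R]_n -> R) (b : bc) y : R :=
  match b with Neumann => g y | Capillary => 0 end.

Lemma lagrangianE g theta b y q c :
  lagrangian H g theta b y q c =
  conjugate y q (angle_weight theta b y * c) - flux g b y * c.
Proof.
case: b; rewrite /lagrangian /conjugate /conjugate_arg /=; last by rewrite mul0r subr0.
by congr (sup _ - _); apply: eq_imagel => p _ /=; rewrite mul0r mul0r subr0.
Qed.

End Lagrangian.

(** * Periodic domains with a C^1 boundary *)

Lemma closure_normP (R : realType) (V : normedModType R) (A : set V) (x : V) :
  closure A x <-> forall e : R, 0 < e -> exists2 y, A y & `|x - y| < e.
Proof.
split=> [cl e e0|h B /nbhs_normP[e /= e0 eB]].
  have [|y [Ay xy]] := cl (ball x e); first exact: nbhsx_ballx.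
  by exists y => //; rewrite -ball_normE in xy.
by have [y Ay xy] := h e e0; exists y; split => //; apply: eB.
Qed.

Lemma derive_translate (R : realType) (V : normedModType R) (f : V -> R) (x z v : V) :
  'D_v (fun x => f (x - z)) (x + z) = 'D_v f x.
Proof.
rewrite /derive; set F := fun h => _; set G := fun h => _.
suff -> : F = G by [].
by apply/funext => h; rewrite /F /G /= addrK addrA addrK.
Qed.

Lemma derivable_local_max (R : realType) (phi : R -> R) (s : R) :
  derivable phi s 1 -> (\forall x \near s, phi x <= phi s) -> derive1 phi s = 0.
Proof.
move=> dphi /nbhs_normP[d /= d0 max]; apply/eqP; rewrite -normr_le0.
apply/ler_addgt0Pr => e e0; rewrite add0r ltW//.
have /cvgrPdist_lt /(_ e e0) := dphi.
rewrite near_withinE => -[r /= r0 hr].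
have := hr (Num.min r d / 2); have := hr (- (Num.min r d / 2)).
rewrite /= !sub0r !normrN; set m := Num.min r d.
have m0 : 0 < m by rewrite lt_min r0.
have mr : m <= r by rewrite ge_min lexx.
have md : m <= d by rewrite ge_min lexx orbT.
rewrite ger0_norm ?divr_ge0 ?ltW// => /(_ ltac:(lra)) + /(_ ltac:(lra)).
rewrite oppr_eq0 => /(_ ltac:(lra)) + /(_ ltac:(lra)).
rewrite derive1E -/(derive phi s 1).
have -> : (m / 2)%:A + s = s + m / 2 by rewrite addrC [_%:A]mulr1.
have -> : (- (m / 2))%:A + s = s - m / 2 by rewrite addrC [_%:A]mulr1.
set D := 'D_1 phi s.
have M1 : phi (s + m / 2) <= phi s.
  by apply: max => /=; rewrite opprD addNKr normrN ger0_norm; lra.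
have M2 : phi (s - m / 2) <= phi s.
  by apply: max => /=; rewrite subKr ger0_norm; lra.
have m2 : 0 < (m / 2)^-1 by rewrite invr_gt0 divr_gt0.
rewrite -[_ *: _]/(_ * _) -[X in _ -> `|_ - X| < _ -> _]/(_ * _) invrN mulNr opprK.
have Q1 : 0 <= - ((m / 2)^-1 * (phi (s - m / 2) - phi s)).
  by rewrite -mulrN mulr_ge0 ?oppr_ge0 ?subr_le0// ltW.
have Q2 : 0 <= - ((m / 2)^-1 * (phi (s + m / 2) - phi s)).
  by rewrite -mulrN mulr_ge0 ?oppr_ge0 ?subr_le0// ltW.
move: Q1 Q2; rewrite !ltr_norml.
move: ((m / 2)^-1 * _) ((m / 2)^-1 * _) D => A B D; clear; lra.
Qed.

Section Domain.
Variables (R : realType) (n : nat) (Omega : set 'rV[R]_n).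
Hypothesis Omega_open : open Omega.
Hypothesis Omega_periodic : [set x + z | x in Omega & z in @Zlattice R n] = Omega.
Implicit Types (x y z w : 'rV[R]_n).

Lemma ZlatticeN z : Zlattice z -> Zlattice (- z).
Proof. by move=> [k ->]; exists (- k); rewrite map_mxN. Qed.

Lemma nearest_Zlattice x : exists2 z, Zlattice z & `|x - z| <= 1.
Proof.
exists (\row_i (Num.floor (x 0 i))%:~R).
  by exists (\row_i Num.floor (x 0 i)); apply/rowP => i; rewrite !mxE.
apply: norm_le_coord => // i; rewrite !mxE.
have := floor_itv (x 0 i); rewrite intrD1 => /andP[h1 h2].
by rewrite ger0_norm; lra.
Qed.

Lemma Omega_translate x z : Zlattice z -> Omega (x + z) <-> Omega x.
Proof.
move=> Zz; split=> Ox.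
  rewrite -Omega_periodic; exists (x + z) => //; exists (- z); first exact: ZlatticeN.
  by rewrite addrK.
by rewrite -Omega_periodic; exists x => //; exists z.
Qed.

Lemma closure_translate x z : Zlattice z -> closure Omega x -> closure Omega (x + z).
Proof.
move=> Zz /closure_normP cl; apply/closure_normP => e e0.
have [y Oy xy] := cl e e0; exists (y + z); first exact/Omega_translate.
by rewrite opprD addrACA subrr addr0.
Qed.

Lemma bdryE x : bdry Omega x <-> closure Omega x /\ ~ Omega x.
Proof. by rewrite /bdry (interior_id Omega).1//; split => -[]. Qed.

Lemma closure_cases x : closure Omega x -> Omega x \/ bdry Omega x.
Proof. by move=> cx; case: (pselect (Omega x)) => [|Ox]; [left|right; apply/bdryE]. Qed.

Lemma bdry_translate x z : Zlattice z -> bdry Omega x -> bdry Omega (x + z).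
Proof.
move=> Zz /bdryE[cx Ox]; apply/bdryE; split; first exact: closure_translate.
by move/(Omega_translate x Zz).
Qed.

Lemma closed_bdry : closed (bdry Omega).
Proof. rewrite /bdry setDE; apply: closedI; first exact: closed_closure.
by apply: open_closedC; exact: open_interior. Qed.

Lemma dilate1 : dilate 1 Omega = Omega.
Proof.
apply/seteqP; split => [_ [x Ox <-]|x Ox]; first by rewrite scale1r.
by exists x => //; rewrite scale1r.
Qed.

Lemma local_defining_translate y z f : Zlattice z -> local_defining Omega y f ->
  local_defining Omega (y + z) (fun x => f (x - z)).
Proof.
move=> Zz [U [oU Uy [df cg] g0 UO]].
have ctr : continuous (fun x => x - z) by move=> x; apply: differentiable_continuous; exact: differentiableB.
have gE x : grad (fun x => f (x - z)) x = grad f (x - z).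
  apply/rowP => i; rewrite !mxE.
  by rewrite -(derive_translate f (x - z) z) subrK.
exists ((fun x => x - z) @^-1` U); split.
- by apply: open_comp => // x _; exact: ctr.
- by rewrite /= addrK.
- split=> x /= Ux.
    apply: (@differentiable_comp _ _ _ _ (fun x => x - z) f); last exact: df.
    exact: differentiableB.
  rewrite (_ : grad _ = grad f \o (fun x => x - z)); last exact/funext.
  by apply: continuous_comp; [exact: ctr|exact: cg].
- by move=> x /= Ux; rewrite gE; exact: g0.
- by move=> x /= Ux; rewrite -(UO _ Ux) -(Omega_translate (x - z) Zz) subrK.
Qed.

Lemma grad_translate f y z : grad (fun x => f (x - z)) (y + z) = grad f y.
Proof. by apply/rowP => i; rewrite !mxE derive_translate. Qed.

Lemma is_outward_normal_translate y z w : Zlattice z ->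
  is_outward_normal Omega y w -> is_outward_normal Omega (y + z) w.
Proof.
move=> Zz [f /(local_defining_translate Zz) df ->].
by exists (fun x => f (x - z)) => //; rewrite grad_translate.
Qed.

Lemma outward_normal_translate y z : Zlattice z ->
  outward_normal Omega (y + z) = outward_normal Omega y.
Proof.
move=> Zz; rewrite /outward_normal; congr xget; apply/seteqP; split => w.
  move/(is_outward_normal_translate (ZlatticeN Zz)); by rewrite addrK.
exact: is_outward_normal_translate.
Qed.

(** The curve stays in the closure on both sides of [s], so at a boundary point its velocity is
    orthogonal to the normal and not merely inward. *)
Definition tangent y w : Prop := exists (eta : R -> 'rV[R]_n) s,
  [/\ derivable eta s 1, eta s = y, derive1 eta s = w &
      \forall x \near s, closure Omega (eta x)].

Lemma derive_grad (f : 'rV[R]_n -> R) y w : differentiable f y ->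
  'd f y w = dot (grad f y) w.
Proof.
move=> df; rewrite {1}(row_sum_delta w) linear_sum /dot; apply: eq_bigr => i _.
by rewrite linearZ/= -deriveE// !mxE [_ *: _]mulrC.
Qed.

Lemma defining_le0 (f : 'rV[R]_n -> R) (U : set 'rV[R]_n) x : open U ->
  (forall x, U x -> differentiable f x) ->
  (forall x, U x -> (Omega x <-> f x < 0)) -> U x -> closure Omega x -> f x <= 0.
Proof.
move=> oU df UO Ux cx; rewrite leNgt; apply/negP => fx.
have cf := differentiable_continuous (df x Ux).
have [|y [Oy [Uy /= fy]]] := cx (U `&` [set y | 0 < f y]).
  apply: filterI; first exact: open_nbhs_nbhs.
  exact: (@cvgr_gt _ _ _ _ _ _ cf).
by move/(UO _ Uy): Oy; lra.
Qed.

(** The defining function is zero at [y] and nonpositive on the closure, so along the curve it has a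
    local maximum at [s]. *)
Lemma tangent_grad y w (f : 'rV[R]_n -> R) : bdry Omega y -> local_defining Omega y f ->
  tangent y w -> dot (grad f y) w = 0.
Proof.
move=> /bdryE[cy Oy] [U [oU Uy [df _] _ UO]] [eta [s [deta etas <- near_cl]]].
have fle x : U x -> closure Omega x -> f x <= 0 by exact: defining_le0.
have fy : f y = 0.
  apply/eqP; rewrite eq_le fle//= leNgt; apply/negP => /(UO _ Uy).
  exact: Oy.
have ddeta := (derivable1_diffP eta s).1 deta.
have dfy : differentiable f (eta s) by rewrite etas; exact: df.
have dcomp : differentiable (f \o eta) s by exact: differentiable_comp.
have := @derivable_local_max R (f \o eta) s ((derivable1_diffP _ _).2 dcomp).
rewrite derive1E deriveE// diff_comp//= derive_grad// -deriveE// -derive1E etas.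
rewrite fy; apply.
have cU : \forall x \near s, U (eta x).
  have := differentiable_continuous ddeta; apply.
  by rewrite etas; exact: open_nbhs_nbhs.
by apply: filterS2 cU near_cl => x; exact: fle.
Qed.

End Domain.

(** * Uniform bounds by periodicity and compactness *)

Lemma cvg_sum_fun (R : realType) (T : Type) (F : set_system T) {FF : Filter F}
    (I : Type) (r : seq I) (f : I -> T -> R) (l : I -> R) :
  (forall i, f i x @[x --> F] --> l i) ->
  \sum_(i <- r) f i x @[x --> F] --> \sum_(i <- r) l i.
Proof.
move=> fl; elim: r => [|i r IH].
  rewrite big_nil (_ : (fun x => _) = cst 0); first exact: cvg_cst.
  by apply/funext => x; rewrite big_nil.
rewrite big_cons (_ : (fun x => _) = (fun x => f i x + \sum_(j <- r) f j x)).
  exact: cvgD.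
by apply/funext => x; rewrite big_cons.
Qed.

(** Monotonicity in [r] turns each local bound into a statement about all large [r], and compactness
    merges these. *)
Lemma compact_uniform (R : realType) (T : topologicalType) (K : set T)
    (P : R -> T -> Prop) : compact K ->
  (forall x r r', r <= r' -> P r x -> P r' x) ->
  (forall x, K x -> exists r, \forall y \near x, P r y) ->
  exists r, forall x, K x -> P r x.
Proof.
move=> /compact_near_coveringP cK mono loc.
have : \forall r \near +oo, K `<=` P r.
  apply: cK => x /loc[r Pr].
  exists ([set y | P r y], [set r' | r <= r']) => /=.
    by split => //; apply: nbhs_pinfty_ge; rewrite num_real.
  by move=> [y r'] /= [Py rr']; exact: mono Py.
by move=> [M [_ hM]]; exists (M + 1); apply: hM; rewrite ltrDl.
Qed.

Lemma compact_closed_bounded (R : realType) (n : nat) (A : set 'rV[R]_n) (M : R) :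
  closed A -> compact (A `&` [set x | `|x| <= M]).
Proof.
move=> cA; apply: bounded_closed_compact.
  exists M; split; rewrite ?num_real// => r Mr x [_ /= xM].
  by rewrite (le_trans xM)// ltW.
apply: closedI => //.
apply: (@closed_comp _ _ (@Num.norm _ 'rV[R]_n) [set r | r <= M]).
  by move=> x _; exact: norm_continuous.
exact: closed_le.
Qed.

Lemma quotient_addr (R : realType) (V : normedModType R) (eta : R -> V) (z : V) (s : R) :
  (fun h : R => h^-1 *: (((fun s => eta s + z) \o +%R^~ s) (h *: 1) - (eta s + z))) =
  (fun h : R => h^-1 *: ((eta \o +%R^~ s) (h *: 1) - eta s)).
Proof. by apply/funext => h /=; rewrite opprD addrACA subrr addr0. Qed.

Lemma derivable_addr (R : realType) (V : normedModType R) (eta : R -> V) (z : V) (s : R) :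
  derivable eta s 1 -> derivable (fun s => eta s + z) s 1.
Proof. by rewrite /derivable quotient_addr. Qed.

Lemma derive1_addr (R : realType) (V : normedModType R) (eta : R -> V) (z : V) (s : R) :
  derive1 (fun s => eta s + z) s = derive1 eta s.
Proof. by rewrite !derive1E /derive quotient_addr. Qed.

Section UniformBounds.
Variables (R : realType) (n : nat) (Omega : set 'rV[R]_n)
  (H : 'rV[R]_n -> 'rV[R]_n -> R) (K0 : R)
  (gamma : 'rV[R]_n -> 'rV[R]_n) (g theta : 'rV[R]_n -> R).
Hypothesis Omega_open : open Omega.
Hypothesis Omega_C1 : C1_boundary Omega.
Hypothesis Omega_periodic : [set x + z | x in Omega & z in @Zlattice R n] = Omega.
Hypothesis H_growth : forall y p,
  enorm p ^+ 2 / 2 - K0 <= H y p <= enorm p ^+ 2 / 2 + K0.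
Hypothesis gamma_continuous : {within bdry Omega, continuous gamma}.
Hypothesis gamma_periodic : Zperiodic_on (bdry Omega) gamma.
Hypothesis gamma_outward : forall y, bdry Omega y ->
  0 < dot (gamma y) (outward_normal Omega y).
Hypothesis g_continuous : {within bdry Omega, continuous g}.
Hypothesis g_periodic : Zperiodic_on (bdry Omega) g.
Hypothesis theta_range : forall y, pi / 2 <= theta y < pi.
Hypothesis theta_continuous : continuous theta.
Hypothesis theta_periodic : Zperiodic_on setT theta.
Implicit Types (x y z w : 'rV[R]_n).

Lemma outward_normalP y : bdry Omega y ->
  is_outward_normal Omega y (outward_normal Omega y).
Proof.
move=> /Omega_C1[f df]; rewrite /outward_normal.
by case: xgetP => // /(_ ((enorm (grad f y))^-1 *: grad f y)) []; exists f.
Qed.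

Lemma enorm_gt0 x : x != 0 -> 0 < enorm x.
Proof.
move=> x0; rewrite lt_neqAle enorm_ge0 andbT eq_sym; apply: contra x0 => /eqP x0.
apply/eqP/rowP => i; rewrite mxE; apply/eqP; rewrite -normr_le0 -x0.
exact: coord_le_enorm.
Qed.

Lemma tangent_translate y z w : Zlattice z -> tangent Omega y w ->
  tangent Omega (y + z) w.
Proof.
move=> Zz [eta [s [de es dw ne]]].
exists (fun s => eta s + z), s; split.
- exact: derivable_addr.
- by rewrite es.
- by rewrite derive1_addr.
- by apply: filterS ne => x; exact: closure_translate.
Qed.

Lemma outward_normal_dot y : bdry Omega y ->
  dot (outward_normal Omega y) (outward_normal Omega y) = 1.
Proof.
move=> /outward_normalP[f [U [_ Uy _ g0 _]] ->].
have e0 := enorm_gt0 (g0 _ Uy).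
by rewrite dotZl dotZr -sqr_enorm; field; rewrite gt_eqF.
Qed.

Lemma outward_normal_tangent y w : bdry Omega y -> tangent Omega y w ->
  dot (outward_normal Omega y) w = 0.
Proof.
move=> By tw; have [f df ->] := outward_normalP By.
by rewrite dotZl (tangent_grad Omega_open By df tw) mulr0.
Qed.

(** [N] is a normal vector scaled against [gamma]; it is quantified existentially so that all points
    near a given one can use the gradient of the same local defining function. *)
Definition transversal (r : R) y : Prop := bdry Omega y ->
  [/\ `|gamma y| <= r, `|g y| <= r &
    exists N, [/\ `|N| <= r, 1 <= dot N (gamma y) &
      forall w, tangent Omega y w -> dot N w = 0]].

Lemma transversal_near y : bdry Omega y -> exists r, \forall x \near y, transversal r x.
Proof.
move=> By; have [f df nu] := outward_normalP By.
have [U [oU Uy [dif cg] g0 UO]] := df.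
have e0 := enorm_gt0 (g0 _ Uy).
have c0 : 0 < dot (grad f y) (gamma y).
  have := gamma_outward By; rewrite nu dotZr dotC.
  by rewrite pmulr_rgt0// invr_gt0.
set c := dot _ _ in c0.
have cgam : gamma x @[x --> within (bdry Omega) (nbhs y)] --> gamma y.
  by move/subspace_continuousP: gamma_continuous; apply.
have cgg : g x @[x --> within (bdry Omega) (nbhs y)] --> g y.
  by move/subspace_continuousP: g_continuous; apply.
have cgr : grad f x @[x --> within (bdry Omega) (nbhs y)] --> grad f y.
  by apply: cvg_within_filter; exact: cg.
have coordc (h : 'rV[R]_n -> 'rV[R]_n) i :
    h x @[x --> within (bdry Omega) (nbhs y)] --> h y ->
    h x 0 i @[x --> within (bdry Omega) (nbhs y)] --> h y 0 i.
  move=> hc; apply: (@cvg_comp _ _ _ h (fun M => M 0 i) _ (nbhs (h y)) _ hc).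
  exact: coord_continuous.
have cdot : dot (grad f x) (gamma x) @[x --> within (bdry Omega) (nbhs y)] --> c.
  by apply: cvg_sum_fun => i; apply: cvgM; exact: coordc.
have N1 : \forall x \near y, bdry Omega x -> c / 2 < dot (grad f x) (gamma x).
  by apply: (cvgr_gt _ cdot); rewrite ltr_pdivrMr// ltr_pMr// ltr1n.
have N2 : \forall x \near y, bdry Omega x -> `|gamma x| < `|gamma y| + 1.
  by apply: (cvgr_norm_lt _ cgam); rewrite ltrDl.
have N3 : \forall x \near y, bdry Omega x -> `|g x| < `|g y| + 1.
  by apply: (cvgr_norm_lt _ cgg); rewrite ltrDl.
have N4 : \forall x \near y, bdry Omega x -> `|grad f x| < `|grad f y| + 1.
  by apply: (cvgr_norm_lt _ cgr); rewrite ltrDl.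
have N5 : \forall x \near y, U x by exact: open_nbhs_nbhs.
pose r := `|gamma y| + 1 + (`|g y| + 1) + (2 / c) * (`|grad f y| + 1).
exists r; apply: filterS2 (filterI N1 N2) (filterI (filterI N3 N4) N5).
move=> x [n1 n2] [[n3 n4] Ux] Bx.
have h1 := n2 Bx; have h2 := n3 Bx; have h3 := n4 Bx; have h4 := n1 Bx.
have p1 : 0 <= (2 / c) * (`|grad f y| + 1).
  by rewrite mulr_ge0 ?addr_ge0// divr_ge0// ltW.
have p2 := normr_ge0 (gamma y); have p3 := normr_ge0 (g y).
split.
- by rewrite /r; move: p1 p2 p3 h1; lra.
- by rewrite /r; move: p1 p2 p3 h2; lra.
(* Near [y] the product of [grad f] and [gamma] exceeds half of its value [c] at [y], whence the
   factor [2 / c]. *)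
- exists ((2 / c) *: grad f x); split.
  + rewrite normrZ ger0_norm ?divr_ge0 ?(ltW c0)//.
    have : 2 / c * `|grad f x| <= 2 / c * (`|grad f y| + 1).
      by rewrite ler_wpM2l ?divr_ge0 ?(ltW c0)// ltW.
    by rewrite /r; move: p2 p3; lra.
  + rewrite dotZl mulrAC ler_pdivlMr// mul1r.
    by move: h4; lra.
  + move=> w tw; rewrite dotZl (tangent_grad Omega_open Bx _ tw) ?mulr0//.
    by exists U.
Qed.

Lemma transversal_le y r r' : r <= r' -> transversal r y -> transversal r' y.
Proof.
move=> rr h By; have [h1 h2 [N [N1 N2 N3]]] := h By.
split; [exact: le_trans rr|exact: le_trans rr|].
by exists N; split => //; exact: le_trans rr.
Qed.

Lemma transversal_uniform : exists2 r, 0 < r & forall y, transversal r y.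
Proof.
have [||r hr] := @compact_uniform R _ _ transversal
    (compact_closed_bounded (M := 1) (@closed_bdry _ _ Omega)).
- by move=> x r r'; exact: transversal_le.
- by move=> x [Bx _]; exact: transversal_near.
exists (Num.max 1 r); first by rewrite lt_max ltr01.
move=> y; apply: (@transversal_le _ r); first by rewrite le_max lexx orbT.
move=> By; have [z Zz yz] := nearest_Zlattice y.
have ZNz := ZlatticeN Zz.
have By' : bdry Omega (y - z) by exact: bdry_translate.
have [||h1 h2 [N [N1 N2 N3]]] := hr (y - z) => //.
have gE : gamma y = gamma (y - z) by rewrite -(gamma_periodic By' Zz) subrK.
have ggE : g y = g (y - z) by rewrite -(g_periodic By' Zz) subrK.
rewrite gE ggE; split => //; exists N; split => // w tw.
by apply: N3; exact: tangent_translate.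
Qed.

Lemma cos_theta_le0 y : cos (theta y) <= 0.
Proof.
have /andP[h1 h2] := theta_range y; rewrite -[theta y](subrK (pi / 2)).
rewrite cosD cos_pihalf mulr0 sub0r sin_pihalf mulr1 oppr_le0.
apply: sin_ge0_pi; rewrite subr_ge0 h1/=.
by have := pi_gt0 R; lra.
Qed.

Lemma cos_theta_gtN1 y : -1 < cos (theta y).
Proof.
have /andP[h1 h2] := theta_range y; have p0 := pi_gt0 R.
by rewrite -cospi ltr_cos// in_itv/=; apply/andP; split; lra.
Qed.

(** Compactness of a period cell turns [theta < pi] into a gap between the cosine and [-1]. The
    strict bound [k < 1] is what makes the capillary Lagrangian dominate the speed. *)
Lemma cos_theta_uniform : exists2 k : R, 0 <= k < 1 &
  forall y, - k <= cos (theta y) <= 0.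
Proof.
pose P (r : R) y := 0 < r /\ 1 <= r * (1 + cos (theta y)).
have [||r hr] := @compact_uniform R _ _ P
    (compact_closed_bounded (M := 1) (closedT : closed [set: 'rV[R]_n])).
- move=> x r r' rr [r0 h]; split; first exact: lt_le_trans rr.
  apply: (le_trans h); rewrite ler_wpM2r//; have := cos_theta_gtN1 x; lra.
- move=> x _; set c := 1 + cos (theta x).
  have c0 : 0 < c by have := cos_theta_gtN1 x; rewrite /c; lra.
  exists (2 / c).
  have : \forall y \near x, cos (theta y) > cos (theta x) - c / 2.
    have cc : {for x, continuous (fun y => cos (theta y))}.
      apply: (@continuous_comp _ _ _ theta cos); first exact: theta_continuous.
      exact: continuous_cos.
    by apply: (cvgr_gt _ cc); lra.
  apply: filterS => y hy; split; first by rewrite divr_gt0.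
  rewrite mulrAC ler_pdivlMr// mul1r; rewrite /c in hy *; lra.
have [r0 _] : P r 0 by apply: hr; split => //=; rewrite normr0.
exists (Num.max 0 (1 - r^-1)).
  by rewrite le_max lexx gt_max ltr01/= ltrBlDr ltrDl invr_gt0.
move=> y; rewrite cos_theta_le0 andbT.
have [z Zz yz] := nearest_Zlattice y.
have [|_] := hr (y - z); first by split.
have -> : theta (y - z) = theta y by rewrite theta_periodic//; exact: ZlatticeN.
rewrite -ler_pdivrMl// mulr1 => h.
have : 1 - r^-1 <= Num.max 0 (1 - r^-1) by rewrite le_max lexx orbT.
lra.
Qed.

End UniformBounds.

(** * Lower bounds for the Lagrangian *)

Definition sgcoord (R : realType) (n : nat) (w : 'rV[R]_n) i : 'rV[R]_n :=
  Num.sg (w 0 i) *: delta_mx 0 i.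

Lemma dot_sgcoord (R : realType) (n : nat) (w q : 'rV[R]_n) i :
  dot (sgcoord w i) q = Num.sg (w 0 i) * q 0 i.
Proof. by rewrite dotZl dot_delta. Qed.

Lemma dot_sgcoord_self (R : realType) (n : nat) (w : 'rV[R]_n) i :
  dot (sgcoord w i) w = `|w 0 i|.
Proof. by rewrite dot_sgcoord -normrEsg. Qed.

Lemma sg_mul_le (R : realType) (a c r : R) : `|c| <= r -> - r <= Num.sg a * c <= r.
Proof.
move=> cr; rewrite -ler_norml normrM (le_trans _ cr)//.
by rewrite ler_piMl// normr_sg; case: eqP.
Qed.

Lemma dot_sgcoord_sqr (R : realType) (n : nat) (w : 'rV[R]_n) i :
  dot (sgcoord w i) (sgcoord w i) <= 1.
Proof.
rewrite dot_sgcoord !mxE !eqxx mulr1 -expr2 -real_normK ?num_real//.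
by rewrite expr_le1// normr_sg; case: eqP.
Qed.

Lemma dotN2 (R : realType) (n : nat) (p q : 'rV[R]_n) : dot (- p) (- q) = dot p q.
Proof. by rewrite dotNl dotNr opprK. Qed.

Lemma enorm_le1D (R : realType) (n : nat) (e nu : 'rV[R]_n) (k : R) : 0 <= k ->
  dot e e <= 1 -> dot nu nu = 1 -> dot e nu <= 1 -> enorm (- (e + k *: nu)) <= 1 + k.
Proof.
move=> k0 ee nn en; rewrite -(@ler_pXn2r _ 2) ?nnegrE ?enorm_ge0 ?addr_ge0//.
rewrite sqr_enorm dotN2 !dotDl !dotDr !dotZl !dotZr nn (dotC nu).
have := ler_wpM2l k0 en; rewrite mulr1.
by move: (k * dot e nu) (dot e e) ee => a c; clear; lra.
Qed.

Lemma dot_expand (R : realType) (n : nat) (e N w v : 'rV[R]_n) (a l : R) :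
  dot (- (e + a *: N)) (- (w + l *: v)) =
  dot e w + l * dot e v + (a * dot N w + a * (l * dot N v)).
Proof. by rewrite dotN2 dotDl !dotDr !dotZl !dotZr. Qed.

Section LowerBounds.
Variables (R : realType) (n : nat) (H : 'rV[R]_n -> 'rV[R]_n -> R) (K0 : R).
Hypothesis H_growth : forall y p,
  enorm p ^+ 2 / 2 - K0 <= H y p <= enorm p ^+ 2 / 2 + K0.
Implicit Types (y w p q : 'rV[R]_n).

Lemma conjugate_ge_sqr y q c p :
  dot p q - (dot p p / 2 + K0) - c * enorm p <= conjugate H y q c.
Proof.
apply: le_trans (conjugate_ge H_growth y q c p).
rewrite /conjugate_arg lerD2r lerD2l lerN2 -sqr_enorm.
by have /andP[] := H_growth y p.
Qed.

Lemma conjugate_lower_interior y w i :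
  `|w 0 i| <= conjugate H y (- w) 0 + (1 / 2 + K0).
Proof.
have := conjugate_ge_sqr y (- w) 0 (- sgcoord w i).
rewrite mul0r subr0 !dotN2 dot_sgcoord_self.
have := dot_sgcoord_sqr w i; move: (dot _ _) `|_| (conjugate _ _ _ _) => A B D h1 h2.
lra.
Qed.

(** The test momentum is [- (e + (2 * r) *: N)] with [e = sgcoord w i]. Its second part does not see
    [w] and earns at least [2 * r * l] from the reflection term; this pays for two losses of at most
    [r * l], one from [e] against [gam] and one from [gy]. *)
Lemma conjugate_lower_oblique y w gam N (l gy r : R) i : 0 < r -> 0 <= l ->
  `|gam| <= r -> `|gy| <= r -> `|N| <= r -> 1 <= dot N gam -> dot N w = 0 ->
  `|w 0 i| <= conjugate H y (- (w + l *: gam)) 0 + l * gy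
    + ((1 + 4 * r * r + 4 * r * r * (n%:R * r ^+ 2)) / 2 + K0).
Proof.
move=> r0 l0 h1 h2 N1 N2 N3.
have ew := dot_sgcoord_self w i; have eq q := dot_sgcoord w q i.
have := dot_sgcoord_sqr w i.
move: (sgcoord w i) ew eq => e ew eq ee.
have := conjugate_ge_sqr y (- (w + l *: gam)) 0 (- (e + (2 * r) *: N)).
rewrite mul0r subr0 !dot_expand ew N3 mulr0 add0r (dotC N e) (eq N) (eq gam).
have /andP[_ eN] := sg_mul_le (w 0 i) (le_trans (coord_le_norm N i) N1).
have /andP[eg _] := sg_mul_le (w 0 i) (le_trans (coord_le_norm gam i) h1).
have NN : dot N N <= n%:R * r ^+ 2.
  rewrite (le_trans (dot_le_norm N))// ler_wpM2l//.
  by rewrite ler_pXn2r ?nnegrE// (ltW r0).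
have gr : - r <= gy by move: h2; rewrite ler_norml => /andP[].
have rr0 : 0 <= 2 * r by rewrite mulr_ge0// ltW.
have a1 := ler_wpM2l l0 eg.
have a2 : l * (2 * r) <= 2 * r * (l * dot N gam).
  by rewrite [leRHS]mulrCA ler_wpM2l// ler_peMr.
have a3 := ler_wpM2l l0 gr.
have a4 := ler_wpM2l rr0 eN.
have a5 := ler_wpM2l rr0 (ler_wpM2l rr0 NN).
move: a1 a2 a3 a4 a5 ee; rewrite !mulrN.
have -> : 4 * r * r * (n%:R * r ^+ 2) = 2 * r * (2 * r * (n%:R * r ^+ 2)) by ring.
have -> : 4 * r * r = 2 * r * r + 2 * r * r by ring.
have -> : l * (2 * r) = l * r + l * r by ring.
move: (l * (Num.sg _ * _)) (2 * r * (l * dot N gam)) (l * gy) => A1 A2 A3.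
move: (2 * r * (Num.sg _ * _)) (2 * r * (2 * r * dot N N)) => A4 A5.
move: (2 * r * (2 * r * _)) (dot e e) (conjugate _ _ _ _) `|w 0 i| => A6 A7 A8 A9.
move: (l * r) (2 * r * r) => A10 A11; lra.
Qed.

(** The test momentum is [- (e + a *: nu)], of norm at most [1 + a]. Its normal part earns [a * l];
    the losses are at most [l] from [e] and [k * l * (1 + a)] from the angle term. The choice
    [a = (1 + k) / (1 - k)] solves [k * (1 + a) = a - 1], so they balance. *)
Lemma conjugate_lower_normal y w nu (l c k : R) i : 0 <= l -> 0 <= k < 1 ->
  - k <= c <= 0 -> dot nu nu = 1 -> dot nu w = 0 ->
  `|w 0 i| <= conjugate H y (- (w + l *: nu)) (c * - l)
    + ((1 + (1 + k) / (1 - k)) ^+ 2 / 2 + K0).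
Proof.
move=> l0 /andP[k0 k1] /andP[kc c0] nn nw.
have ew := dot_sgcoord_self w i; have eq q := dot_sgcoord w q i.
have := dot_sgcoord_sqr w i.
move: (sgcoord w i) ew eq => e ew eq ee.
pose a := (1 + k) / (1 - k).
have a0 : 0 <= a by rewrite divr_ge0//; lra.
have := conjugate_ge_sqr y (- (w + l *: nu)) (c * - l) (- (e + a *: nu)).
have /andP[en1 en2] : - 1 <= Num.sg (w 0 i) * nu 0 i <= 1.
  apply: sg_mul_le; apply: (le_trans (coord_le_enorm nu i)).
  by rewrite /enorm nn sqrtr1.
have E : enorm (- (e + a *: nu)) <= 1 + a.
  by apply: enorm_le1D => //; rewrite eq.
rewrite -[dot (- _) (- (e + _))]sqr_enorm.
have E2 : enorm (- (e + a *: nu)) ^+ 2 <= (1 + a) ^+ 2.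
  by rewrite ler_pXn2r ?nnegrE ?enorm_ge0 ?addr_ge0.
have E3 : - (k * (l * (1 + a))) <= - (c * - l * enorm (- (e + a *: nu))).
  rewrite lerN2 mulrN -mulNr -mulrA.
  rewrite (@le_trans _ _ (k * (l * enorm (- (e + a *: nu)))))//.
    by rewrite ler_wpM2r ?mulr_ge0 ?enorm_ge0//; lra.
  by rewrite !ler_wpM2l.
rewrite dot_expand ew nw nn mulr1 mulr0 add0r (eq nu).
have a1 := ler_wpM2l l0 en1.
have key : k * (l * (1 + a)) = l * a - l by rewrite /a; field; lra.
move: E3 E2 a1; rewrite key mulrN1.
rewrite [a * l]mulrC.
move: (enorm _ ^+ 2) (c * - l * _) (l * (_ * _)) ((1 + a) ^+ 2) => A1 A2 A3 A4.
move: (l * a) `|w 0 i| (conjugate _ _ _ _) => A5 A6 A7; lra.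
Qed.

End LowerBounds.

Lemma ae_neq (R : realType) (c : R) : {ae @lebesgue_measure R, forall s, s != c}.
Proof.
exists [set c]; split; [exact: measurable_set1|exact: lebesgue_measure_set1|].
by move=> s /= /negP; rewrite negbK => /eqP.
Qed.

(** * Operations on curves *)

Lemma quotient_shift (R : realType) (V : normedModType R) (f : R -> V) (a s : R) :
  (fun h : R => h^-1 *: (((fun s => f (s + a)) \o +%R^~ s) (h *: 1) - f (s + a))) =
  (fun h : R => h^-1 *: ((f \o +%R^~ (s + a)) (h *: 1) - f (s + a))).
Proof. by apply/funext => h /=; rewrite addrA. Qed.

Lemma derivable_shift (R : realType) (V : normedModType R) (f : R -> V) (a s : R) :
  derivable f (s + a) 1 -> derivable (fun s => f (s + a)) s 1.
Proof. by rewrite /derivable quotient_shift. Qed.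

Lemma derive1_shift (R : realType) (V : normedModType R) (f : R -> V) (a s : R) :
  derive1 (fun s => f (s + a)) s = derive1 f (s + a).
Proof. by rewrite !derive1E /derive quotient_shift. Qed.

Lemma L1loc_shift (R : realType) (f : R -> R) (a : R) : 0 <= a -> L1loc f ->
  L1loc (fun s => f (s + a)).
Proof.
move=> a0 fL T T0; apply: (integrable_on_integral_on_shift (c := a) _).1.
have := fL (T + a) (addr_ge0 T0 a0); apply: integrable_onS => //.
by rewrite add0r.
Qed.

Lemma ACloc_shift (R : realType) (n : nat) (f : R -> 'rV[R]_n) (a : R) : 0 <= a ->
  ACloc f -> ACloc (fun s => f (s + a)).
Proof.
move=> a0 fA T T0 e e0; have [d d0 hd] := fA (T + a) (addr_ge0 T0 a0) e e0.
exists d => // m u v uv dis lt; apply: hd => [i||].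
- by have [h1 h2 h3] := uv i; split; [rewrite addr_ge0|rewrite lerD2r|rewrite lerD2r].
- move=> i j _ _ [x []] /=; rewrite !in_itv/= => /andP[h1 h2] /andP[h3 h4].
  apply: dis => //; exists (x - a); split => /=; rewrite in_itv/=.
    by rewrite ltrBrDr ltrBlDr h1.
  by rewrite ltrBrDr ltrBlDr h3.
- by apply: le_lt_trans lt; apply: ler_sum => i _; rewrite opprD addrACA subrr addr0.
Qed.

Lemma ACloc_addr (R : realType) (n : nat) (f : R -> 'rV[R]_n) (z : 'rV[R]_n) :
  ACloc f -> ACloc (fun s => f s + z).
Proof.
move=> fA T T0 e e0; have [d d0 hd] := fA T T0 e e0.
exists d => // m u v uv dis lt; apply: le_lt_trans (hd m u v uv dis lt).
by apply: ler_sum => i _; rewrite opprD addrACA subrr addr0.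
Qed.

Definition switch (R : realType) (X : Type) (T : R) (f h : R -> X) (s : R) : X :=
  if s < T then f s else h (s - T).

Lemma integrable_on_switch (R : realType) (T S : R) (f h : R -> R) : 0 <= T -> 0 <= S ->
  integrable_on 0 T f -> integrable_on 0 S h ->
  integrable_on 0 (T + S) (switch T f h) /\
    integral_on 0 (T + S) (switch T f h) = integral_on 0 T f + integral_on 0 S h.
Proof.
move=> T0 S0 fi hi.
have TTS : T <= T + S by rewrite lerDl.
have hs : integrable_on (T - T) (T + S - T) h by rewrite subrr addrC addKr.
have [i1 e1] := integrable_on_integral_on_shift hs.
have i2 : (@lebesgue_measure R).-integrable `[T, T + S] (EFin \o switch T f h).
  apply: eq_integrable i1 => // s; rewrite inE/= in_itv/= => /andP[Ts _].
  by rewrite /switch ltNge Ts.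
have fi' : (@lebesgue_measure R).-integrable `[0, T[ (EFin \o switch T f h).
  have fi' : (@lebesgue_measure R).-integrable `[0, T[ (EFin \o f).
    by apply: integrableS fi => //; apply: subset_itvl; rewrite bnd_simp.
  apply: eq_integrable fi' => // s; rewrite inE/= in_itv/= => /andP[_ sT].
  by rewrite /switch sT.
have mT : measurable_fun `[0, T] (switch T f h).
  apply/measurable_fun_itv_bndo_bndcP.
  by apply/measurable_EFinP; exact: measurable_int fi'.
have fiT : integrable_on 0 T (switch T f h).
  apply: integrable_on_ae fi => //; apply: aeS (ae_neq T) => s sT /andP[_ sT'].
  by rewrite /switch lt_neqAle sT sT'.
have iTS : (@lebesgue_measure R).-integrable `]T, T + S] (EFin \o switch T f h).
  by apply: integrableS i2 => //; apply: subset_itvr; rewrite bnd_simp.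
have tot : integrable_on 0 (T + S) (switch T f h) by exact: integrable_on_glue fiT iTS.
split => //; rewrite (integral_on_split T0 TTS tot); congr (_ + _).
  apply: integral_on_ae => //; first exact: integrable_on_measurable.
  apply: aeS (ae_neq T) => s sT /andP[_ sT'].
  by rewrite /switch lt_neqAle sT sT'.
have e2 : T + S - T = S by rewrite addrC addKr.
rewrite subrr e2 in e1; rewrite -e1.
apply: eq_Rintegral => s; rewrite inE/= in_itv/= => /andP[Ts _].
by rewrite /switch ltNge Ts.
Qed.

Lemma L1loc_switch_loc (R : realType) (T : R) (f h : R -> R) : 0 <= T ->
  L1loc f -> L1loc h -> L1loc (switch T f h).
Proof.
move=> T0 fL hL S S0; have [h1 _] := integrable_on_switch T0 S0 (fL T T0) (hL S S0).
by apply: integrable_onS h1 => //; rewrite lerDr.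
Qed.

Lemma ACloc_switch (R : realType) (n : nat) (T : R) (f h : R -> 'rV[R]_n) :
  0 <= T -> f T = h 0 -> ACloc f -> ACloc h -> ACloc (switch T f h).
Proof.
move=> T0 fh fA hA S S0 e e0.
pose e' := e / (2 * (n%:R + 1)).
have n1 : 0 < 2 * (n%:R + 1) :> R by rewrite mulr_gt0// ltr_wpDl.
have e'0 : 0 < e' by rewrite divr_gt0.
have [d1 d10 hd1] := fA T T0 e' e'0.
have [d2 d20 hd2] := hA S S0 e' e'0.
exists (Num.min d1 d2); first by rewrite lt_min d10.
move=> m u v uv dis; rewrite lt_min => /andP[lt1 lt2].
(* The glued curve is a sum of two curves frozen beyond, respectively before, time [T], so no
   interval has to be cut at [T]. *)
have E s : switch T f h s = f (Num.min s T) + (h (Num.max s T - T) - h 0).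
  rewrite /switch; case: ltP => sT.
    by rewrite subrr subrr addr0.
  by rewrite fh [RHS]addrC subrK.
have tri (x y : 'rV[R]_n) : enorm (x + y) <= (n%:R + 1) * (enorm x + enorm y).
  rewrite (le_trans (enorm_le_norm _))//.
  rewrite (@le_trans _ _ (n%:R * (enorm x + enorm y)))//.
    rewrite ler_wpM2l// (le_trans (ler_normD _ _))// lerD//; exact: norm_le_enorm.
  by rewrite ler_wpM2r ?addr_ge0 ?enorm_ge0// lerDl.
have s1 := hd1 m (fun i => Num.min (u i) T) (fun i => Num.min (v i) T).
have s2 := hd2 m (fun i => Num.max (u i) T - T) (fun i => Num.max (v i) T - T).
have minmax i : [/\ u i <= v i, 0 <= u i & v i <= S] by have [] := uv i.
have {}s1 : \sum_(i < m) enorm (f (Num.min (v i) T) - f (Num.min (u i) T)) < e'.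
  apply: s1 => [i||].
  - have [h1 h2 h3] := minmax i; split.
    + by rewrite le_min h2.
    + by rewrite le_min ge_min h1 ge_min lexx orbT.
    + by rewrite ge_min lexx orbT.
  - move=> i j _ _ [x []] /=; rewrite !in_itv/=.
    move=> /andP[a1 a2] /andP[a3 a4]; apply: dis => //; exists x.
    move: a1 a2 a3 a4; rewrite !lt_min !gt_min => b1 /andP[b2 b3] b4 /andP[b5 b6].
    have xT : (T < x) = false by apply/negbTE; rewrite -leNgt ltW.
    by rewrite xT !orbF in b1 b4; split; rewrite /= in_itv/= ?b1 ?b2 ?b4 ?b5.
  - apply: le_lt_trans lt1; apply: ler_sum => i _; have [h1 _ _] := minmax i.
    by rewrite /Num.min; case: (ltP (v i) T) => ?; case: (ltP (u i) T) => ?; lra.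
have {}s2 : \sum_(i < m) enorm (h (Num.max (v i) T - T) - h (Num.max (u i) T - T)) < e'.
  apply: s2 => [i||].
  - have [h1 h2 h3] := minmax i; split.
    + by rewrite subr_ge0 le_max lexx orbT.
    + by rewrite lerD2r ge_max !le_max h1 lexx orbT.
    + by rewrite lerBlDr ge_max lerDr S0 andbT (le_trans h3)// lerDl.
  - move=> i j _ _ [x []] /=; rewrite !in_itv/= !ltrBlDr !ltrBrDr.
    move=> /andP[a1 a2] /andP[a3 a4]; apply: dis => //; exists (x + T).
    move: a1 a2 a3 a4; rewrite !gt_max !lt_max => /andP[b1 b2] b3 /andP[b4 b5] b6.
    have xT : (x + T < T) = false by apply/negbTE; rewrite -leNgt ltW.
    by rewrite xT !orbF in b3 b6; split; rewrite /= in_itv/= ?b1 ?b3 ?b4 ?b6.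
  - apply: le_lt_trans lt2; apply: ler_sum => i _; have [h1 _ _] := minmax i.
    by rewrite /Num.max; case: (ltP (v i) T) => ?; case: (ltP (u i) T) => ?; lra.
apply: (@le_lt_trans _ _ ((n%:R + 1) *
  (\sum_(i < m) enorm (f (Num.min (v i) T) - f (Num.min (u i) T)) +
   \sum_(i < m) enorm (h (Num.max (v i) T - T) - h (Num.max (u i) T - T))))).
  rewrite -big_split mulr_sumr; apply: ler_sum => i _.
  rewrite !E (_ : _ - _ = f (Num.min (v i) T) - f (Num.min (u i) T) +
    (h (Num.max (v i) T - T) - h (Num.max (u i) T - T))); first exact: tri.
  by rewrite opprD addrACA; congr (_ + _); rewrite opprD addrACA subrr addr0.
have -> : e = (n%:R + 1) * (e' + e') by rewrite /e'; field; rewrite gt_eqF// ltr_wpDl.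
by rewrite ltr_pM2l ?ltrD// ltr_wpDl.
Qed.

Lemma nbhs_of_ball (R : realType) (V : normedModType R) (x : V) (r : R) (B : set V) :
  0 < r -> (forall y, `|y - x| < r -> B y) -> nbhs x B.
Proof.
by move=> r0 h; apply/nbhs_normP; exists r => // y /=; rewrite distrC; exact: h.
Qed.

(** * Trajectories and their cost *)

Section Trajectories.
Variables (R : realType) (n : nat) (Omega : set 'rV[R]_n)
  (H : 'rV[R]_n -> 'rV[R]_n -> R) (K0 : R)
  (gamma : 'rV[R]_n -> 'rV[R]_n) (g theta : 'rV[R]_n -> R) (b : bc).
Hypothesis n_ge2 : (2 <= n)%N.
Hypothesis Omega_open : open Omega.
Hypothesis Omega_connected : connected Omega.
Hypothesis Omega_bdry_neq0 : bdry Omega !=set0.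
Hypothesis Omega_C1 : C1_boundary Omega.
Hypothesis Omega_periodic : [set x + z | x in Omega & z in @Zlattice R n] = Omega.
Hypothesis H_continuous : continuous (fun yp : 'rV[R]_n * 'rV[R]_n => H yp.1 yp.2).
Hypothesis H_periodic : forall p, Zperiodic_on setT (fun y => H y p).
Hypothesis K0_gt0 : 0 < K0.
Hypothesis H_growth : forall y p,
  enorm p ^+ 2 / 2 - K0 <= H y p <= enorm p ^+ 2 / 2 + K0.
Hypothesis gamma_continuous : {within bdry Omega, continuous gamma}.
Hypothesis gamma_periodic : Zperiodic_on (bdry Omega) gamma.
Hypothesis gamma_outward : forall y, bdry Omega y ->
  0 < dot (gamma y) (outward_normal Omega y).
Hypothesis g_continuous : {within bdry Omega, continuous g}.
Hypothesis g_periodic : Zperiodic_on (bdry Omega) g.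
Hypothesis theta_range : forall y, pi / 2 <= theta y < pi.
Hypothesis theta_continuous : continuous theta.
Hypothesis theta_periodic : Zperiodic_on setT theta.
Local Notation mu := (@lebesgue_measure R).
Implicit Types (x y z w : 'rV[R]_n).

(* [g] is only controlled on the boundary; elsewhere it multiplies [l = 0]. *)
Definition gB y : R := (g \_ (bdry Omega)) y.

Definition lagr y (q : 'rV[R]_n) (c : R) : R := lagrangian H gB theta b y q c.

Lemma lagr0_le y q : lagr y q 0 <= dot q q / 2 + K0.
Proof. by rewrite /lagr lagrangianE !mulr0 subr0; exact: conjugate_le. Qed.

Lemma lagr_lower : exists2 C, 0 < C & forall y w (l : R) i, closure Omega y ->
  tangent Omega y w -> 0 <= l -> (Omega y -> l = 0) ->
  `|w 0 i| <= lagr y (- (w + l *: beta Omega gamma b y)) (- l) + C.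
Proof.
have [r r0 tr] := transversal_uniform Omega_open Omega_C1 Omega_periodic
  gamma_continuous gamma_periodic gamma_outward g_continuous g_periodic.
have [k k01 hk] := cos_theta_uniform theta_range theta_continuous theta_periodic.
pose C1 : R := 1 / 2 + K0.
pose C2 : R := (1 + 4 * r * r + 4 * r * r * (n%:R * r ^+ 2)) / 2 + K0.
pose C3 : R := (1 + (1 + k) / (1 - k)) ^+ 2 / 2 + K0.
have C1_gt0 : 0 < C1 by rewrite addr_gt0// divr_gt0.
have C2_gt0 : 0 < C2.
  have rr : 0 <= 4 * r * r by rewrite !mulr_ge0 ?(ltW r0).
  by rewrite addr_gt0// divr_gt0// -addrA ltr_wpDr// addr_ge0// mulr_ge0// mulr_ge0// sqr_ge0.
have C3_gt0 : 0 < C3.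
  by rewrite (lt_le_trans K0_gt0)// lerDr divr_ge0 ?sqr_ge0.
exists (C1 + C2 + C3); first by apply: addr_gt0 => //; exact: addr_gt0.
move=> y w l i cy tw l0 Ol; have [Oy|By] := closure_cases Omega_open cy.
  rewrite (Ol Oy) scale0r addr0 oppr0 /lagr lagrangianE !mulr0 subr0.
  have := conjugate_lower_interior H_growth y w i; rewrite -/C1; lra.
rewrite /lagr lagrangianE; case: (b) => /=.
  rewrite mul0r /gB patchE mem_set// mulrN opprK.
  have [h1 h2 [N [N1 N2 N3]]] := tr y By.
  have := conjugate_lower_oblique H_growth y i r0 l0 h1 h2 N1 N2 (N3 w tw).
  rewrite -/C2 (mulrC (g y)); lra.
rewrite mul0r subr0.
have := conjugate_lower_normal H_growth y i l0 k01 (hk y)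
  (outward_normal_dot Omega_C1 By) (outward_normal_tangent Omega_open Omega_C1 By tw).
rewrite -/C3; lra.
Qed.

Implicit Types (eta v : R -> 'rV[R]_n) (T t : R).

Definition lower_const (C : R) : Prop := 0 < C /\
  forall y w (l : R) i, closure Omega y ->
  tangent Omega y w -> 0 <= l -> (Omega y -> l = 0) ->
  `|w 0 i| <= lagr y (- (w + l *: beta Omega gamma b y)) (- l) + C.

Definition traj (eta v : R -> 'rV[R]_n) (l : R -> R) : Prop :=
  [/\ [/\ ACloc eta, L1loc_vec v & L1loc l],
      (forall s, 0 <= s -> closure Omega (eta s))
    & {ae mu, forall s, 0 <= s ->
        [/\ derivable eta s 1,
            derive1 eta s + l s *: beta Omega gamma b (eta s) = v s,
            0 <= l s
          & Omega (eta s) -> l s = 0]}].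

Lemma SP_traj x eta v l :
  SP Omega gamma b 1 x eta v l <-> eta 0 = x /\ traj eta v l.
Proof.
rewrite /SP /traj dilate1; split=> [[h1 h2 h3 h4]|[h2 [h1 h3 h4]]]; split => //.
  by split => //; apply: aeS h4 => s h s0; have := h s0; rewrite invr1 scale1r.
by apply: aeS h4 => s h s0; have := h s0; rewrite invr1 scale1r.
Qed.

Definition cost (eta v : R -> 'rV[R]_n) (l : R -> R) (s : R) : R :=
  lagr (eta s) (- v s) (- l s).

(** Freezing a curve outside [[0, T]] makes it continuous on the whole line; its values at negative
    times are arbitrary. *)
Definition clamp (T s : R) : R := Num.max 0 (Num.min s T).

Lemma clamp_id T s : 0 <= s <= T -> clamp T s = s.
Proof. by move=> /andP[s0 sT]; rewrite /clamp min_l// max_r. Qed.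

Lemma clamp_itv T s : 0 <= T -> 0 <= clamp T s <= T.
Proof.
by move=> T0; rewrite /clamp le_max lexx/= ge_max T0 ge_min lexx orbT.
Qed.

Lemma clamp_lip T s s' : s <= s' -> 0 <= clamp T s' - clamp T s <= s' - s.
Proof.
rewrite /clamp => ss; rewrite /Num.max /Num.min.
by case: (ltP s T) => ?; case: (ltP s' T) => ?; case: ltP => ?; case: ltP => ?; lra.
Qed.

Lemma ACloc_continuous eta T : 0 <= T -> ACloc eta ->
  continuous (fun s : R => eta (clamp T s)).
Proof.
move=> T0 ac s; apply/cvgrPdist_lt => e e0.
have [d d0 hd] := ac T T0 e e0.
have key (x y : R) : x <= y -> y - x < d -> `|eta (clamp T y) - eta (clamp T x)| < e.
  move=> xy yxd; apply: le_lt_trans (norm_le_enorm _) _.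
  have := hd 1%N (fun=> clamp T x) (fun=> clamp T y).
  rewrite !big_ord1; apply.
  - move=> _; have /andP[h1 h2] := clamp_lip T xy.
    have /andP[h3 h4] := clamp_itv x T0; have /andP[h5 h6] := clamp_itv y T0.
    by split => //; rewrite -subr_ge0.
  - by move=> i j _ _ _; rewrite !ord1.
  - by have /andP[h1 h2] := clamp_lip T xy; apply: le_lt_trans yxd.
apply/nbhs_normP; exists d => //= s' /=; rewrite ltr_norml => /andP[h1 h2].
case: (leP s s') => ss; first by rewrite distrC; apply: key => //; lra.
by apply: key; [exact: ltW|lra].
Qed.

Lemma measurable_continuous_comp eta T (f : 'rV[R]_n -> R) : 0 <= T -> ACloc eta ->
  continuous f -> measurable_fun setT (fun s => f (eta (clamp T s))).
Proof.
move=> T0 ac cf; apply: continuous_measurable_fun => s.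
apply: (@continuous_comp _ _ _ (fun s => eta (clamp T s)) f); last exact: cf.
exact: ACloc_continuous.
Qed.

Lemma measurable_gB eta T : 0 <= T -> ACloc eta ->
  measurable_fun setT (fun s => gB (eta (clamp T s))).
Proof.
move=> T0 ac; pose e s := eta (clamp T s).
have ce : continuous e by exact: ACloc_continuous.
pose D := e @^-1` bdry Omega.
have cD : closed D by apply: closed_comp => [x _|]; [exact: ce|exact: closed_bdry].
have mD : measurable D by exact: closed_measurable.
have mgD : measurable_fun D (g \o e).
  apply: subspace_continuous_measurable_fun => //.
  apply/subspace_continuousP => s Ds.
  have gc : g x @[x --> within (bdry Omega) (nbhs (e s))] --> g (e s).
    by move/subspace_continuousP: g_continuous; apply.
  apply: cvg_comp gc => A hA.
  exact: (ce s _ hA).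
have h := (@measurable_restrictT _ _ _ _ D (g \o e) mD).1 mgD.
apply: eq_measurable_fun h => s _; rewrite /gB !patchE.
have [sD|sD] := pselect (bdry Omega (e s)).
  by rewrite !mem_set.
by rewrite !memNset.
Qed.

Lemma measurable_cost eta v l T : 0 <= T -> traj eta v l ->
  measurable_fun `[0, T] (cost eta v l).
Proof.
move=> T0 [[ac vL lL] _ _].
have mv i : measurable_fun `[0, T] (fun s => v s 0 i).
  by apply/measurable_EFinP; exact: measurable_int (vL i T T0).
have ml : measurable_fun `[0, T] l.
  by apply/measurable_EFinP; exact: measurable_int (lL T T0).
apply: (@eq_measurable_fun _ _ _ _ _ (fun s =>
  conjugate H (eta (clamp T s)) (- v s)
    (angle_weight theta b (eta (clamp T s)) * - l s)
  - flux gB b (eta (clamp T s)) * - l s)).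
  move=> s; rewrite inE/= in_itv/= => sT; rewrite clamp_id//.
  by rewrite /cost /lagr lagrangianE.
have mNl : measurable_fun `[0, T] (fun s => - l s) by exact: measurable_funN.
apply: measurable_funB; last apply: measurable_funM => //.
- apply: (measurable_conjugate H_continuous H_growth).
  + move=> p; apply: measurable_funTS.
    exact: (measurable_continuous_comp T0 ac (continuous_H1 H_continuous (p := p))).
  + move=> i; apply: eq_measurable_fun (measurable_funN (mv i)) => s _.
    by rewrite mxE.
  + apply: measurable_funM => //; apply: measurable_funTS.
    rewrite /angle_weight; case: (b) => //.
    have cc : continuous (fun y => cos (theta y)).
      move=> y; apply: (@continuous_comp _ _ _ theta cos); first exact: theta_continuous.
      exact: continuous_cos.
    exact: (measurable_continuous_comp T0 ac cc).
- apply: measurable_funTS; rewrite /flux; case: (b) => //.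
  exact: measurable_gB.
Qed.

Lemma cost_ge_speed C eta v l : lower_const C -> traj eta v l ->
  {ae mu, forall s, 0 <= s -> [/\ derivable eta s 1, 0 <= cost eta v l s + C &
    forall i, `|derive1 eta s 0 i| <= cost eta v l s + C]}.
Proof.
move=> [C0 hC] [_ cl ae_tr].
have n0 : (0 < n)%N := ltn_trans (ltn0Sn 0) n_ge2.
(* Time zero is discarded because [tangent] asks for the curve to stay in the closure on both
   sides. *)
apply: (aeS2 _ ae_tr (ae_neq 0)) => s tr s0 sge; have [ds dv l0 Ol] := tr sge.
have sgt : 0 < s by rewrite lt_neqAle eq_sym s0.
have tg : tangent Omega (eta s) (derive1 eta s).
  exists eta, s; split => //.
  have : \forall x \near s, 0 < x by exact: lt_nbhsr.
  by apply: filterS => x x0; apply: cl; exact: ltW.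
have h i : `|derive1 eta s 0 i| <= cost eta v l s + C.
  by rewrite /cost -dv; apply: hC => //; exact: cl.
by split => //; apply: le_trans (h (Ordinal n0)).
Qed.

Lemma traj_component C eta v l (a c : R) : lower_const C -> traj eta v l ->
  0 <= a <= c -> integrable_on a c (cost eta v l) ->
  `|eta c - eta a| <= integral_on a c (fun s => cost eta v l s + C).
Proof.
move=> hC tr /andP[a0 ac] ic; have [[AC _ _] _ _] := tr.
have c0 : 0 <= c by exact: le_trans ac.
(* The integrand is nonnegative only almost everywhere, whereas the comparison with an integral asks
   for it at every point. *)
pose G s := Num.max 0 (cost eta v l s + C).
have sp := cost_ge_speed hC tr.
have icC : integrable_on a c (fun s => cost eta v l s + C).
  rewrite /integrable_on (_ : EFin \o _ = (EFin \o cost eta v l) \+ (EFin \o cst C))%E//.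
  by apply: integrableD => //; exact: integrable_on_cst.
have mG : measurable_fun `[a, c] G.
  by apply: measurable_maxr => //; exact: integrable_on_measurable.
have GE : {ae mu, forall s, a <= s <= c -> cost eta v l s + C = G s}.
  apply: aeS sp => s h /andP[s1 _]; rewrite /G max_r//.
  by have [] := h (le_trans a0 s1).
have iG : integrable_on a c G by exact: integrable_on_ae GE icC.
have -> : integral_on a c (fun s => cost eta v l s + C) = integral_on a c G.
  by apply: integral_on_ae => //; exact: integrable_on_measurable.
have bound (sg : R) i : `|sg| = 1 -> sg * (eta c 0 i - eta a 0 i) <= integral_on a c G.
  move=> sg1; rewrite mulrBr.
  apply: (@abs_continuous1_le_integral R a c (fun s => sg * eta s 0 i)) => //.
  - move=> e e0; have [d d0 hd] := AC c c0 e e0; exists d => // m u w uw dis lt.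
    apply: le_lt_trans (hd m u w _ dis lt); last first.
      by move=> j; have [h1 h2 h3] := uw j; split => //; exact: le_trans h1.
    apply: ler_sum => j _; rewrite -mulrBr normrM sg1 mul1r.
    by have := coord_le_enorm (eta (w j) - eta (u j)) i; rewrite !mxE.
  - by move=> s _; rewrite /G le_max lexx.
  apply: aeS sp => s h /andP[s1 s2].
  have [ds _ hi] := h (ltW (le_lt_trans a0 s1)).
  have dsi : derivable (fun s => eta s 0 i) s 1 by exact: (derivable_mxP _ _ _).1.
  split; first exact: derivableM.
  rewrite derive1E (@deriveZ _ _ _ (fun s => eta s 0 i) sg)//.
  have -> : 'D_1 (fun s => eta s 0 i) s = derive1 eta s 0 i.
    by rewrite derive1E derive_mx// mxE.
  rewrite (le_trans (ler_norm _))// normrZ sg1 mul1r (le_trans (hi i))//.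
  by rewrite /G le_max lexx orbT.
apply: norm_le_coord => [|i].
  by apply: Rintegral_ge0 => s _; rewrite /G le_max lexx.
rewrite !mxE; have b1 := bound 1 i; have b2 := bound (-1) i.
rewrite normr1 in b1; rewrite normrN1 in b2.
by rewrite ler_norml; have := b1 erefl; have := b2 erefl; rewrite mul1r mulN1r; lra.
Qed.

Lemma integral_cost_ge C eta v l (a c : R) : lower_const C -> traj eta v l ->
  0 <= a <= c -> integrable_on a c (cost eta v l) ->
  - C * (c - a) <= integral_on a c (cost eta v l).
Proof.
move=> hC tr /andP[a0 ac] ic; rewrite -integral_on_cst//.
apply: integral_on_le => //; first exact: integrable_on_cst.
apply: aeS (cost_ge_speed hC tr) => s h /andP[s1 _].
by have [_ h2 _] := h (le_trans a0 s1); rewrite /= -subr_ge0 opprK.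
Qed.

(** Off the boundary [g] is arbitrary, so the integrand of [action] may fail to be measurable. There
    [l] vanishes at almost every time, so it agrees almost everywhere with the measurable [cost]. *)
Lemma action_cost eta v l t : traj eta v l -> 0 <= t ->
  (action H g theta b 1 t eta v l =
   \int[mu]_(s in `[0%R, t]) (cost eta v l s)%:E)%E.
Proof.
move=> tr t0; rewrite /action; apply: ae_eq_integral_nonmeasurable => //.
  by apply/measurable_EFinP; exact: measurable_cost.
have [_ cl ae_tr] := tr.
apply: aeS ae_tr => s h; rewrite /= in_itv/= => /andP[s0 _].
have [_ _ _ Ol] := h s0; rewrite invr1 scale1r; congr EFin.
rewrite /cost /lagr !lagrangianE; congr (_ - _).
have [Os|Bs] := closure_cases Omega_open (cl s s0).
  by rewrite (Ol Os) oppr0 !mulr0.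
by rewrite /flux /gB; case: (b) => //; rewrite patchE mem_set.
Qed.

(** The cost is bounded below almost everywhere, so its negative part has a finite integral and only
    the value [+oo] can prevent integrability. *)
Lemma action_cases eta v l t : traj eta v l -> 0 <= t ->
  action H g theta b 1 t eta v l = +oo%E \/
  (integrable_on 0 t (cost eta v l) /\
   action H g theta b 1 t eta v l = (integral_on 0 t (cost eta v l))%:E).
Proof.
move=> tr t0; rewrite action_cost//.
have [C C0 hC'] := lagr_lower; have hC : lower_const C by split.
have mc := measurable_cost t0 tr.
pose f s := Num.max (- C) (cost eta v l s).
have mf : measurable_fun `[0, t] f by exact: measurable_maxr.
have fE : {ae mu, forall s, 0 <= s <= t -> cost eta v l s = f s}.
  apply: aeS (cost_ge_speed hC tr) => s h /andP[s0 _].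
  by have [_ h2 _] := h s0; rewrite /f max_r//; lra.
have [ic|nic] := pselect (integrable_on 0 t f).
  right; have ic' : integrable_on 0 t (cost eta v l).
    by apply: integrable_on_ae ic => //; apply: aeS fE => s h /h.
  split => //; rewrite /integral_on /Rintegral fineK//.
  exact: integrable_fin_num.
left.
have -> : (\int[mu]_(s in `[0%R, t]) (cost eta v l s)%:E =
           \int[mu]_(s in `[0%R, t]) (f s)%:E)%E.
  apply: ae_eq_integral => //; [exact/measurable_EFinP|exact/measurable_EFinP|].
  case: fE => N [mN N0 sub]; exists N; split => // x /= /not_implyP[xab h'].
  by apply: sub => /= fh; apply: h'; rewrite fh.
have mfE : measurable_fun `[0, t] (EFin \o f) by exact/measurable_EFinP.
rewrite integralE.
have negfin : (\int[mu]_(x in `[0%R, t]) (fun s => (f s)%:E)^\- x < +oo)%E.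
  apply: (@le_lt_trans _ _ (\int[mu]_(x in `[0%R, t]) (cst C%:E x)))%E.
    apply: ge0_le_integral => //; first exact: measurable_funeneg.
    move=> s _; rewrite funenegE /= ge_max lee_fin; apply/andP; split.
      by rewrite lerNl /f le_max lexx.
    by rewrite lee_fin ltW// hC.1.
  have /integrableP[_] := integrable_on_cst 0 t C.
  apply: le_lt_trans; apply: ge0_le_integral => //.
  - by move=> s _; rewrite /= lee_fin ltW.
  - exact: (measurable_cst `|C|%:E).
  - by move=> s _; rewrite /= lee_fin ler_norm.
have posy : (\int[mu]_(x in `[0%R, t]) (fun s => (f s)%:E)^\+ x = +oo)%E.
  apply/eqP; rewrite -leye_eq leNgt; apply/negP => fin.
  apply: nic; apply/integrableP; split => //.
  have -> : (fun s : R => `|(EFin \o f) s|)%E = ((EFin \o f)^\+ \+ (EFin \o f)^\-)%E.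
    by rewrite -fune_abse.
  rewrite ge0_integralD//; [|exact: measurable_funepos|exact: measurable_funeneg].
  exact: lte_add_pinfty.
by rewrite posy addye// eqe_oppLR/= lt_eqF.
Qed.

(** * Translating, shifting and concatenating trajectories *)

Lemma gB_translate y z : Zlattice z -> gB (y + z) = gB y.
Proof.
move=> Zz; rewrite /gB !patchE.
have [By|By] := pselect (bdry Omega y).
  by rewrite !mem_set ?g_periodic//; exact: bdry_translate.
rewrite !memNset// => /(bdry_translate Omega_open Omega_periodic (ZlatticeN Zz)).
by rewrite addrK.
Qed.

Lemma lagr_translate y z (q : 'rV[R]_n) (c : R) : Zlattice z ->
  lagr (y + z) q c = lagr y q c.
Proof.
move=> Zz; rewrite /lagr !lagrangianE /flux gB_translate// /angle_weight theta_periodic//.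
congr (_ - _); rewrite /conjugate /conjugate_arg; congr sup.
by apply: eq_imagel => p _; rewrite H_periodic.
Qed.

Lemma beta_translate y z : bdry Omega y -> Zlattice z ->
  beta Omega gamma b (y + z) = beta Omega gamma b y.
Proof.
move=> By Zz; rewrite /beta; case: (b); first exact: gamma_periodic.
exact: outward_normal_translate.
Qed.

Lemma traj_translate eta v l z : Zlattice z -> traj eta v l ->
  traj (fun s => eta s + z) v l.
Proof.
move=> Zz [[ac vL lL] cl ae_tr]; split.
- by split => //; exact: ACloc_addr.
- by move=> s s0; apply: closure_translate => //; exact: cl.
apply: aeS ae_tr => s h s0; have [d1 d2 l0 Ol] := h s0; split.
- exact: derivable_addr d1.
- rewrite derive1_addr -d2; congr (_ + _).
  have [Os|Bs] := closure_cases Omega_open (cl s s0).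
    by rewrite (Ol Os) !scale0r.
  by rewrite beta_translate.
- exact: l0.
- by move=> /(Omega_translate Omega_periodic _ Zz); exact: Ol.
Qed.

Lemma traj_shift eta v l (a : R) : 0 <= a -> traj eta v l ->
  traj (fun s => eta (s + a)) (fun s => v (s + a)) (fun s => l (s + a)).
Proof.
move=> a0 [[ac vL lL] cl ae_tr]; split.
- split; [exact: ACloc_shift| |exact: L1loc_shift].
  by move=> i; apply: (L1loc_shift a0 (vL i)).
- by move=> s s0; apply: cl; exact: addr_ge0.
apply: aeS (ae_shift a ae_tr) => s h s0; have [d1 d2 l0 Ol] := h (addr_ge0 s0 a0).
by split; [exact: derivable_shift d1|rewrite derive1_shift|exact: l0|exact: Ol].
Qed.

Lemma traj_switch T eta1 v1 l1 eta2 v2 l2 : 0 <= T -> eta1 T = eta2 0 ->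
  traj eta1 v1 l1 -> traj eta2 v2 l2 ->
  traj (switch T eta1 eta2) (switch T v1 v2) (switch T l1 l2).
Proof.
move=> T0 e12 [[ac1 vL1 lL1] cl1 ae1] [[ac2 vL2 lL2] cl2 ae2]; split.
- split; [exact: ACloc_switch| |exact: L1loc_switch_loc].
  move=> i; have := L1loc_switch_loc T0 (vL1 i) (vL2 i).
  by congr L1loc; apply/funext => s; rewrite /switch; case: ifP.
- move=> s s0; rewrite /switch; case: ltP => sT; first exact: cl1.
  by apply: cl2; rewrite subr_ge0.
have ae2' := ae_shift (- T) ae2.
have ae3 : {ae mu, forall s, s != T /\ (0 <= s -> [/\ derivable eta1 s 1,
    derive1 eta1 s + l1 s *: beta Omega gamma b (eta1 s) = v1 s, 0 <= l1 s
    & Omega (eta1 s) -> l1 s = 0])}.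
  by apply: aeS2 (ae_neq T) ae1 => s h1 h2; split.
apply: aeS2 ae3 ae2' => s [sT h1] h2 s0; rewrite /switch.
case: (ltP s T) => lt.
  have [d1 d2 l0 Ol] := h1 s0.
  have near : {near s, eta1 =1 switch T eta1 eta2}.
    have : \forall x \near s, x < T by exact: lt_nbhsl.
    by apply: filterS => x xT; rewrite /switch xT.
  split; [exact: near_eq_derivable near d1| |exact: l0|exact: Ol].
  by rewrite derive1E -(near_eq_derive _ near) -derive1E.
have Ts : T < s by rewrite lt_neqAle eq_sym sT.
have [|d1 d2 l0 Ol] := h2; first by rewrite subr_ge0.
have near : {near s, (fun x : R => eta2 (x - T)) =1 switch T eta1 eta2}.
  have : \forall x \near s, T < x by exact: lt_nbhsr.
  by apply: filterS => x xT; rewrite /switch ltNge ltW.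
split; [ |rewrite derive1E -(near_eq_derive _ near) -derive1E|exact: l0|exact: Ol].
  apply: near_eq_derivable near _; exact: derivable_shift d1.
by rewrite derive1_shift.
Qed.

Lemma cost_switch T eta1 v1 l1 eta2 v2 l2 :
  cost (switch T eta1 eta2) (switch T v1 v2) (switch T l1 l2) =
  switch T (cost eta1 v1 l1) (cost eta2 v2 l2).
Proof. by apply/funext => s; rewrite /cost /switch; case: ifP. Qed.

(** * Straight motions and reachability at finite cost *)

Lemma ACloc_ray x w T : ACloc (fun s : R => x + Num.min s T *: w).
Proof.
move=> S S0 e e0; exists (e / (enorm w + 1)).
  by rewrite divr_gt0// ltr_wpDl// enorm_ge0.
move=> m u v uv _ lt.
have E a c : a <= c -> enorm (x + Num.min c T *: w - (x + Num.min a T *: w)) <=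
    (c - a) * (enorm w + 1).
  move=> ac; rewrite opprD addrACA subrr add0r -scalerBl /enorm dotZl dotZr mulrA.
  rewrite -expr2 sqrtrM ?sqr_ge0// sqrtr_sqr -/(enorm w).
  have h1 : `|Num.min c T - Num.min a T| <= c - a.
    by rewrite /Num.min ler_norml; case: (ltP c T) => ?; case: (ltP a T) => ?; lra.
  apply: ler_pM => //; first exact: enorm_ge0.
  by rewrite lerDl.
apply: (@le_lt_trans _ _ ((\sum_(i < m) (v i - u i)) * (enorm w + 1))).
  by rewrite mulr_suml; apply: ler_sum => i _; apply: E; have [] := uv i.
by rewrite -ltr_pdivlMr// ltr_wpDl// enorm_ge0.
Qed.

Lemma measurable_switch_cst T (c d : R) (D : set R) : measurable D ->
  measurable_fun D (switch T (cst c) (cst d)).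
Proof.
move=> mD; apply: measurable_funTS.
rewrite (_ : switch _ _ _ = fun s => if s < T then cst c s else cst d s)//.
have mT : measurable_fun [set: R] (fun s : R => s < T) by apply: measurable_fun_ltr.
exact: (@measurable_fun_ifT _ _ R R (cst c) (cst d) _ mT (measurable_cst _) (measurable_cst _)).
Qed.

Lemma L1loc_switch_cst T (c d : R) : L1loc (switch T (cst c) (cst d)).
Proof.
move=> S S0; apply: (@integrable_on_bounded _ _ _ _ (`|c| + `|d|)).
  exact: measurable_switch_cst.
move=> s _; rewrite /switch; case: ifP => _; first by rewrite lerDl.
by rewrite lerDr.
Qed.

Lemma traj_ray x w T : 0 <= T ->
  (forall s, 0 <= s <= T -> closure Omega (x + s *: w)) ->
  traj (fun s => x + Num.min s T *: w) (switch T (cst w) (cst 0)) (cst 0).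
Proof.
move=> T0 cl; split.
- split; first exact: ACloc_ray.
    move=> i; have := L1loc_switch_cst T (w 0 i) 0; congr L1loc.
    by apply/funext => s; rewrite /switch; case: ifP; rewrite //= mxE.
  by move=> S S0; exact: (integrable_on_cst 0 S 0).
- by move=> s s0; apply: cl; rewrite le_min s0 T0 ge_min lexx orbT.
apply: aeS (ae_neq T) => s sT s0.
case: (ltP s T) => lt.
  have q : (fun h : R => h^-1 *: (((fun s : R => x + s *: w) \o +%R^~ s) (h *: 1)
      - (x + s *: w))) = fun h : R => h^-1 *: (h *: w).
    apply/funext => h /=; congr (_ *: _).
    by rewrite [h *: 1]mulr1 scalerDl addrCA addrK.
  have lim : (fun h : R => h^-1 *: (h *: w)) @ 0^' --> w.
    have e : {near 0^', (fun=> w) =1 (fun h : R => h^-1 *: (h *: w))}.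
      have : \forall h \near (0 : R)^', h != 0 by exact: nbhs_dnbhs_neq.
      by apply: filterS => h h0; rewrite scalerA mulVf// scale1r.
    exact: cvg_trans (near_eq_cvg e) (cvg_cst w).
  have d1 : derivable (fun s : R => x + s *: w) s 1.
    by rewrite /derivable q; apply/cvg_ex; exists w.
  have d2 : 'D_1 (fun s : R => x + s *: w) s = w.
    by rewrite /derive q; apply/cvg_lim.
  have near : {near s, (fun s : R => x + s *: w) =1 (fun s => x + Num.min s T *: w)}.
    have : \forall y \near s, y < T by exact: lt_nbhsl.
    by apply: filterS => y yT; rewrite min_l// ltW.
  split; [exact: near_eq_derivable near d1| |exact: lexx|by move=> _].
  by rewrite derive1E -(near_eq_derive _ near) d2 scale0r addr0 /switch lt.
have Ts : T < s by rewrite lt_neqAle eq_sym sT.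
have near : {near s, cst (x + T *: w) =1 (fun s => x + Num.min s T *: w)}.
  have : \forall y \near s, T < y by exact: lt_nbhsr.
  by apply: filterS => y yT; rewrite /= min_r// ltW.
split; [exact: near_eq_derivable near (derivable_cst _ _ _)| |exact: lexx|by move=> _].
rewrite derive1E -(near_eq_derive _ near) derive_cst scale0r addr0 /switch.
by rewrite ltNge lt.
Qed.

(** An actual path of finite real cost replaces the extended-real infimum [metric], so that paths
    can be cut and concatenated. *)
Definition reach T x y (A : R) : Prop :=
  exists eta v l, [/\ traj eta v l, eta 0 = x, eta T = y,
    integrable_on 0 T (cost eta v l) & integral_on 0 T (cost eta v l) <= A].

Lemma reach_le T x y (A B : R) : A <= B -> reach T x y A -> reach T x y B.
Proof.
move=> AB [eta [v [l [h1 h2 h3 h4 h5]]]]; exists eta, v, l; split => //.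
exact: le_trans AB.
Qed.

Lemma reach_concat (T1 T2 : R) x y z (A1 A2 : R) : 0 <= T1 -> 0 <= T2 ->
  reach T1 x y A1 -> reach T2 y z A2 -> reach (T1 + T2) x z (A1 + A2).
Proof.
move=> T10 T20 [eta1 [v1 [l1 [tr1 e1 f1 i1 a1]]]] [eta2 [v2 [l2 [tr2 e2 f2 i2 a2]]]].
have [i a] := integrable_on_switch T10 T20 i1 i2.
exists (switch T1 eta1 eta2), (switch T1 v1 v2), (switch T1 l1 l2); split.
- by apply: traj_switch => //; rewrite f1.
- rewrite /switch; case: ltP => // T1le.
  have T1E : T1 = 0 by apply/eqP; rewrite eq_le T1le.
  by rewrite T1E subrr e2 -f1 T1E.
- by rewrite /switch ltNge lerDl T20/= addrC addKr.
- by rewrite cost_switch.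
- by rewrite cost_switch a lerD.
Qed.

Lemma reach_translate T x y z (A : R) : Zlattice z -> reach T x y A ->
  reach T (x + z) (y + z) A.
Proof.
move=> Zz [eta [v [l [tr e1 e2 i a]]]].
have E : cost (fun s => eta s + z) v l = cost eta v l.
  by apply/funext => s; rewrite /cost lagr_translate.
exists (fun s => eta s + z), v, l; split; rewrite ?e1 ?e2 ?E//.
exact: traj_translate.
Qed.

Lemma reach_sub eta v l (a c : R) : traj eta v l -> 0 <= a <= c ->
  integrable_on a c (cost eta v l) ->
  reach (c - a) (eta a) (eta c) (integral_on a c (cost eta v l)).
Proof.
move=> tr /andP[a0 ac] i.
have i' : integrable_on (0 + a) (c - a + a) (cost eta v l) by rewrite add0r subrK.
have [i1 e1] := integrable_on_integral_on_shift i'.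
exists (fun s => eta (s + a)), (fun s => v (s + a)), (fun s => l (s + a)); split.
- exact: traj_shift.
- by rewrite add0r.
- by rewrite subrK.
- exact: i1.
- by move: e1; rewrite add0r subrK => <-.
Qed.

Lemma reach_ray T x w : 0 <= T ->
  (forall s, 0 <= s <= T -> closure Omega (x + s *: w)) ->
  reach T x (x + T *: w) ((dot w w / 2 + K0) * T).
Proof.
move=> T0 cl; have tr := traj_ray T0 cl.
have n0 : (0 < n)%N := ltn_trans (ltn0Sn 0) n_ge2.
have w0 : 0 <= dot w w by rewrite -sqr_enorm sqr_ge0.
pose e s := x + Num.min s T *: w.
pose v := switch T (cst w) (cst 0).
have up s : cost e v (cst 0) s <= dot w w / 2 + K0.
  rewrite /cost /= oppr0 (le_trans (lagr0_le _ _))// lerD2r ler_pM2r// dotN2.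
  rewrite /v /switch; case: ifP => // _.
  by rewrite [dot _ _]big1// => i _; rewrite mxE mul0r.
have lo s : - (1 / 2 + K0) <= cost e v (cst 0) s.
  rewrite /cost /= oppr0 /lagr lagrangianE !mulr0 subr0.
  have := conjugate_lower_interior H_growth (e s) (v s) (Ordinal n0).
  have := normr_ge0 (v s 0 (Ordinal n0)); lra.
have ic : integrable_on 0 T (cost e v (cst 0)).
  apply: (@integrable_on_bounded _ _ _ _ (dot w w / 2 + (1 / 2 + K0))).
    exact: measurable_cost.
  move=> s _; rewrite ler_norml; apply/andP; split.
    by rewrite (le_trans _ (lo s))// lerN2 lerDr divr_ge0.
  by rewrite (le_trans (up s))// lerD2l lerDr divr_ge0.
exists e, v, (cst 0); split => //.
- by rewrite /e min_l// scale0r addr0.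
- by rewrite /e minxx.
have <- : integral_on 0 T (cst (dot w w / 2 + K0)) = (dot w w / 2 + K0) * T.
  by rewrite integral_on_cst// subr0.
apply: integral_on_le => //; first exact: integrable_on_cst.
by apply: aeW => s _; exact: up.
Qed.

Lemma reach_wait T x : 0 <= T -> closure Omega x -> reach T x x (K0 * T).
Proof.
move=> T0 cx; have := @reach_ray T x 0 T0.
rewrite scaler0 addr0 [dot _ _]big1 ?mul0r ?add0r; first by apply => s _; rewrite scaler0 addr0.
by move=> i _; rewrite mxE mul0r.
Qed.

Lemma reach_segment T x y : 0 < T ->
  (forall s : R, 0 <= s <= 1 -> closure Omega (x + s *: (y - x))) ->
  reach T x y (dot (y - x) (y - x) / (2 * T) + K0 * T).
Proof.
move=> T0 cl; have := @reach_ray T x (T^-1 *: (y - x)) (ltW T0).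
rewrite scalerA divff ?gt_eqF// scale1r (addrC x (y - x)) subrK dotZl dotZr.
have -> : (T^-1 * (T^-1 * dot (y - x) (y - x)) / 2 + K0) * T =
    dot (y - x) (y - x) / (2 * T) + K0 * T.
  by field; rewrite gt_eqF.
apply => s /andP[s0 sT]; rewrite scalerA; apply: cl.
by rewrite divr_ge0 ?(ltW T0)//= ler_pdivrMr// mul1r.
Qed.

Lemma reach_metric T x y (A : R) : 0 <= T -> reach T x y A ->
  (metric Omega H gamma g theta b T x y <= A%:E)%E.
Proof.
move=> T0 [eta [v [l [tr e1 e2 i a]]]]; apply: (@le_trans _ _ (action H g theta b 1 T eta v l)).
  apply: ereal_inf_lbound; exists eta, v, l; split => //.
  by apply/SP_traj.
have [E|[_ ->]] := action_cases tr T0; last by rewrite lee_fin.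
move: E; rewrite action_cost// => E.
have := integrable_fin_num _ i; rewrite /= E.
by move=> /(_ (measurable_itv _)).
Qed.

(** * Connections of bounded cost *)

Lemma is_derive_ray (f : 'rV[R]_n -> R) x w (s : R) : differentiable f (x + s *: w) ->
  is_derive s 1 (fun s : R => f (x + s *: w)) (dot (grad f (x + s *: w)) w).
Proof.
move=> df; have dw : derivable f (x + s *: w) w by exact: diff_derivable.
have q : (fun h : R => h^-1 *: (((fun s : R => f (x + s *: w)) \o +%R^~ s) (h *: 1)
      - f (x + s *: w))) =
    fun h : R => h^-1 *: ((f \o +%R^~ (x + s *: w)) (h *: w) - f (x + s *: w)).
  apply/funext => h /=; congr (_ *: (f _ - _)).
  by rewrite [h *: 1]mulr1 scalerDl addrCA.
apply: DeriveDef; first by rewrite /derivable q.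
by rewrite -(derive_grad _ df) -deriveE// /derive q.
Qed.

(** With [w] opposite to the gradient at [x0], the defining function decreases strictly along [w]
    near [x0]. It is nonpositive on the closure, so by the mean value theorem it is negative after
    any short step, for all nearby [x] at once. *)
Lemma inward_segments x0 : bdry Omega x0 -> exists w r, 0 < r /\
  forall x, closure Omega x -> `|x - x0| < r ->
  forall s, 0 < s <= r -> Omega (x + s *: w).
Proof.
move=> B0; have [f [U [oU U0 [dif cg] g0 UO]]] := Omega_C1 B0.
pose w := - grad f x0.
have c0 : dot (grad f x0) w < 0.
  by rewrite dotNr oppr_lt0 -sqr_enorm exprn_gt0// enorm_gt0// g0.
have cdot : {for x0, continuous (fun x => dot (grad f x) w)}.
  apply: (@continuous_comp _ _ _ (grad f) (fun p => dot p w)); first exact: cg.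
  exact: continuous_dot.
have : \forall x \near x0, U x /\ dot (grad f x) w < 0.
  apply: filterI; first exact: open_nbhs_nbhs.
  exact: (cvgr_lt _ cdot).
move=> /nbhs_normP[r /= r0 hr].
have w0 : 0 < 1 + `|w| by rewrite ltr_pwDl.
pose r1 := r / (2 * (1 + `|w|)).
have r10 : 0 < r1 by rewrite divr_gt0// mulr_gt0.
have r1E : r1 + r1 * `|w| = r / 2.
  by rewrite /r1; field; rewrite gt_eqF.
exists w, r1; split => // x cx xx0 s /andP[s0 sr].
have inb (u : R) : 0 <= u <= s -> U (x + u *: w) /\ dot (grad f (x + u *: w)) w < 0.
  move=> /andP[u0 us]; apply: hr; rewrite /= opprD addrA.
  apply: (le_lt_trans (ler_normB _ _)); rewrite normrZ (ger0_norm u0) distrC.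
  have : u * `|w| <= r1 * `|w| by rewrite ler_wpM2r// (le_trans us).
  lra.
have dfu (u : R) : 0 <= u <= s -> is_derive u 1 (fun u : R => f (x + u *: w))
    (dot (grad f (x + u *: w)) w).
  by move=> /inb[Uu _]; apply: is_derive_ray; exact: dif.
have [||c cs E] := @MVT R (fun u => f (x + u *: w)) (fun u => dot (grad f (x + u *: w)) w)
    0 s s0.
- by move=> u; rewrite in_itv/= => /andP[u0 us]; apply: dfu; rewrite !ltW.
- apply: derivable_within_continuous => u; rewrite in_itv/= => us.
  by have [] := dfu u us.
have [Us _] := inb s (introT andP (conj (ltW s0) (lexx s))).
apply/UO => //; move: E; rewrite scale0r addr0 subr0 => E.
have [Ux _] : U x /\ dot (grad f x) w < 0.
  by have := inb 0; rewrite scale0r addr0; apply; rewrite lexx ltW.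
have fx := defining_le0 oU dif UO Ux cx.
have : dot (grad f (x + c *: w)) w * s < 0.
  rewrite pmulr_llt0//; move: cs; rewrite in_itv/= => /andP[c1 c2].
  by have [] := inb c; rewrite ?ltW.
lra.
Qed.

(** Asking for every positive duration makes the relation transitive: the time is simply divided. *)
Definition link x y : Prop := forall T, 0 < T -> exists A, reach T x y A.

Lemma link_trans x y z : link x y -> link y z -> link x z.
Proof.
move=> h1 h2 T T0; have T20 : 0 < T / 2 by rewrite divr_gt0.
have [A hA] := h1 _ T20; have [B hB] := h2 _ T20; exists (A + B).
by rewrite (splitr T); apply: reach_concat hA hB; exact: ltW.
Qed.

Lemma reach_ball x0 (r T : R) x y : 0 < T -> (forall y, `|y - x0| < r -> Omega y) ->
  `|x - x0| < r -> `|y - x0| < r ->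
  reach T x y (n%:R * (2 * r) ^+ 2 / (2 * T) + K0 * T).
Proof.
move=> T0 br xr yr; have := @reach_segment T x y T0.
have r0 : 0 < r by exact: le_lt_trans xr.
have d : `|y - x| <= 2 * r.
  rewrite (_ : y - x = (y - x0) - (x - x0)); last by rewrite opprB addrA subrK.
  by apply: (le_trans (ler_normB _ _)); lra.
move=> h; have {}h := h _; apply: reach_le (h _).
  have T2 : 0 < (2 * T)^-1 by rewrite invr_gt0 mulr_gt0.
  rewrite lerD2r (ler_pM2r T2); apply: (le_trans (dot_le_norm _)).
  apply: ler_wpM2l; first exact: ler0n.
  by rewrite ler_pXn2r// nnegrE// mulr_ge0// ltW.
move=> s /andP[s0 s1]; apply: subset_closure; apply: br.
rewrite (_ : _ - x0 = (1 - s) *: (x - x0) + s *: (y - x0)).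
  apply: (le_lt_trans (ler_normD _ _)).
  rewrite !normrZ !ger0_norm// ?subr_ge0//.
  have [->|s0'] := eqVneq s 0; first by rewrite subr0 mul1r mul0r addr0.
  have h1 : s * `|y - x0| < s * r by rewrite ltr_pM2l// lt_neqAle eq_sym s0'.
  have h2 : (1 - s) * `|x - x0| <= (1 - s) * r by rewrite ler_wpM2l ?subr_ge0// ltW.
  lra.
by apply/rowP => i; rewrite !mxE; ring.
Qed.

Lemma Omega_ball x0 : Omega x0 -> exists2 r : R, 0 < r & forall y, `|y - x0| < r -> Omega y.
Proof.
move=> O0; have /nbhs_normP[r /= r0 hr] := open_nbhs_nbhs (conj Omega_open O0).
by exists r => // y yr; apply: hr; rewrite /= distrC.
Qed.

Lemma link_ball x0 r x y : (forall y, `|y - x0| < r -> Omega y) ->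
  `|x - x0| < r -> `|y - x0| < r -> link x y.
Proof. by move=> br xr yr T T0; eexists; exact: reach_ball br xr yr. Qed.

Lemma link_Omega p q : Omega p -> Omega q -> link p q.
Proof.
move=> Op; pose B := [set q | Omega q /\ link p q].
suff -> : Omega = B by move=> [].
have BO : B `<=` Omega by move=> x [].
apply/esym; apply: Omega_connected.
- exists p; split => //; have [r r0 br] := Omega_ball Op.
  by apply: (link_ball br); rewrite subrr normr0.
- exists B; last by rewrite setIidr.
  rewrite openE => x [Ox px]; have [r r0 br] := Omega_ball Ox.
  have : nbhs (x : 'rV[R]_n) B; last by [].
  apply: (@nbhs_of_ball R 'rV[R]_n x r B r0) => y yr; split; first exact: br.
  by apply: link_trans px (link_ball br _ yr); rewrite subrr normr0.
- exists (closure B); first exact: closed_closure.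
  apply/seteqP; split => [x Bx|x [Ox /closure_normP cx]].
    by split; [exact: BO|exact: subset_closure].
  split => //; have [r r0 br] := Omega_ball Ox.
  have [y [Oy py] xy] := cx r r0.
  by apply: link_trans py (link_ball br _ _); rewrite ?subrr ?normr0// distrC.
Qed.

(** Both directions are recorded since the cost is in general not invariant under time reversal. *)
Definition bireach T p x (A : R) := reach T p x A /\ reach T x p A.

Lemma bireach_le T x y (A B : R) : A <= B -> bireach T x y A -> bireach T x y B.
Proof. by move=> AB [h1 h2]; split; exact: reach_le AB _. Qed.

Lemma bireach_concat (T1 T2 : R) x y z (A1 A2 : R) : 0 <= T1 -> 0 <= T2 ->
  bireach T1 x y A1 -> bireach T2 y z A2 -> bireach (T1 + T2) x z (A1 + A2).
Proof.
move=> h1 h2 [a1 b1] [a2 b2]; split; first exact: reach_concat a1 a2.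
by rewrite addrC (addrC A1); exact: reach_concat b2 b1.
Qed.

Lemma bireach_Omega T p q : 0 < T -> Omega p -> Omega q -> exists A, bireach T p q A.
Proof.
move=> T0 Op Oq; have [A hA] := link_Omega Op Oq T0; have [B hB] := link_Omega Oq Op T0.
exists (Num.max A B); split; [apply: reach_le hA|apply: reach_le hB].
  by rewrite le_max lexx.
by rewrite le_max lexx orbT.
Qed.

(** Near a boundary point [x0], each [x] is first pushed by [r *: w] into one ball inside [Omega]
    around [q], with the same bound for all [x]; the time is divided as [1/4 + 1/8 + 1/8]. *)
Lemma bireach_near p x0 : Omega p -> closure Omega x0 ->
  exists A, \forall x \near x0, closure Omega x -> bireach 2^-1 p x A.
Proof.
move=> Op cx0; have e0 : 0 < 4^-1 :> R by rewrite invr_gt0.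
have [Ox0|Bx0] := closure_cases Omega_open cx0.
  have [r r0 br] := Omega_ball Ox0; have [A hA] := bireach_Omega e0 Op Ox0.
  pose A' := n%:R * (2 * r) ^+ 2 / (2 * 4^-1) + K0 * 4^-1.
  exists (A + A'); apply/nbhs_normP; exists r => // x /=; rewrite distrC => xr _.
  have -> : 2^-1 = 4^-1 + 4^-1 :> R by field.
  apply: (bireach_concat (ltW e0) (ltW e0) hA).
  have x00 : `|x0 - x0| < r by rewrite subrr normr0.
  by split; [exact: reach_ball e0 br x00 xr|exact: reach_ball e0 br xr x00].
have [w [r [r0 hw]]] := inward_segments Bx0.
have f0 : 0 < 8^-1 :> R by rewrite invr_gt0.
pose q := x0 + r *: w.
have Oq : Omega q by apply: hw => //; rewrite ?subrr ?normr0// r0 lexx.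
have [A hA] := bireach_Omega e0 Op Oq.
have [r' r'0 br] := Omega_ball Oq.
pose A1 := n%:R * (2 * r') ^+ 2 / (2 * 8^-1) + K0 * 8^-1.
pose A2 := dot (r *: w) (r *: w) / (2 * 8^-1) + K0 * 8^-1.
exists (A + (A1 + A2)); apply/nbhs_normP; exists (Num.min r r'); first by rewrite /= lt_min r0.
move=> x /=; rewrite distrC lt_min => /andP[xr xr'] cx.
have -> : 2^-1 = 4^-1 + (8^-1 + 8^-1) :> R by field.
apply: (bireach_concat (ltW e0) _ hA); first by rewrite addr_ge0 ?ltW.
apply: (@bireach_concat _ _ _ (x + r *: w)); [exact: ltW|exact: ltW| |].
  have d : `|x + r *: w - q| < r' by rewrite opprD addrACA subrr addr0.
  have q0 : `|q - q| < r' by rewrite subrr normr0.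
  by split; [exact: reach_ball f0 br q0 d|exact: reach_ball f0 br d q0].
have seg (s : R) : 0 <= s <= 1 -> closure Omega (x + s *: (r *: w)).
  move=> /andP[s0 s1]; have [->|sn] := eqVneq s 0; first by rewrite scale0r addr0.
  apply: subset_closure; rewrite scalerA; apply: hw => //.
  have sgt : 0 < s by rewrite lt_neqAle eq_sym sn.
  by apply/andP; split; [exact: mulr_gt0|rewrite ler_piMl// ltW].
split.
  have := @reach_segment 8^-1 (x + r *: w) x f0.
  rewrite (_ : x - (x + r *: w) = - (r *: w)); last by rewrite opprD addrA subrr add0r.
  rewrite dotN2; apply => s /andP[s0 s1].
  rewrite scalerN -addrA -[X in X - _]scale1r -scalerBl; apply: seg.
  by rewrite subr_ge0 s1 lerBlDr lerDl.
have := @reach_segment 8^-1 x (x + r *: w) f0.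
by rewrite [x + _]addrC addrK; exact.
Qed.

(** After a lattice translation [x] has norm at most one and [y] at most [D + 1]. On this compact
    part of the closure all points are joined to the hub [p], in both directions, in time one
    half. *)
Lemma connect_unit (D : R) : exists2 C, 0 <= C & forall x y,
  closure Omega x -> closure Omega y -> `|x - y| <= D -> reach 1 x y C.
Proof.
have [p Op] : exists p, Omega p.
  have [x /(bdryE Omega_open)[cx _]] := Omega_bdry_neq0.
  by have /closure_normP/(_ 1 ltr01)[y Oy _] := cx; exists y.
have [||A hA] := @compact_uniform R _ _ (fun A x => closure Omega x -> bireach 2^-1 p x A)
    (compact_closed_bounded (M := D + 1) (@closed_closure _ Omega)).
- by move=> x r r' rr h /h; exact: bireach_le.
- by move=> x [cx _]; exact: bireach_near.
exists (Num.max 0 (A + A)); first by rewrite le_max lexx.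
move=> x y cx cy xy; apply: (@reach_le _ _ _ (A + A)).
  by rewrite le_max lexx orbT.
have [z Zz xz] := nearest_Zlattice x; have Nz := ZlatticeN Zz.
have cx' := closure_translate Omega_periodic Nz cx.
have cy' := closure_translate Omega_periodic Nz cy.
have D0 : 0 <= D by exact: le_trans xy.
have [_ h1] : bireach 2^-1 p (x - z) A.
  by apply: hA => //; split => //=; lra.
have [h2 _] : bireach 2^-1 p (y - z) A.
  apply: hA => //; split => //=; rewrite (_ : y - z = (x - z) - (x - y)).
    by apply: (le_trans (ler_normB _ _)); rewrite addrC lerD.
  by apply/rowP => i; rewrite !mxE; ring.
have e0 : 0 <= 2^-1 :> R by rewrite invr_ge0.
have := reach_translate Zz (reach_concat e0 e0 h1 h2); rewrite !subrK.
by have -> : 2^-1 + 2^-1 = 1 :> R by field.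
Qed.

Lemma reach_closure T x y (A : R) : 0 <= T -> reach T x y A ->
  closure Omega x /\ closure Omega y.
Proof. by move=> T0 [eta [v [l [[_ cl _] <- <- _ _]]]]; split; exact: cl. Qed.

(** A point on the segment from [x] to [y] may lie outside the closure, so the intermediate stop is
    a lattice translate of [x] close to it. The rounding error of at most one is the [+ 1] in the
    distance bound; the last step covers at most [M + 1] plus this error. *)
Lemma reach_nat (M C : R) : 1 <= M ->
  (forall x y, closure Omega x -> closure Omega y -> `|x - y| <= M + 2 -> reach 1 x y C) ->
  forall (N : nat) x y, closure Omega x -> closure Omega y ->
  `|y - x| <= M * N.+1%:R + 1 -> reach N.+1%:R x y (C * N.+1%:R).
Proof.
move=> M1 hC; have M0 : 0 < M by exact: lt_le_trans M1.
elim=> [|N IH] x y cx cy xy.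
  by rewrite mulr1; apply: hC => //; rewrite distrC; lra.
set k := N.+1%:R in IH *; have k0 : 0 < k :> R by rewrite ltr0n.
have E : N.+2%:R = k + 1 :> R by rewrite -natr1.
pose D := M * (k + 1) + 1; have Mk : 0 < M * k by rewrite mulr_gt0.
have D0 : 0 < D by rewrite /D mulrDr; lra.
have hD : `|y - x| <= D by rewrite /D -E.
pose u := (M * k / D) *: (y - x).
have [z Zz uz] := nearest_Zlattice u.
have th : M * k / D + (M + 1) / D = 1 by rewrite -mulrDl /D; field;
  rewrite /D in D0; rewrite gt_eqF//; lra.
have th0 : 0 <= (M + 1) / D by apply: divr_ge0; [lra|exact: ltW].
have uN : `|u| <= M * k.
  have h : 0 <= M * k / D by apply: divr_ge0; exact: ltW.
  rewrite /u normrZ (ger0_norm h) mulrAC ler_pdivrMr//.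
  by apply: ler_wpM2l => //; exact: ltW.
have zN : `|z| <= M * k + 1.
  rewrite (_ : z = u - (u - z)); last by rewrite opprB addrC subrK.
  by apply: (le_trans (ler_normB _ _)); lra.
have cz := closure_translate Omega_periodic Zz cx.
have h1 : reach k x (x + z) (C * k).
  by apply: IH => //; rewrite [x + z]addrC addrK.
have h2 : reach 1 (x + z) y C.
  apply: hC => //; rewrite distrC.
  rewrite (_ : y - (x + z) = ((M + 1) / D) *: (y - x) + (u - z)).
    apply: (le_trans (ler_normD _ _)); rewrite normrZ (ger0_norm th0).
    have : (M + 1) / D * `|y - x| <= M + 1.
      by rewrite mulrAC ler_pdivrMr// ler_wpM2l//; lra.
    lra.
  rewrite addrA -scalerDl [(M + 1) / D + _]addrC th scale1r opprD addrA //.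
rewrite E mulrDr mulr1; exact: reach_concat (ltW k0) ler01 h1 h2.
Qed.

Lemma reach_far (M : R) : exists2 C, 0 <= C & forall t x y, 1 <= t ->
  closure Omega x -> closure Omega y -> `|y - x| <= M * t -> reach t x y (C * t).
Proof.
(* The distance is covered in the integer part of [t], which is at least half of [t]; the rest of
   the time is spent waiting. *)
pose M' := 2 * Num.max 1 M.
have M1 : 1 <= Num.max 1 M by rewrite le_max lexx.
have MM : M <= Num.max 1 M by rewrite le_max lexx orbT.
have [C C0 hC] := connect_unit (M' + 2).
exists (C + K0); first by rewrite addr_ge0// ltW.
move=> t x y t1 cx cy xy; have t0 : 0 <= t by exact: le_trans t1.
have /andP[nt tn] := truncn_itv t0.
have : (0 < Num.truncn t)%N.
  by rewrite -(ltr_nat R); move: tn; rewrite -natr1; lra.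
move: nt tn; case: (Num.truncn t) => // N nt tn _.
have N1 : 1 <= N.+1%:R :> R by rewrite ler1n.
have h1 : reach N.+1%:R x y (C * N.+1%:R).
  apply: (@reach_nat M') => //; first by rewrite /M'; lra.
  apply: (le_trans xy).
  apply: (@le_trans _ _ (Num.max 1 M * t)); first by rewrite ler_wpM2r.
  have : Num.max 1 M * t <= Num.max 1 M * (2 * N.+1%:R).
    rewrite ler_wpM2l//; first by lra.
    by move: tn; rewrite -natr1; lra.
  by rewrite /M'; lra.
have tN : 0 <= t - N.+1%:R by rewrite subr_ge0.
have := reach_concat (ler0n _ _) tN h1 (reach_wait tN cy).
rewrite addrC subrK; apply: reach_le; rewrite mulrDl lerD//.
  by rewrite ler_wpM2l.
by rewrite ler_wpM2l ?(ltW K0_gt0)// lerBlDr lerDl (le_trans _ N1).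
Qed.

(** * Splitting a path into two halves *)

Definition pick_sum (V : nmodType) (x : nat -> bool) (f : nat -> V) (j : nat) : V :=
  \sum_(0 <= i < j) (if x i then f i else 0).

Lemma pick_sumS (V : nmodType) (x : nat -> bool) (f : nat -> V) j :
  pick_sum x f j.+1 = pick_sum x f j + (if x j then f j else 0).
Proof. by rewrite /pick_sum big_nat_recr. Qed.

(* A maximal block of consecutive selected indices begins at [j]. *)
Definition starts (x : nat -> bool) (j : nat) : bool :=
  if j is i.+1 then x i.+1 && ~~ x i else x 0%N.

Definition restarts (x : nat -> bool) (j : nat) : nat := \sum_(0 <= i < j) starts x i.

Lemma restartsS (x : nat -> bool) j : restarts x j.+1 = (restarts x j + starts x j)%N.
Proof. by rewrite /restarts big_nat_recr. Qed.

Lemma restarts_le (x : nat -> bool) q :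
  (restarts x q <= (\sum_(0 <= j < q) (x j != x j.+1)).+1)%N.
Proof.
rewrite /restarts; case: q => [|q]; first by rewrite big_geq.
rewrite big_nat_recl// [X in (_ <= X.+1)%N]big_nat_recr//=.
have : (\sum_(0 <= i < q) (x i.+1 && ~~ x i) <= \sum_(0 <= i < q) (x i != x i.+1))%N.
  by apply: leq_sum => i _; case: (x i); case: (x i.+1).
by case: (x 0%N); lia.
Qed.

(** Within a block of selected pieces each piece, translated by the same lattice vector, starts
    where the previous one ends. At the start of a block the path moves in unit time to a translate
    of [pt j] at distance at most one, which costs [C] and shifts the displacement by at most
    one. *)
Lemma assemble (C tau : R) (pt : nat -> 'rV[R]_n) (a : nat -> R) (x : nat -> bool) p q :
  (forall x y, closure Omega x -> closure Omega y -> `|x - y| <= 1 -> reach 1 x y C) ->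
  0 <= tau -> closure Omega p ->
  (forall j, (j < q)%N -> reach tau (pt j) (pt j.+1) (a j)) ->
  exists e, let c : R := (restarts x q)%:R in
    reach (pick_sum x (fun=> tau) q + c) p e (pick_sum x a q + C * c) /\
    `|e - (p + pick_sum x (fun j => pt j.+1 - pt j) q)| <= c.
Proof.
move=> hC t0 cp hr.
(* The last clause states that after a selected piece the current end is a translate of [pt j], so
   the next selected piece attaches without gluing. *)
suff h j : (j <= q)%N -> exists e, let c : R := (restarts x j)%:R in
    [/\ closure Omega e, 
      reach (pick_sum x (fun=> tau) j + c) p e (pick_sum x a j + C * c),
      `|e - (p + pick_sum x (fun j => pt j.+1 - pt j) j)| <= c &
      (0 < j)%N -> x j.-1 -> exists2 z, Zlattice z & e = pt j + z].
  by have [e [_ h1 h2 _]] := h q (leqnn q); exists e.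
have ps0 i : 0 <= pick_sum x (fun=> tau) i.
  by apply: sumr_ge0 => k _; case: (x k).
elim: j => [_|j IH jq].
  exists p; rewrite /pick_sum /restarts !big_geq//= mulr0 !addr0 subrr normr0; split => //.
  by rewrite -[X in reach _ _ _ X](mulr0 K0); exact: reach_wait.
have [e [ce re de ze]] := IH (ltnW jq).
rewrite restartsS natrD !pick_sumS.
set c : R := (restarts x j)%:R in re de *.
set T := pick_sum _ _ j in re *; set S := pick_sum _ _ j in de *.
set A := pick_sum _ _ j in re *.
have c0 : 0 <= c by exact: ler0n.
have Tc0 : 0 <= T + c by rewrite addr_ge0 ?ps0.
have [cj cj1] := reach_closure t0 (hr j jq).
case xj: (x j); last first.
  have -> : starts x j = false by case: (j) xj => //= i ->.
  by exists e; rewrite !addr0; split => //= _; rewrite xj.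
case sj: (starts x j).
  have [z Zz ez] := nearest_Zlattice (e - pt j).
  have cz := closure_translate Omega_periodic Zz cj.
  have r1 : reach 1 e (pt j + z) C by apply: hC => //; rewrite opprD addrA.
  have r2 := reach_translate Zz (hr j jq).
  exists (pt j.+1 + z); split.
  - exact: closure_translate.
  - have := reach_concat (addr_ge0 Tc0 ler01) t0 (reach_concat Tc0 ler01 re r1) r2.
    have -> : T + c + 1 + tau = T + tau + (c + true%:R) by rewrite /=; ring.
    by have -> : A + C * c + C + a j = A + a j + C * (c + true%:R) by rewrite /=; ring.
  - rewrite (_ : _ - _ = (e - (p + S)) - (e - pt j - z)).
      by apply: (le_trans (ler_normB _ _)); exact: lerD.
    by apply/rowP => i; rewrite !mxE; ring.
  - by move=> _ _; exists z.
have jgt : (0 < j)%N by case: (j) sj xj => //= ->.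
have xj1 : x j.-1 by case: (j) jgt sj xj => //= i _ h xi; move: h; rewrite xi; case: (x i).
have [z Zz ez] := ze jgt xj1.
have r2 := reach_translate Zz (hr j jq); rewrite -ez in r2.
exists (pt j.+1 + z); rewrite addr0; split.
- exact: closure_translate.
- by rewrite addrAC [A + a j + _]addrAC; exact: reach_concat Tc0 t0 re r2.
- rewrite (_ : _ - _ = e - (p + S)) => //.
  by rewrite ez; apply/rowP => i; rewrite !mxE; ring.
- by move=> _ _; exists z.
Qed.

Lemma pick_sumC (V : nmodType) (x : nat -> bool) (f : nat -> V) q :
  pick_sum x f q + pick_sum (fun j => ~~ x j) f q = \sum_(0 <= j < q) f j.
Proof.
rewrite /pick_sum -big_split; apply: eq_bigr => j _ /=.
by case: (x j); rewrite ?addr0 ?add0r.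
Qed.

Lemma pick_sumD (V : nmodType) (x : nat -> bool) (f h : nat -> V) q :
  pick_sum x (fun j => f j + h j) q = pick_sum x f q + pick_sum x h q.
Proof.
rewrite /pick_sum -big_split; apply: eq_bigr => j _ /=.
by case: (x j); rewrite ?addr0.
Qed.

Lemma pick_sum_coord (x : nat -> bool) (f : nat -> 'rV[R]_n) q k :
  pick_sum x f q 0 k = pick_sum x (fun j => f j 0 k) q.
Proof. by rewrite /pick_sum summxE; apply: eq_bigr => j _; case: (x j); rewrite ?mxE. Qed.

(** Each of the [n.+1] measures has pieces of weight at most 2, hence an error of [2 * n.+1]. A
    displacement is the difference of two of these measures, so its error doubles. *)
Lemma half_selection (pt : nat -> 'rV[R]_n) q :
  (forall j, (j < q)%N -> `|pt j.+1 - pt j| <= 1) ->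
  exists x : nat -> bool,
    (\sum_(0 <= j < q) (x j != x j.+1) <= n.+1.*2.+1)%N /\
    `|pick_sum x (fun=> 1 : R) q - q%:R / 2| <= 2 * n.+1%:R /\
    `|pick_sum x (fun j => pt j.+1 - pt j) q - 2^-1 *: (pt q - pt 0%N)| <= 4 * n.+1%:R.
Proof.
move=> hpt; pose D j := pt j.+1 - pt j.
have hD j k : (j < q)%N -> `|D j 0 k| <= 1.
  by move=> jq; rewrite (le_trans (coord_le_norm _ _))//; exact: hpt.
(* One measure counts the pieces; the others are their coordinate displacements,
   shifted by 1 to be nonnegative. *)
pose w (i : 'I_n.+1) j : R := if (j < q)%N then
  (if unlift ord0 i is Some k then 1 + D j 0 k else 1) else 0.
have w0 i j : 0 <= w i j.
  rewrite /w; case: ifP => // jq; case: unlift => [k|] //.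
  by have := hD j k jq; rewrite ler_norml => /andP[]; lra.
have w2 i j : w i j <= 2.
  rewrite /w; case: ifP => // jq; case: unlift => [k|]; last by rewrite ler1n.
  by have := hD j k jq; rewrite ler_norml => /andP[]; lra.
have [x [chx hx]] := halving q w0 w2.
exists x; split => //.
have wE i : \sum_(0 <= j < q | x j) w i j = pick_sum x (w i) q.
  by rewrite /pick_sum big_mkcond.
have h0 := hx ord0.
have E0 : pick_sum x (w ord0) q = pick_sum x (fun=> 1 : R) q.
  by apply: eq_big_nat => j /andP[_ jq]; rewrite /w jq unlift_none.
have F0 : \sum_(0 <= j < q) w ord0 j = q%:R.
  rewrite (@eq_big_nat _ _ _ _ _ _ (fun=> 1 : R)) ?sumr_const_nat ?subn0//.
  by move=> j /andP[_ jq]; rewrite /w jq unlift_none.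
rewrite wE E0 F0 [_ * 2]mulrC in h0; split => //.
apply: norm_le_coord => [|k]; first by rewrite mulr_ge0.
have hk := hx (lift ord0 k).
have Ek : pick_sum x (w (lift ord0 k)) q = pick_sum x (fun=> 1 : R) q + pick_sum x D q 0 k.
  rewrite pick_sum_coord -pick_sumD.
  by apply: eq_big_nat => j /andP[_ jq]; rewrite /w jq liftK.
have Fk : \sum_(0 <= j < q) w (lift ord0 k) j = q%:R + (pt q 0 k - pt 0%N 0 k).
  rewrite -(telescope_sumr (fun j => pt j 0 k))// -{1}[q%:R]F0 -big_split.
  apply: eq_big_nat => j /andP[_ jq]; rewrite /w jq liftK unlift_none /D.
  by rewrite !mxE.
rewrite wE Ek Fk [_ * 2]mulrC in hk; rewrite !mxE.
move: h0 hk; rewrite !ler_norml => /andP[a1 a2] /andP[a3 a4].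
by apply/andP; split; lra.
Qed.

Lemma integral_on_chain f (tau : R) q : 0 <= tau ->
  integrable_on 0 (q%:R * tau) f ->
  \sum_(0 <= j < q) integral_on (j%:R * tau) (j.+1%:R * tau) f = integral_on 0 (q%:R * tau) f.
Proof.
move=> t0; elim: q => [|q IH] i.
  by rewrite big_geq// mul0r /integral_on set_itv1 Rintegral_set1.
have qq : q%:R * tau <= q.+1%:R * tau :> R by rewrite ler_wpM2r// ler_nat.
have q0 : 0 <= q%:R * tau by rewrite mulr_ge0.
rewrite big_nat_recr//= (integral_on_split q0 qq i) IH//.
by apply: integrable_onS i.
Qed.

Lemma halve : exists Th C : R, forall S xh yh A p z, 0 < S -> reach S xh yh A ->
  closure Omega p -> Zlattice z -> `|z - 2^-1 *: (yh - xh)| <= 3 ->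
  exists T1 T2 B1 B2, [/\ 0 <= T1 /\ 0 <= T2, `|T1 - S / 2| <= Th /\ `|T2 - S / 2| <= Th,
    reach T1 p (p + z) B1, reach T2 p (p + z) B2 & B1 + B2 <= A + C].
Proof.
have [C1 C10 hC1] := connect_unit 1.
(* A bound for the number of blocks: at most [n.+1.*2.+1] changes, plus one for a first block
   starting at index zero. *)
pose K : R := n.+1.*2.+2%:R.
(* The distance left for the final connection: the target is off by 3, the selection by [4 * n.+1],
   the gluing by [K]. *)
have [C2 C20 hC2] := connect_unit (3 + 4 * n.+1%:R + K).
exists (2 * n.+1%:R + K + 1), (2 * (C1 * K + C2)).
move=> S xh yh A p z S0 [eta [v [l [tr e0 eS ic ia]]]] cp Zz hz.
have [[AC _ _] _ _] := tr.
have [d d0 hd] := AC S (ltW S0) 1 ltr01.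
(* Pieces shorter than [d] move by less than one, and those shorter than one keep the error in time
   bounded. The number [q] of pieces depends on the path and enters no constant. *)
pose m := Num.min d 1; have m0 : 0 < m by rewrite lt_min d0 ltr01.
pose q := (Num.truncn (S / m)).+1.
have q0 : 0 < q%:R :> R by rewrite ltr0n.
pose tau := S / q%:R; have t0 : 0 < tau by rewrite divr_gt0.
have tm : tau < m.
  have /andP[_] := truncn_itv (ltW (divr_gt0 S0 m0)).
  by rewrite /tau ltr_pdivrMr// ltr_pdivrMr// mulrC.
have t1 : tau <= 1 by rewrite ltW// (lt_le_trans tm)// ge_min lexx orbT.
have qt : q%:R * tau = S by rewrite /tau mulrC divfK// gt_eqF.
pose pt j := eta (j%:R * tau).
have step j : (j < q)%N -> [/\ 0 <= j%:R * tau, j%:R * tau <= j.+1%:R * tau & j.+1%:R * tau <= S].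
  move=> jq; split; first by rewrite mulr_ge0// ltW.
    by rewrite ler_pM2r// ler_nat.
  by rewrite -qt ler_pM2r// ler_nat.
have stepE j : j.+1%:R * tau - j%:R * tau = tau.
  by rewrite -mulrBl -natr1 addrC addKr mul1r.
have hpt j : (j < q)%N -> `|pt j.+1 - pt j| <= 1.
  move=> jq; have [a1 a2 a3] := step j jq; apply: (le_trans (norm_le_enorm _)); apply: ltW.
  have := hd 1%N (fun=> j%:R * tau) (fun=> j.+1%:R * tau); rewrite !big_ord1; apply.
  - by move=> _; split.
  - by move=> i k _ _ _; rewrite !ord1.
  - by rewrite stepE (lt_le_trans tm)// ge_min lexx.
pose a j := integral_on (j%:R * tau) (j.+1%:R * tau) (cost eta v l).
have hr j : (j < q)%N -> reach tau (pt j) (pt j.+1) (a j).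
  move=> jq; have [a1 a2 a3] := step j jq; rewrite -(stepE j).
  by apply: reach_sub => //; [rewrite a1|exact: integrable_onS ic].
have sa : \sum_(0 <= j < q) a j <= A.
  by rewrite integral_on_chain ?qt// ltW.
have [x [chx [hx1 hx2]]] := half_selection hpt.
pose x' j := ~~ x j.
have chx' : (\sum_(0 <= j < q) (x' j != x' j.+1) <= n.+1.*2.+1)%N.
  apply: leq_trans chx; apply: leq_sum => j _.
  by rewrite /x'; case: (x j); case: (x j.+1).
have hx1' : `|pick_sum x' (fun=> 1 : R) q - q%:R / 2| <= 2 * n.+1%:R.
  have := pick_sumC x (fun=> 1 : R) q; rewrite sumr_const_nat subn0 -/x' => E.
  move: hx1; rewrite !ler_norml => /andP[b1 b2].
  by apply/andP; split; lra.
have hx2' : `|pick_sum x' (fun j => pt j.+1 - pt j) q - 2^-1 *: (pt q - pt 0%N)| <= 4 * n.+1%:R.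
  have := pick_sumC x (fun j => pt j.+1 - pt j) q; rewrite telescope_sumr// -/x' => E.
  rewrite (_ : pick_sum x' _ q - _ =
    - (pick_sum x (fun j => pt j.+1 - pt j) q - 2^-1 *: (pt q - pt 0%N))).
    by rewrite normrN.
  by rewrite -E; apply/rowP => k; rewrite !mxE; field.
have half (s : nat -> bool) : (\sum_(0 <= j < q) (s j != s j.+1) <= n.+1.*2.+1)%N ->
    `|pick_sum s (fun=> 1 : R) q - q%:R / 2| <= 2 * n.+1%:R ->
    `|pick_sum s (fun j => pt j.+1 - pt j) q - 2^-1 *: (pt q - pt 0%N)| <= 4 * n.+1%:R ->
    exists2 T, 0 <= T /\ `|T - S / 2| <= 2 * n.+1%:R + K + 1 &
      reach T p (p + z) (pick_sum s a q + (C1 * K + C2)).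
  move=> chs hs1 hs2.
  have [e [re de]] := assemble s hC1 (ltW t0) cp hr.
  set c : R := (restarts s q)%:R in re de.
  have c0 : 0 <= c by exact: ler0n.
  have cK : c <= K by rewrite ler_nat (leq_trans (restarts_le s q)).
  set U := pick_sum s (fun=> tau) q in re.
  have UE : U = tau * pick_sum s (fun=> 1 : R) q.
    by rewrite /pick_sum mulr_sumr; apply: eq_bigr => j _; case: (s j); rewrite ?mulr1 ?mulr0.
  have N0 : 0 <= pick_sum s (fun=> 1 : R) q by apply: sumr_ge0 => j _; case: (s j).
  have U0 : 0 <= U by rewrite UE mulr_ge0// ltW.
  have US : `|U - S / 2| <= 2 * n.+1%:R.
    rewrite UE -qt -[_ * tau / 2]mulrA [_ * (tau / 2)]mulrCA -mulrBr normrM (gtr0_norm t0).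
    by rewrite (le_trans _ hs1)// ler_piMl.
  have Uc0 : 0 <= U + c by rewrite addr_ge0.
  have [_ ce] := reach_closure Uc0 re.
  have re2 : reach 1 e (p + z) C2.
    apply: hC2 => //; first exact: closure_translate.
    rewrite (_ : e - (p + z) = (e - (p + pick_sum s (fun j => pt j.+1 - pt j) q)) +
        ((pick_sum s (fun j => pt j.+1 - pt j) q - 2^-1 *: (pt q - pt 0%N)) -
         (z - 2^-1 *: (yh - xh)))).
      apply: (le_trans (ler_normD _ _)).
      have := ler_normB (pick_sum s (fun j => pt j.+1 - pt j) q - 2^-1 *: (pt q - pt 0%N))
        (z - 2^-1 *: (yh - xh)); lra.
    rewrite /pt qt mul0r e0 eS.
    by apply/rowP => k; rewrite !mxE; ring.
  exists (U + c + 1).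
    split; first by rewrite addr_ge0.
    rewrite -[U + c + 1]addrA [U + _ - _]addrAC (le_trans (ler_normD _ _))// -addrA lerD//.
    by rewrite ger0_norm ?addr_ge0// lerD2r.
  apply: reach_le (reach_concat Uc0 ler01 re re2).
  by rewrite -addrA lerD2l lerD2r ler_wpM2l.
have [T1 [hT1 hS1] r1] := half x chx hx1 hx2.
have [T2 [hT2 hS2] r2] := half x' chx' hx1' hx2'.
exists T1, T2, (pick_sum x a q + (C1 * K + C2)), (pick_sum x' a q + (C1 * K + C2)).
split => //; have := pick_sumC x a q; rewrite -/x'; lra.
Qed.

(** * Gaining time by a shortcut *)

Lemma integral_on_addr f (C a c : R) : a <= c -> integrable_on a c f ->
  integrable_on a c (fun s => f s + C) /\
  integral_on a c (fun s => f s + C) = integral_on a c f + C * (c - a).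
Proof.
move=> ac i; split; last first.
  rewrite -integral_on_cst// /integral_on -RintegralD//.
  exact: integrable_on_cst.
rewrite /integrable_on (_ : EFin \o _ = (EFin \o f) \+ (EFin \o cst C))%E//.
by apply: integrableD => //; exact: integrable_on_cst.
Qed.

Lemma cheap_chunk f (L : R) m : 0 <= L -> (0 < m)%N -> integrable_on 0 (m%:R * L) f ->
  exists2 j, (j < m)%N &
    integral_on (j%:R * L) (j.+1%:R * L) f * m%:R <= integral_on 0 (m%:R * L) f.
Proof.
move=> L0 m0 i; apply: contrapT => h; have m0' : 0 < m%:R :> R by rewrite ltr0n.
pose M := integral_on 0 (m%:R * L) f / m%:R.
have lt j : (j < m)%N -> M < integral_on (j%:R * L) (j.+1%:R * L) f.
  move=> jm; rewrite ltNge; apply/negP => le; apply: h; exists j => //.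
  by rewrite -ler_pdivlMr.
have : \sum_(0 <= j < m) M < \sum_(0 <= j < m) integral_on (j%:R * L) (j.+1%:R * L) f.
  rewrite !big_mkord; apply: ltr_sum => [|j _]; last exact: lt.
  by apply/hasP; exists (Ordinal m0) => //; rewrite mem_index_enum.
by rewrite integral_on_chain// sumr_const_nat subn0 -[M *+ m]mulr_natr /M divfK ?gt_eqF// ltxx.
Qed.

(** The cost raised by [C0] is nonnegative and integrates to at most [Q * t]. The [m] windows of
    length [L] cover at least time [t], so in one of them it integrates to at most [Q * L], which
    bounds the displacement. The window itself costs at least [- C0 * L], so its removal loses no
    more than that. *)
Lemma skip_chunk (P L : R) : 0 <= P -> 0 < L -> exists C, forall t xh yh A,
  L <= 2 * t -> A <= P * t -> reach (2 * t) xh yh A ->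
  reach (2 * t - L + 1) xh yh (A + C).
Proof.
move=> P0 L0; have [C0 C00 hC'] := lagr_lower; have hC : lower_const C0 by split.
pose Q := P + 2 * C0; have Q0 : 0 <= Q by rewrite addr_ge0// mulr_ge0// ltW.
have [C1 C10 hC1] := connect_unit (Q * L).
exists (C0 * L + C1) => t xh yh A Lt At [eta [v [l [tr e0 e1 ic ia]]]].
have t0 : 0 < t by rewrite -(pmulr_rgt0 _ (ltr0Sn R 1)); exact: lt_le_trans Lt.
have tt0 : 0 <= 2 * t by rewrite mulr_ge0// ltW.
have /andP[m1 m2] := truncn_itv (divr_ge0 tt0 (ltW L0)).
move: m1 m2; set m := Num.truncn _ => m1 m2.
have m0 : (0 < m)%N.
  rewrite -ltnS -(ltr_nat R); apply: le_lt_trans m2.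
  by rewrite ler_pdivlMr// mul1r.
have mR : 1 <= m%:R :> R by rewrite ler1n.
have mL : m%:R * L <= 2 * t by rewrite -ler_pdivlMr.
have tm : t <= m%:R * L.
  move: m2; rewrite ltr_pdivrMr// -natr1 mulrDl mul1r => h.
  have : L <= m%:R * L by rewrite ler_peMl// ltW.
  lra.
have mL0 : 0 <= m%:R * L by rewrite mulr_ge0// ltW.
pose f s := cost eta v l s + C0.
have [icC icE] := integral_on_addr C0 tt0 ic.
have icm : integrable_on 0 (m%:R * L) f by apply: integrable_onS icC.
have tot : integral_on 0 (m%:R * L) f <= Q * t.
  have := integral_on_split mL0 mL icC; rewrite icE subr0 -/f => E.
  have : 0 <= integral_on (m%:R * L) (2 * t) f.
    apply: le_trans (traj_component hC tr _ _); [exact: normr_ge0|by rewrite mL0|].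
    by apply: integrable_onS ic.
  have -> : Q * t = P * t + C0 * (2 * t) by rewrite /Q; ring.
  move: E At ia; clearbody f m; move: (integral_on _ _ _) (integral_on _ _ _).
  move: (integral_on _ _ _) (C0 * _) (P * t) => I1 Pt I2 I3 I4 E h1 h2 h3; lra.
have [j jm cheap] := cheap_chunk (ltW L0) m0 icm.
pose a := j%:R * L; pose c := j.+1%:R * L.
have a0 : 0 <= a by rewrite mulr_ge0// ltW.
have cE : c = a + L by rewrite /c /a -natr1 mulrDl mul1r.
have ac : a <= c by rewrite cE lerDl ltW.
have ct : c <= 2 * t by rewrite (le_trans _ mL)// ler_wpM2r ?(ltW L0)// ler_nat.
have c0 : 0 <= c by exact: le_trans ac.
have at2 : a <= 2 * t by exact: le_trans ct.
have i1 : integrable_on 0 a (cost eta v l) by apply: integrable_onS ic.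
have i2 : integrable_on a c (cost eta v l) by apply: integrable_onS ic.
have i3 : integrable_on c (2 * t) (cost eta v l) by apply: integrable_onS ic.
have i23 : integrable_on a (2 * t) (cost eta v l) by apply: integrable_onS ic.
have d : `|eta c - eta a| <= Q * L.
  apply: (le_trans (traj_component hC tr _ i2)); first by rewrite a0.
  have : integral_on a c f * m%:R <= Q * L * m%:R.
    apply: (le_trans cheap); apply: (le_trans tot).
    by rewrite -mulrA ler_wpM2l// mulrC.
  by rewrite ler_pM2r// (lt_le_trans ltr01 mR).
have := reach_sub tr (introT andP (conj (lexx 0) a0)) i1; rewrite subr0 e0 => r1.
have := reach_sub tr (introT andP (conj c0 ct)) i3; rewrite e1 => r3.
have [_ cl _] := tr.
have r2 : reach 1 (eta a) (eta c) C1.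
  by apply: hC1; [exact: cl|exact: cl|rewrite distrC].
have s1 := integral_on_split a0 at2 ic; have s2 := integral_on_split ac ct i23.
have low := integral_cost_ge hC tr (introT andP (conj a0 ac)) i2.
have tc : 0 <= 2 * t - c by rewrite subr_ge0.
have := reach_concat (addr_ge0 a0 ler01) tc (reach_concat a0 ler01 r1 r2) r3.
have -> : a + 1 + (2 * t - c) = 2 * t - L + 1 by rewrite cE; ring.
have cL : c - a = L by rewrite cE addrC addKr.
apply: reach_le; rewrite cL mulNr in low; move: low ia; rewrite s1 s2.
move: (integral_on 0 a _) (integral_on a c _) (integral_on c _ _) (C0 * L).
by move=> I1 I2 I3 x h1 h2; lra.
Qed.

Lemma halving_estimate (M : R) : exists2 C, 0 < C & forall t y xh yh A p z,
  1 <= t -> `|y| <= M * t -> `|xh| <= 1 -> `|yh - 2 *: y| <= 1 ->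
  closure Omega p -> Zlattice z -> `|p| <= 1 -> `|p + z - y| <= 1 ->
  reach (2 * t) xh yh A ->
  exists2 B, reach t p (p + z) B & 2 * B <= A + C.
Proof.
have [C0 C00 hC'] := lagr_lower; have hC : lower_const C0 by split.
have [C1 C10 far] := reach_far (M + 2).
have [Th' [Ch hv]] := halve; pose Th := Num.max 0 Th'.
have Th0 : 0 <= Th by rewrite le_max lexx.
have ThT : Th' <= Th by rewrite le_max lexx orbT.
have P0 : 0 <= 2 * C1 by rewrite mulr_ge0.
have L0 : 0 < 2 * Th + 1 by rewrite ltr_wpDl// mulr_ge0.
have [Cs skip] := skip_chunk P0 L0.
pose t0 := Th + 1; have t00 : 0 < t0 by rewrite ltr_wpDl.
have Q0 : 0 < 2 * (C1 + C0) * t0 by rewrite mulr_gt0// mulr_gt0// ltr_wpDl.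
have KT : 0 <= 4 * (K0 * Th) by rewrite mulr_ge0// mulr_ge0// ltW.
exists (2 * (C1 + C0) * t0 + `|Cs + Ch| + 4 * (K0 * Th)).
  by rewrite -addrA ltr_wpDr// addr_ge0.
move=> t y xh yh A p z t1 yM xh1 yh1 cp Zz p1 pz r.
have abs := normr_ge0 (Cs + Ch); have abs' := ler_norm (Cs + Ch).
have tt : 0 <= t by exact: le_trans t1.
have cpz := closure_translate Omega_periodic Zz cp.
have far' : reach t p (p + z) (C1 * t).
  apply: far => //; rewrite addrC addKr.
  rewrite (_ : z = (p + z - y) + (y - p)); last by apply/rowP => k; rewrite !mxE; ring.
  have := ler_normD (p + z - y) (y - p); have := ler_normB y p.
  by rewrite mulrDl; lra.
(* A given path that is this expensive is beaten by a direct connection; otherwise its cost is at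
   most a multiple of [t], as the shortcut requires. *)
have [At|At] := leP (2 * C1 * t) A.
  by exists (C1 * t) => //; move: At Q0 KT abs; rewrite -mulrA; lra.
(* For bounded [t] the direct connection is good enough, since [A] is at least [- C0 * (2 * t)]. *)
have [tt0|tt0] := leP t t0.
  exists (C1 * t) => //.
  have low : - C0 * (2 * t) <= A.
    have [eta [v [l [tr e0 e1 ic ia]]]] := r; apply: le_trans ia.
    have := integral_cost_ge hC tr _ ic; rewrite subr0; apply.
    by rewrite lexx mulr_ge0.
  have : (C1 + C0) * t <= (C1 + C0) * t0 by rewrite ler_wpM2l// addr_ge0// ltW.
  by move: low KT abs; rewrite mulNr !mulrDl !mulrDr !mulrDl !mulrA; lra.
(* A window of length [2 * Th + 1] is traded for one unit of time, so each half is aimed at duration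
   [t - Th] and lasts at most [t]. *)
have r' : reach (2 * t - 2 * Th) xh yh (A + Cs).
  have := skip t xh yh A; rewrite opprD addrA subrK; apply => //; last exact: ltW.
  by move: tt0; rewrite /t0; lra.
have S0 : 0 < 2 * t - 2 * Th by move: tt0; rewrite /t0; lra.
have dz : `|z - 2^-1 *: (yh - xh)| <= 3.
  rewrite (_ : _ - _ = (p + z - y) - p - 2^-1 *: ((yh - 2 *: y) - xh)).
    have := ler_normB (p + z - y - p) (2^-1 *: (yh - 2 *: y - xh)).
    rewrite normrZ ger0_norm ?invr_ge0//.
    have := ler_normB (p + z - y) p; have := ler_normB (yh - 2 *: y) xh; lra.
  by apply/rowP => k; rewrite !mxE; field.
have [T1 [T2 [B1 [B2 [[T10 T20] [h1 h2] r1 r2 B12]]]]] := hv _ _ _ _ _ _ S0 r' cp Zz dz.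
have wait T B : 0 <= T -> `|T - (2 * t - 2 * Th) / 2| <= Th' -> reach T p (p + z) B ->
    reach t p (p + z) (B + 2 * (K0 * Th)).
  move=> T0; rewrite ler_norml => /andP[a1 a2] rT.
  have tT : 0 <= t - T by lra.
  have := reach_concat T0 tT rT (reach_wait tT cpz); rewrite addrC subrK.
  apply: reach_le; rewrite lerD2l mulrCA ler_wpM2l ?(ltW K0_gt0)//; lra.
have := wait _ _ T10 h1 r1; have := wait _ _ T20 h2 r2 => w2 w1.
(* The cheaper half costs at most half of [B1 + B2]; waiting adds at most [2 * (K0 * Th)] to it. *)
have [B1B2|B2B1] := leP B1 B2; [exists (B1 + 2 * (K0 * Th))|exists (B2 + 2 * (K0 * Th))] => //.
  by move: Q0 KT abs'; lra.
by move: Q0 KT abs'; lra.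
Qed.

(** * Passage to the extended metric *)

Lemma bdry_near p y : bdry Omega p -> exists z, Zlattice z /\ unit_cell (p + z - y).
Proof.
move=> Bp; pose k := \row_i Num.floor (y 0 i - p 0 i + 2^-1).
exists (map_mx intr k); split; first by exists k.
move=> i; rewrite !mxE.
have := floor_itv (y 0 i - p 0 i + 2^-1); rewrite intrD1 => /andP[h1 h2].
by apply/andP; split; lra.
Qed.

Lemma unit_cell_norm x : unit_cell x -> `|x| <= 2^-1.
Proof.
move=> ux; apply: norm_le_coord => [|i]; first by rewrite invr_ge0.
by rewrite ler_norml; exact: ux.
Qed.

(** The estimate is proved for every competitor of duration [2 * t], always with the same admissible
    ends [p] and [p + z] for the half; taking infima then needs no minimizer, and competitors of
    infinite action are trivial. *)
Lemma ext_metric_halving (M : R) : exists2 C : R, 0 < C &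
  forall (t : R) y, 1 <= t -> enorm y <= M * t ->
    (2%:E * ext_metric Omega H gamma g theta b t 0 y
      <= ext_metric Omega H gamma g theta b (2 * t) 0 (2 *: y) + C%:E)%E.
Proof.
have [C C0 est] := halving_estimate M; exists C => // t y t1 yM.
have tt : 0 <= t by exact: le_trans t1.
have [p0 Bp0] := Omega_bdry_neq0.
have [z0 [Zz0 u0]] := bdry_near 0 Bp0; pose p := p0 + z0.
have Bp : bdry Omega p by exact: bdry_translate.
have [z [Zz u]] := bdry_near y Bp.
have Bpz : bdry Omega (p + z) by exact: bdry_translate.
rewrite -leeBlDr//; apply: le_ereal_inf_tmp => _ [xh [yh [Bx By ux uy ->]]].
apply: le_ereal_inf_tmp => _ [eta [v [l [sp ey ->]]]].
have [ex tr] := (SP_traj _ _ _ _).1 sp.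
have tt2 : 0 <= 2 * t by rewrite mulr_ge0.
have [->|[ic ->]] := action_cases tr tt2; first by rewrite leey.
have r : reach (2 * t) xh yh (integral_on 0 (2 * t) (cost eta v l)).
  by exists eta, v, l; split.
have half1 (x : 'rV[R]_n) : unit_cell x -> `|x| <= 1.
  by move=> /unit_cell_norm h; lra.
have [B rB hB] : exists2 B, reach t p (p + z) B &
    2 * B <= integral_on 0 (2 * t) (cost eta v l) + C.
  apply: (est t y xh yh _ p z) => //.
  - by apply: le_trans yM; exact: norm_le_enorm.
  - by apply: half1; move: ux; rewrite subr0.
  - exact: half1.
  - by case: Bp.
  - by apply: half1; move: u0; rewrite subr0.
  - exact: half1.
have le1 : (ext_metric Omega H gamma g theta b t 0 y <= B%:E)%E.
  apply: le_trans (reach_metric tt rB); apply: ereal_inf_lbound.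
  by exists p, (p + z); split => //; rewrite subr0; move: u0; rewrite subr0.
rewrite leeBlDr//; apply: (@le_trans _ _ (2%:E * B%:E)%E).
  by apply: lee_wpmul2l.
by rewrite -EFinM -EFinD lee_fin.
Qed.

End Trajectories.

Unset Implicit Arguments.
Set Strict Implicit.
Set Printing Implicit Defensive.

Theorem lemma4p7 (R : realType) (n : nat) (Omega : set 'rV[R]_n)
    (H : 'rV[R]_n -> 'rV[R]_n -> R) (K0 : R) (u0 : 'rV[R]_n -> R)
    (gamma : 'rV[R]_n -> 'rV[R]_n) (g theta : 'rV[R]_n -> R)
    (b : bc) (M0 : R)
    (n_ge2 : (2 <= n)%N)
    (Omega_open : open Omega)
    (Omega_connected : connected Omega)
    (Omega_bdry_neq0 : bdry Omega !=set0)
    (Omega_C1 : C1_boundary Omega)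
    (Omega_periodic : [set x + z | x in Omega & z in @Zlattice R n] = Omega)
    (H_continuous : continuous (fun yp : 'rV[R]_n * 'rV[R]_n => H yp.1 yp.2))
    (H_periodic : forall p, Zperiodic_on setT (fun y => H y p))
    (H_convex : forall y, convex_function [set: 'rV[R]_n] (H y))
    (K0_gt0 : 0 < K0)
    (H_growth : forall y p,
       enorm p ^+ 2 / 2 - K0 <= H y p <= enorm p ^+ 2 / 2 + K0)
    (u0_bounded : [bounded u0 x | x in [set: 'rV[R]_n]])
    (u0_unif_continuous : unif_continuous u0)
    (u0_lipschitz : [lipschitz u0 x | x in [set: 'rV[R]_n]])
    (gamma_continuous : {within bdry Omega, continuous gamma})
    (gamma_periodic : Zperiodic_on (bdry Omega) gamma)
    (gamma_outward : forall y, bdry Omega y ->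
       0 < dot (gamma y) (outward_normal Omega y))
    (g_continuous : {within bdry Omega, continuous g})
    (g_periodic : Zperiodic_on (bdry Omega) g)
    (theta_range : forall y, pi / 2 <= theta y < pi)
    (theta_continuous : continuous theta)
    (theta_periodic : Zperiodic_on setT theta)
    (M0_gt0 : 0 < M0)
    (M0_bound : minimizer_bound Omega H u0 gamma g theta b M0) :
  exists2 C : R, 0 < C &
    forall (t : R) (y : 'rV[R]_n), 1 <= t -> enorm y <= M0 * t ->
      (2%:E * ext_metric Omega H gamma g theta b t 0 y
        <= ext_metric Omega H gamma g theta b (2 * t) 0 (2 *: y) + C%:E)%E.
Proof.
by apply: (@ext_metric_halving R n Omega H K0); assumption.
Qed.
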